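(* Let $k$ be an even non-negative integer, and let $\chi_1,\chi_2$ be primitive Dirichlet characters modulo $p$ and $q$ respectively, such that one of them is a non-principal even character and the other is an odd character. Let $a,x>0$. Then for every complex $\nu$ with $\Re(\nu)>0$, \begin{align*} \sum_{n=1}^\infty \sigma_{k,\chi_1,\chi_2}(n)n^{\frac{\nu}{2}}K_\nu(a\sqrt{nx})=\frac{(-1)^{\frac{k}{2}} (aq)^{\nu} p^{\nu+k} x^{\frac{\nu}{2}}}{i\,2^{3\nu+k+2}\pi^{2\nu+k+1}} \tau(\chi_1)\tau(\chi_2) \Gamma(\nu+k+1)\sum_{n=1}^\infty \frac{\sigma_{k,\bar{\chi}_2,\bar{\chi}_1}(n)}{\left( n+\frac{a^2pqx}{16\pi^2} \right)^{\nu+k+1} } . \end{align*}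
   Context: For Dirichlet characters $\chi_1,\chi_2$ and $z\in\mathbb{C}$: $\sigma_{z,\chi_1,\chi_2}(n)=\sum_{d\mid n}d^z\chi_1(d)\chi_2(n/d)$. $\tau(\chi)=\sum_{h=1}^q\chi(h)e^{2\pi i h/q}$ is the Gauss sum, and $K_\nu$ the modified Bessel function of the second kind. *)

(* Defs.v *)
From Stdlib Require Import Reals ZArith Arith List.
From Coquelicot Require Export Coquelicot.
Import ListNotations.
Open Scope R_scope.

Definition Cexp (z : C) : C :=
  (exp (Re z) * cos (Im z), exp (Re z) * sin (Im z)).

Definition cpow (r : R) (s : C) : C := Cexp (Cmult s (RtoC (ln r))).

Definition csum (l : list nat) (f : nat -> C) : C :=
  fold_right (fun n acc => Cplus (f n) acc) (RtoC 0) l.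

Definition CInt_0_oo (f : R -> C) : C :=
  @RInt_gen C_R_CompleteNormedModule f (at_right 0) (Rbar_locally p_infty).

Definition CGamma (s : C) : C :=
  CInt_0_oo (fun t => Cmult (cpow t (Cminus s (RtoC 1))) (RtoC (exp (- t)))).

Definition Ccosh (w : C) : C :=
  Cmult (RtoC (/ 2)) (Cplus (Cexp w) (Cexp (Copp w))).
Definition BesselK (nu : C) (z : R) : C :=
  CInt_0_oo (fun t => Cmult (RtoC (exp (- (z * cosh t)))) (Ccosh (Cmult nu (RtoC t)))).

Definition dirichlet_char (q : nat) (chi : Z -> C) : Prop :=
  (1 <= q)%nat /\
  chi 1%Z = RtoC 1 /\
  (forall m n : Z, chi (m * n)%Z = Cmult (chi m) (chi n)) /\
  (forall n : Z, chi (n + Z.of_nat q)%Z = chi n) /\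
  (forall n : Z, Z.gcd n (Z.of_nat q) <> 1%Z -> chi n = RtoC 0) /\
  (forall n : Z, Z.gcd n (Z.of_nat q) = 1%Z -> chi n <> RtoC 0).

Definition principal_char (q : nat) (chi : Z -> C) : Prop :=
  forall n : Z, Z.gcd n (Z.of_nat q) = 1%Z -> chi n = RtoC 1.

(* primitive: no proper divisor d of q is an induced modulus *)
Definition primitive_char (q : nat) (chi : Z -> C) : Prop :=
  dirichlet_char q chi /\
  forall d : nat, Nat.divide d q -> (d < q)%nat ->
    ~ (forall n : Z, Z.gcd n (Z.of_nat q) = 1%Z ->
         Z.modulo n (Z.of_nat d) = Z.modulo 1 (Z.of_nat d) -> chi n = RtoC 1).

Definition even_char (chi : Z -> C) : Prop := chi (-1)%Z = RtoC 1.
Definition odd_char (chi : Z -> C) : Prop := chi (-1)%Z = RtoC (-1).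

Definition conj_char (chi : Z -> C) : Z -> C := fun n => Cconj (chi n).

Definition gauss_sum (q : nat) (chi : Z -> C) : C :=
  csum (seq 1 q) (fun h =>
    Cmult (chi (Z.of_nat h)) (Cexp ((0%R : R), 2 * PI * INR h / INR q))).

Definition sigma_chi (z : C) (chi1 chi2 : Z -> C) (n : nat) : C :=
  csum (filter (fun d => Nat.eqb (n mod d) 0) (seq 1 n)) (fun d =>
    Cmult (Cmult (cpow (INR d) z) (chi1 (Z.of_nat d))) (chi2 (Z.of_nat (n / d)))).

(* Main.v *)
Require Import Defs.
From Stdlib Require Import Reals ZArith Arith List Lra Lia Psatz Permutation Classical ClassicalEpsilon.
From Coquelicot Require Import Coquelicot.
Open Scope R_scope.

(** Since n^(nu/2) K_nu(a sqrt(n x)) = (1/2) (a sqrt x / 2)^nu * int_0^oo w^(nu-1) e^(-b w - n/w) dw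
    with b = a^2 x / 4, the left-hand side is an integral transform of the Lambert series
    F(u) = sum_n sigma_{k,chi1,chi2}(n) e^(-n u) at u = 1/w. The series F is an Eisenstein series
    of weight k + 1 and satisfies F(u) = c u^(-k-1) G(4 pi^2 / (p q u)), where G is built in the same
    way from conj chi2 and conj chi1; inserting this turns the integral into a sum of Gamma
    integrals, which is the right-hand side.

    The transformation of F comes from evaluating the double sum of
    chi2(m) (conj chi1)(l) / (p u m + 2 pi i l)^(k+1) in both orders. Each inner sum is a partial
    fraction expansion of a periodic Lambert series: for k = 0 it is the limit of a finite identity
    over the roots of unity of order q M, and higher k follows by differentiation in u. Since the
    double sum does not converge absolutely for k = 0, every sum over Z is first summed by parts
    against the bounded partial sums of the character; mixed second differences of 1/z^(k+1) decay
    like 1/|z|^3, so after that everything converges absolutely. *)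

(** * Limits and series in C *)

(** The hypotheses on the characters act in three ways. Primitivity makes the Gauss sum separable at
    every residue, so the finite Fourier transform carries a character to a multiple of its
    conjugate; this is why conjugates appear in the dual series. Both moduli exceed 1, so the
    characters vanish at 0 and have mean 0: no constant term arises, and their partial sums are
    periodic. Opposite parities, with the odd weight k + 1, make the summand of each outer sum over
    Z even, so it reduces to twice a sum over positive indices; with equal parities it would be odd
    and cancel.

    On the analytic side, an integral is carried together with an antiderivative having limits at 0
    and infinity, and majorants are multiples of the derivative of (w/(1+w))^d, which has mass 1.
    Decay in n must be extracted from e^(-n/w) and from e^(-c n w) with one common exponent. It has
    to exceed k + 1, for the series of sigma_k(n) n^(-s) to converge, and stay below k + 1 + Re nu,
    for the Gamma integrand to remain integrable at 0; k + 1 + Re nu / 2 is the midpoint. *)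

Definition Clim (u : nat -> C) (l : C) : Prop :=
  is_lim_seq (fun n => Cmod (u n - l)) 0.

(** The range is 0, ..., n-1, one term fewer than in [sum_n]. The empty sum makes inductions start
    at 0 and causes the shift by one in [CS_is_series]. *)
Fixpoint psum (f : nat -> C) (n : nat) : C :=
  match n with O => RtoC 0 | S m => (psum f m + f m)%C end.

Definition CS (f : nat -> C) (l : C) : Prop := Clim (psum f) l.

Lemma Cmod_sub_sym (a b : C) : Cmod (a - b) = Cmod (b - a).
Proof. rewrite <- Cmod_opp. f_equal. ring. Qed.

Lemma Cmod_minus_le (a b : C) : Cmod (a - b) <= Cmod a + Cmod b.
Proof.
  unfold Cminus. eapply Rle_trans; [apply Cmod_triangle|].
  rewrite Cmod_opp. lra.
Qed.

Lemma lim0_squeeze (u v : nat -> R) :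
  (forall n, 0 <= u n <= v n) -> is_lim_seq v 0 -> is_lim_seq u 0.
Proof.
  intros H Hv. apply (is_lim_seq_le_le (fun _ => 0) u v); auto.
  apply is_lim_seq_const.
Qed.

Lemma Clim_ext (u v : nat -> C) l : (forall n, u n = v n) -> Clim u l -> Clim v l.
Proof.
  intros H. apply is_lim_seq_ext. intros n; now rewrite H.
Qed.

Lemma Clim_const c : Clim (fun _ => c) c.
Proof.
  unfold Clim. apply is_lim_seq_ext with (fun _ => 0).
  - intros n. replace (c - c)%C with (RtoC 0) by ring. now rewrite Cmod_0.
  - apply is_lim_seq_const.
Qed.

Lemma Clim_unique u l1 l2 : Clim u l1 -> Clim u l2 -> l1 = l2.
Proof.
  intros H1 H2.
  assert (H : is_lim_seq (fun _ : nat => Cmod (l1 - l2)) 0).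
  { apply lim0_squeeze with (fun n => Cmod (u n - l1) + Cmod (u n - l2)).
    - intros n; split; [apply Cmod_ge_0|].
      replace (l1 - l2)%C with (l1 - u n + (u n - l2))%C by ring.
      rewrite (Cmod_sub_sym (u n) l1). apply Cmod_triangle.
    - replace (Finite 0) with (Finite (0 + 0)) by (f_equal; ring).
      now apply is_lim_seq_plus'. }
  apply is_lim_seq_unique in H. rewrite Lim_seq_const in H.
  injection H as H. apply Cmod_eq_0 in H.
  replace l1 with (l1 - l2 + l2)%C by ring. rewrite H. ring.
Qed.

Lemma Clim_plus u v a b : Clim u a -> Clim v b ->
  Clim (fun n => (u n + v n)%C) (a + b)%C.
Proof.
  intros H1 H2.
  apply lim0_squeeze with (fun n => Cmod (u n - a) + Cmod (v n - b)).
  - intros n; split; [apply Cmod_ge_0|].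
    replace (u n + v n - (a + b))%C with
      (u n - a + (v n - b))%C by ring.
    apply Cmod_triangle.
  - replace (Finite 0) with (Finite (0 + 0)) by (f_equal; ring).
    now apply is_lim_seq_plus'.
Qed.

Lemma Clim_mult u v a b : Clim u a -> Clim v b ->
  Clim (fun n => (u n * v n)%C) (a * b)%C.
Proof.
  intros H1 H2.
  apply lim0_squeeze with
    (fun n => Cmod (u n - a) * Cmod (v n - b)
              + (Cmod b * Cmod (u n - a) + Cmod a * Cmod (v n - b))).
  - intros n; split; [apply Cmod_ge_0|].
    replace (u n * v n - a * b)%C with
      ((u n - a) * (v n - b) + (b * (u n - a) + a * (v n - b)))%C by ring.
    rewrite <- !Cmod_mult.
    eapply Rle_trans; [apply Cmod_triangle|]. apply Rplus_le_compat_l, Cmod_triangle.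
  - replace (Finite 0) with (Finite (0 * 0 + (Cmod b * 0 + Cmod a * 0))) by (f_equal; ring).
    apply is_lim_seq_plus'; [now apply is_lim_seq_mult'|].
    apply is_lim_seq_plus'; apply is_lim_seq_mult'; auto; apply is_lim_seq_const.
Qed.

Lemma Clim_scal c u a : Clim u a -> Clim (fun n => (c * u n)%C) (c * a)%C.
Proof. intros H; apply Clim_mult; [apply Clim_const|exact H]. Qed.

Lemma Clim_minus u v a b : Clim u a -> Clim v b ->
  Clim (fun n => (u n - v n)%C) (a - b)%C.
Proof.
  intros H1 H2.
  replace (a - b)%C with (a + RtoC (-1) * b)%C by ring.
  eapply Clim_ext; [|apply Clim_plus; [apply H1|apply (Clim_scal (RtoC (-1)) _ _ H2)]].
  intros n; simpl; ring.
Qed.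

Lemma Clim_Cmod u l : Clim u l -> is_lim_seq (fun n => Cmod (u n)) (Cmod l).
Proof.
  intros H.
  apply is_lim_seq_le_le with (fun n => Cmod l - Cmod (u n - l))
                              (fun n => Cmod l + Cmod (u n - l)).
  - intros n. split.
    + pose proof (Cmod_triangle (u n) (l - u n)%C) as T.
      replace (u n + (l - u n))%C with l in T by ring.
      rewrite Cmod_sub_sym in T. lra.
    + pose proof (Cmod_triangle l (u n - l)%C) as T.
      replace (l + (u n - l))%C with (u n) in T by ring. lra.
  - replace (Finite (Cmod l)) with (Finite (Cmod l - 0)) by (f_equal; ring).
    apply is_lim_seq_minus'; auto. apply is_lim_seq_const.
  - replace (Finite (Cmod l)) with (Finite (Cmod l + 0)) by (f_equal; ring).
    apply is_lim_seq_plus'; auto. apply is_lim_seq_const.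
Qed.

Lemma Clim_mod_le u l M : Clim u l -> (forall n, Cmod (u n) <= M) -> Cmod l <= M.
Proof.
  intros H B. apply Clim_Cmod in H.
  assert (T : Rbar_le (Cmod l) M).
  { apply (is_lim_seq_le (fun n => Cmod (u n)) (fun _ => M)); auto. apply is_lim_seq_const. }
  exact T.
Qed.

Lemma Clim_inv u l : l <> RtoC 0 -> Clim u l -> Clim (fun n => (/ u n)%C) (/ l)%C.
Proof.
  intros Hl H.
  pose proof (Clim_Cmod _ _ H) as Hm.
  assert (Hp : 0 < Cmod l) by now apply Cmod_gt_0.
  unfold Clim.
  apply is_lim_seq_le_le_loc with (fun _ => 0)
    (fun n => Cmod (u n - l) * (2 / (Cmod l * Cmod l))).
  - assert (E : eventually (fun n => Cmod l / 2 < Cmod (u n))).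
    { apply is_lim_seq_spec in Hm.
      assert (Hq : 0 < Cmod l / 2) by lra.
      destruct (Hm (mkposreal _ Hq)) as [N HN]; simpl in HN.
      exists N; intros n Hn. specialize (HN n Hn).
      apply Rabs_def2 in HN. lra. }
    destruct E as [N HN]; exists N; intros n Hn; specialize (HN n Hn).
    split; [apply Cmod_ge_0|].
    assert (Hu : u n <> RtoC 0).
    { apply Cmod_gt_0. lra. }
    replace ((/ u n) - (/ l))%C with
      ((l - u n) * (/ (u n * l)))%C by (field; auto).
    rewrite Cmod_mult, Cmod_sub_sym, Cmod_inv by now apply Cmult_neq_0.
    apply Rmult_le_compat_l; [apply Cmod_ge_0|].
    rewrite Cmod_mult. apply Rmult_le_reg_l with (Cmod (u n) * Cmod l).
    { apply Rmult_lt_0_compat; lra. }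
    rewrite Rinv_r by (apply Rgt_not_eq, Rmult_lt_0_compat; lra).
    replace (Cmod (u n) * Cmod l * (2 / (Cmod l * Cmod l))) with (Cmod (u n) * (2 / Cmod l))
      by (field; lra).
    apply Rmult_le_reg_r with (Cmod l); [lra|].
    replace (Cmod (u n) * (2 / Cmod l) * Cmod l) with (2 * Cmod (u n)) by (field; lra). lra.
  - apply is_lim_seq_const.
  - replace (Finite 0) with (Finite (0 * (2 / (Cmod l * Cmod l)))) by (f_equal; ring).
    apply is_lim_seq_mult'; auto. apply is_lim_seq_const.
Qed.

Lemma Clim_S u l : Clim u l <-> Clim (fun n => u (S n)) l.
Proof. unfold Clim. apply (is_lim_seq_incr_1 (fun n => Cmod (u n - l))). Qed.

Lemma Clim_re_im u l :
  is_lim_seq (fun n => Re (u n)) (Re l) -> is_lim_seq (fun n => Im (u n)) (Im l) -> Clim u l.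
Proof.
  intros H1 H2.
  apply lim0_squeeze with (fun n => Rabs (Re (u n) - Re l) + Rabs (Im (u n) - Im l)).
  - intros n; split; [apply Cmod_ge_0|].
    replace (u n - l)%C with
      (RtoC (Re (u n) - Re l) + Ci * RtoC (Im (u n) - Im l))%C.
    2:{ unfold RtoC, Ci, Cminus, Cplus, Cmult, Copp, Re, Im; simpl.
        apply injective_projections; simpl; ring. }
    eapply Rle_trans; [apply Cmod_triangle|].
    rewrite Cmod_mult, Cmod_Ci, !Cmod_R. lra.
  - replace (Finite 0) with (Finite (Rabs (Re l - Re l) + Rabs (Im l - Im l))).
    2:{ rewrite !Rminus_diag, Rabs_R0. f_equal; ring. }
    apply is_lim_seq_plus'; apply (is_lim_seq_abs _ (Finite _));
      apply is_lim_seq_minus'; auto; apply is_lim_seq_const.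
Qed.

Lemma RtoC_Clim (u : nat -> R) l : is_lim_seq u (Finite l) -> Clim (fun n => RtoC (u n)) (RtoC l).
Proof.
  intros H. apply Clim_re_im; simpl; auto. apply is_lim_seq_const.
Qed.

(** * Finite sums, dominated series and exchange of limits *)

Lemma psum_ext f g n : (forall i, (i < n)%nat -> f i = g i) -> psum f n = psum g n.
Proof.
  induction n; intros H; simpl; auto. rewrite IHn, H; auto.
Qed.

Lemma psum_plus f g n : psum (fun i => (f i + g i)%C) n = (psum f n + psum g n)%C.
Proof. induction n; simpl; [ring|rewrite IHn; ring]. Qed.

Lemma psum_scal c f n : psum (fun i => (c * f i)%C) n = (c * psum f n)%C.
Proof. induction n; simpl; [ring|rewrite IHn; ring]. Qed.

Lemma psum_zero f n : (forall i, (i < n)%nat -> f i = RtoC 0) -> psum f n = RtoC 0.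
Proof. induction n; intros H; simpl; auto. rewrite IHn, H by auto. ring. Qed.

Lemma psum_app f n m : psum f (n + m) = (psum f n + psum (fun i => f (n + i)%nat) m)%C.
Proof.
  induction m; [rewrite Nat.add_0_r; simpl; ring|].
  rewrite Nat.add_succ_r; simpl. rewrite IHm. ring.
Qed.

Lemma psum_S_l f n : psum f (S n) = (f O + psum (fun i => f (S i)) n)%C.
Proof.
  induction n; [simpl; ring|].
  change (psum f (S (S n))) with (psum f (S n) + f (S n))%C. rewrite IHn. simpl. ring.
Qed.

Lemma psum_swap (f : nat -> nat -> C) n m :
  psum (fun i => psum (fun j => f i j) m) n = psum (fun j => psum (fun i => f i j) n) m.
Proof.
  induction n; simpl; [symmetry; apply psum_zero; auto|].
  rewrite IHn, <- psum_plus. reflexivity.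
Qed.

Fixpoint rsum (f : nat -> R) (n : nat) : R :=
  match n with O => 0 | S m => rsum f m + f m end.

Lemma Cmod_psum f w n : (forall i, (i < n)%nat -> Cmod (f i) <= w i) ->
  Cmod (psum f n) <= rsum w n.
Proof.
  induction n; intros H; simpl; [rewrite Cmod_0; lra|].
  eapply Rle_trans; [apply Cmod_triangle|]. apply Rplus_le_compat; auto.
Qed.

Lemma rsum_sum_n w n : rsum w (S n) = sum_n w n.
Proof.
  induction n; [simpl; rewrite sum_O; ring|].
  rewrite sum_Sn, <- IHn. reflexivity.
Qed.

Lemma rsum_le_Series w n : (forall i, 0 <= w i) -> ex_series w -> rsum w n <= Series w.
Proof.
  intros Hp He. destruct n.
  - simpl. apply Series_correct in He.
    assert (T : Rbar_le 0 (Series w)).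
    { apply (is_lim_seq_le (fun _ => 0) (sum_n w)); [|apply is_lim_seq_const|exact He].
      intros n. rewrite <- rsum_sum_n. clear He. induction n; simpl in *.
      - specialize (Hp O). lra.
      - specialize (Hp (S n)). lra. }
    exact T.
  - rewrite rsum_sum_n. apply Series_correct in He.
    apply (is_lim_seq_incr_compare (sum_n w)); auto.
    intros m. rewrite sum_Sn. unfold plus; simpl. specialize (Hp (S m)). lra.
Qed.

Lemma rsum_bounded_ex_series w M : (forall i, 0 <= w i) -> (forall n, rsum w n <= M) -> ex_series w.
Proof.
  intros Hp HM.
  assert (H : ex_finite_lim_seq (sum_n w)).
  { apply ex_finite_lim_seq_incr with M.
    - intros n. rewrite sum_Sn. unfold plus; simpl. specialize (Hp (S n)). lra.
    - intros n. rewrite <- rsum_sum_n. apply HM. }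
  destruct H as [l Hl]. exists l. exact Hl.
Qed.

Lemma psum_sum_n f n : psum f (S n) = @sum_n C_AbelianMonoid f n.
Proof.
  induction n.
  - simpl. rewrite sum_O. ring.
  - rewrite sum_Sn, <- IHn. reflexivity.
Qed.

Lemma Clim_filterlim u l : Clim u l <-> filterlim u eventually (@locally C_UniformSpace l).
Proof.
  split.
  - intros H. apply is_lim_seq_spec in H. intros P [eps He].
    destruct (H eps) as [N HN]. exists N. intros n Hn. apply He.
    apply C_NormedModule_mixin_compat1. specialize (HN n Hn).
    rewrite Rminus_0_r, Rabs_pos_eq in HN by apply Cmod_ge_0. exact HN.
  - intros H. apply is_lim_seq_spec. intros eps.
    (* Balls of [C_UniformSpace] are products of intervals, on which the modulus is only bounded by
       sqrt 2 times the radius. *)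
    assert (H2 : 0 < eps / sqrt 2) by (apply Rdiv_lt_0_compat; [apply cond_pos|apply sqrt_lt_R0; lra]).
    destruct (H (ball l (mkposreal _ H2))) as [N HN]; [now exists (mkposreal _ H2)|].
    exists N; intros n Hn. rewrite Rminus_0_r, Rabs_pos_eq by apply Cmod_ge_0.
    specialize (HN n Hn). apply C_NormedModule_mixin_compat2 in HN. simpl in HN.
    eapply Rlt_le_trans; [exact HN|]. right. field. apply Rgt_not_eq, sqrt_lt_R0; lra.
Qed.

Lemma CS_is_series f l : CS f l <-> is_series f l.
Proof.
  unfold CS, is_series. rewrite Clim_S, Clim_filterlim.
  split; apply filterlim_ext; intros n; now rewrite psum_sum_n.
Qed.

Lemma CS_ext f g l : (forall n, f n = g n) -> CS f l -> CS g l.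
Proof. intros H. apply Clim_ext. intros n; apply psum_ext; auto. Qed.

Lemma CS_plus f g a b : CS f a -> CS g b -> CS (fun n => (f n + g n)%C) (a + b)%C.
Proof.
  intros H1 H2. eapply Clim_ext; [|apply (Clim_plus _ _ _ _ H1 H2)].
  intros n; simpl; now rewrite psum_plus.
Qed.

Lemma CS_scal c f a : CS f a -> CS (fun n => (c * f n)%C) (c * a)%C.
Proof.
  intros H. eapply Clim_ext; [|apply (Clim_scal c _ _ H)].
  intros n; simpl; now rewrite psum_scal.
Qed.

Lemma CS_minus f g a b : CS f a -> CS g b -> CS (fun n => (f n - g n)%C) (a - b)%C.
Proof.
  intros H1 H2. replace (a - b)%C with (a + RtoC (-1) * b)%C by ring.
  eapply CS_ext; [|apply CS_plus; [apply H1|apply (CS_scal (RtoC (-1)) _ _ H2)]].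
  intros n; simpl; ring.
Qed.

Lemma CS_unique f a b : CS f a -> CS f b -> a = b.
Proof. apply Clim_unique. Qed.

Lemma CS_psum (f : nat -> nat -> C) s n : (forall i, (i < n)%nat -> CS (f i) (s i)) ->
  CS (fun j => psum (fun i => f i j) n) (psum s n).
Proof.
  induction n; intros H; simpl.
  - apply Clim_ext with (fun _ => RtoC 0); [|apply Clim_const].
    intros m. symmetry. apply psum_zero; auto.
  - apply CS_plus; auto.
Qed.

Lemma CS_S f l : f O = RtoC 0 -> (CS f l <-> CS (fun n => f (S n)) l).
Proof.
  intros H0. unfold CS. rewrite Clim_S.
  split; apply Clim_ext; intros n; rewrite psum_S_l, H0; ring.
Qed.

Lemma CS_finite f n : (forall i, (n <= i)%nat -> f i = RtoC 0) -> CS f (psum f n).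
Proof.
  intros H. unfold CS, Clim.
  apply is_lim_seq_ext_loc with (fun _ => 0); [|apply is_lim_seq_const].
  exists n. intros m Hm. replace m with (n + (m - n))%nat by lia.
  rewrite psum_app, (psum_zero (fun i => f (n + i)%nat)).
  - replace (_ - _)%C with (RtoC 0) by ring. now rewrite Cmod_0.
  - intros; apply H; lia.
Qed.

Lemma CS_dom f w : (forall n, Cmod (f n) <= w n) -> ex_series w ->
  exists l, CS f l /\ Cmod l <= Series w.
Proof.
  intros H He.
  assert (Hp : forall i, 0 <= w i) by (intros i; eapply Rle_trans; [apply Cmod_ge_0|apply H]).
  destruct (@ex_series_le C_AbsRing C_CompleteNormedModule f w) as [l Hl]; auto.
  assert (Hc : CS f l) by now apply CS_is_series.
  exists l; split; auto.
  apply (Clim_mod_le _ _ _ Hc). intros n. eapply Rle_trans; [apply Cmod_psum; auto|].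
  now apply rsum_le_Series.
Qed.

Lemma CS_tail_le f w l n : (forall n, Cmod (f n) <= w n) -> ex_series w -> CS f l ->
  Cmod (l - psum f n) <= Series w - rsum w n.
Proof.
  intros H He Hc.
  assert (Hp : forall i, 0 <= w i) by (intros i; eapply Rle_trans; [apply Cmod_ge_0|apply H]).
  assert (Hn : Clim (fun m => (psum f (n + m) - psum f n)%C) (l - psum f n)%C).
  { apply Clim_minus; [|apply Clim_const].
    unfold CS, Clim in *. apply (is_lim_seq_incr_n _ n) in Hc.
    eapply is_lim_seq_ext; [|exact Hc]. intros m; simpl. now rewrite Nat.add_comm. }
  apply (Clim_mod_le _ _ _ Hn). intros m.
  rewrite psum_app. replace (_ - _)%C with (psum (fun i => f (n + i)%nat) m) by ring.
  eapply Rle_trans; [apply Cmod_psum with (w := fun i => w (n + i)%nat); auto|].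
  assert (E : rsum w (n + m) = rsum w n + rsum (fun i => w (n + i)%nat) m).
  { induction m; [rewrite Nat.add_0_r; simpl; ring|].
    rewrite Nat.add_succ_r; simpl. rewrite IHm; ring. }
  pose proof (rsum_le_Series w (n + m) Hp He). lra.
Qed.

Lemma rsum_lim w : ex_series w -> is_lim_seq (fun n => Series w - rsum w n) 0.
Proof.
  intros He. replace (Finite 0) with (Finite (Series w - Series w)) by (f_equal; ring).
  apply is_lim_seq_minus'; [apply is_lim_seq_const|].
  apply is_lim_seq_incr_1. apply is_lim_seq_ext with (sum_n w).
  - intros n; now rewrite rsum_sum_n.
  - exact (Series_correct w He).
Qed.

Lemma Clim_psum (f : nat -> nat -> C) (g : nat -> C) n :
  (forall i, (i < n)%nat -> Clim (fun m => f m i) (g i)) ->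
  Clim (fun m => psum (f m) n) (psum g n).
Proof.
  induction n; intros H; simpl; [apply Clim_const|]. apply Clim_plus; auto.
Qed.

(** Dominated convergence for series: beyond a fixed N both sums are within a tail of [w], and below
    N the limit passes termwise. It serves for the limit over roots of unity, for difference
    quotients in t, for the decay of row sums and for exchanging double sums. The sum [l] is
    produced rather than supplied, since the limit is usually not known beforehand. *)
Lemma tannery (f : nat -> nat -> C) (g : nat -> C) (w : nat -> R) (s : nat -> C) :
  (forall m n, Cmod (f m n) <= w n) -> ex_series w ->
  (forall n, Clim (fun m => f m n) (g n)) ->
  (forall m, CS (f m) (s m)) ->
  exists l, CS g l /\ Clim s l.
Proof.
  intros Hw He Hg Hs.
  assert (Hgw : forall n, Cmod (g n) <= w n).
  { intros n. apply (Clim_mod_le _ _ _ (Hg n)). auto. }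
  destruct (CS_dom g w Hgw He) as [l [Hl _]].
  exists l; split; auto.
  apply is_lim_seq_spec. intros eps. pose proof (cond_pos eps) as Heps.
  assert (H4 : 0 < eps / 4) by lra.
  pose proof (rsum_lim w He) as Hr. apply is_lim_seq_spec in Hr.
  destruct (Hr (mkposreal _ H4)) as [N HN]; simpl in HN.
  specialize (HN N (le_n N)). rewrite Rminus_0_r in HN. apply Rabs_def2 in HN.
  assert (Hf : Clim (fun m => psum (f m) N) (psum g N)) by (apply Clim_psum; auto).
  apply is_lim_seq_spec in Hf. destruct (Hf (mkposreal _ H4)) as [K HK]; simpl in HK.
  exists K; intros m Hm. specialize (HK m Hm).
  rewrite Rminus_0_r, Rabs_pos_eq in * by apply Cmod_ge_0.
  replace (s m - l)%C with
    (s m - psum (f m) N + (psum (f m) N - psum g N + (psum g N - l)))%C by ring.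
  eapply Rle_lt_trans; [apply Cmod_triangle|].
  eapply Rle_lt_trans; [apply Rplus_le_compat_l, Cmod_triangle|].
  pose proof (CS_tail_le (f m) w (s m) N (Hw m) He (Hs m)).
  pose proof (CS_tail_le g w l N Hgw He Hl) as T. rewrite Cmod_sub_sym in T. lra.
Qed.

(** Fubini for series as a case of [tannery]: the n-th partial sums of all rows form, for each n, a
    series in the row index, dominated by [W] and converging termwise to the full row sums. *)
Lemma CS_swap (f : nat -> nat -> C) (w : nat -> nat -> R) (W : nat -> R) r c s :
  (forall i j, Cmod (f i j) <= w i j) ->
  (forall i n, rsum (w i) n <= W i) -> ex_series W ->
  (forall i, CS (f i) (r i)) ->
  (forall j, CS (fun i => f i j) (c j)) ->
  CS r s -> CS c s.
Proof.
  intros Hw HW He Hr Hc Hs.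
  destruct (tannery (fun n i => psum (f i) n) r W (fun n => psum c n)) as [l [H1 H2]]; auto.
  - intros n i. eapply Rle_trans; [apply Cmod_psum|apply HW]; auto.
  - intros n. apply (CS_psum (fun j i => f i j) c n). auto.
  - unfold CS. now rewrite (CS_unique _ _ _ Hs H1).
Qed.

(** * Differences of inverse powers *)

Lemma Cpow_diff_le (A B : C) r j : Cmod A <= r -> Cmod B <= r ->
  Cmod (A ^ S j - B ^ S j) <= INR (S j) * r ^ j * Cmod (A - B).
Proof.
  intros HA HB.
  assert (Hr : 0 <= r) by (eapply Rle_trans; [apply Cmod_ge_0|exact HA]).
  induction j.
  - simpl. rewrite !Cmult_1_r. lra.
  - replace (A ^ S (S j) - B ^ S (S j))%C with
      (A * (A ^ S j - B ^ S j) + (A - B) * B ^ S j)%C by (simpl; ring).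
    eapply Rle_trans; [apply Cmod_triangle|].
    rewrite !Cmod_mult, Cmod_pow.
    assert (H1 : Cmod B ^ S j <= r ^ S j) by (apply pow_incr; split; [apply Cmod_ge_0|auto]).
    pose proof (Cmod_ge_0 A). pose proof (Cmod_ge_0 B). pose proof (Cmod_ge_0 (A - B)%C).
    pose proof (Cmod_ge_0 (A ^ S j - B ^ S j)%C).
    rewrite (S_INR (S j)).
    apply Rle_trans with (r * (INR (S j) * r ^ j * Cmod (A - B)) + Cmod (A - B) * r ^ S j).
    + apply Rplus_le_compat; [apply Rmult_le_compat; auto|apply Rmult_le_compat_l; auto].
    + right. simpl pow. ring.
Qed.

Lemma Cinv_diff (z a : C) : z <> RtoC 0 -> (z + a)%C <> RtoC 0 ->
  ((/ z) - (/ (z + a)))%C = (a * ((/ z) * (/ (z + a))))%C.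
Proof. intros; field; auto. Qed.

Lemma Cinv_pow_diff_le (z a : C) r j : z <> RtoC 0 -> (z + a)%C <> RtoC 0 ->
  Cmod (/ z) <= r -> Cmod (/ (z + a)) <= r ->
  Cmod ((/ z) ^ S j - (/ (z + a)) ^ S j)
    <= INR (S j) * Cmod a * r ^ (j + 2).
Proof.
  intros H1 H2 H3 H4. eapply Rle_trans; [apply Cpow_diff_le; eauto|].
  rewrite Cinv_diff, !Cmod_mult by auto.
  assert (Hr : 0 <= r) by (eapply Rle_trans; [apply Cmod_ge_0|exact H3]).
  rewrite pow_add. replace (INR (S j) * Cmod a * (r ^ j * r ^ 2)) with
    (INR (S j) * r ^ j * (Cmod a * (r * r))) by ring.
  apply Rmult_le_compat_l; [apply Rmult_le_pos; [apply pos_INR|now apply pow_le]|].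
  apply Rmult_le_compat_l; [apply Cmod_ge_0|].
  apply Rmult_le_compat; auto; apply Cmod_ge_0.
Qed.

(** Mixed second difference of z^(-j) in the directions a and b. It occurs with two lattice periods,
    and with one period and one small real step in the difference quotients. *)
Definition DD (z a b : C) (j : nat) : C :=
  ((/ z) ^ j - (/ (z + a)) ^ j - (/ (z + b)) ^ j + (/ (z + a + b)) ^ j)%C.

(* The constant is uniform in the steps a and b, so the same bound controls both the lattice
   sums and the difference quotients in z. *)
Lemma DD_le (j : nat) : exists K, 0 <= K /\ forall (z a b : C) r,
  z <> RtoC 0 -> (z + a)%C <> RtoC 0 -> (z + b)%C <> RtoC 0 -> (z + a + b)%C <> RtoC 0 ->
  Cmod (/ z) <= r -> Cmod (/ (z + a)) <= r ->
  Cmod (/ (z + b)) <= r -> Cmod (/ (z + a + b)) <= r ->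
  Cmod (DD z a b (S j)) <= K * Cmod a * Cmod b * r ^ (j + 3).
Proof.
  assert (Base : forall (z a b : C) r,
    z <> RtoC 0 -> (z + a)%C <> RtoC 0 -> (z + b)%C <> RtoC 0 -> (z + a + b)%C <> RtoC 0 ->
    Cmod (/ z) <= r -> Cmod (/ (z + a)) <= r ->
    Cmod (/ (z + b)) <= r -> Cmod (/ (z + a + b)) <= r ->
    Cmod (DD z a b 1) <= 2 * Cmod a * Cmod b * r ^ 3).
  { intros z a b r z0 za zb zab HA HB HC HD. unfold DD.
    replace (_ + _)%C with
      (a * b * ((/ z) * ((/ (z + a)) * (/ (z + b))) + (/ (z + a)) * ((/ (z + b)) * (/ (z + a + b)))))%C
      by (simpl; field; auto).
    rewrite !Cmod_mult.
    replace (2 * Cmod a * Cmod b * r ^ 3) with (Cmod a * Cmod b * (r * (r * r) + r * (r * r)))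
      by (simpl; ring).
    apply Rmult_le_compat_l; [apply Rmult_le_pos; apply Cmod_ge_0|].
    eapply Rle_trans; [apply Cmod_triangle|]. rewrite !Cmod_mult.
    apply Rplus_le_compat; repeat (apply Rmult_le_compat; auto using Cmod_ge_0);
      try (apply Rmult_le_pos; apply Cmod_ge_0). }
  induction j as [|j [K [K0 IH]]].
  - exists 2; split; [lra|]. exact Base.
  (* [K] comes from the previous power, 2 from the base case, and each of the two products of first
     differences contributes j + 1. *)
  - exists (K + 2 + 2 * INR (S j)). split; [pose proof (pos_INR (S j)); lra|].
    intros z a b r z0 za zb zab HA HB HC HD.
    specialize (IH z a b r z0 za zb zab HA HB HC HD).
    specialize (Base z a b r z0 za zb zab HA HB HC HD).
    assert (Hr : 0 <= r) by (eapply Rle_trans; [apply Cmod_ge_0|exact HA]).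
    pose proof (Cinv_pow_diff_le z a r j z0 za HA HB) as E1.
    pose proof (Cinv_pow_diff_le z b r j z0 zb HA HC) as E2.
    assert (zba : (z + b + a)%C <> RtoC 0)
      by (replace (z + b + a)%C with (z + a + b)%C by ring; auto).
    pose proof (Cinv_diff _ b za zab) as F1. pose proof (Cinv_diff _ a zb zba) as F2.
    replace (z + b + a)%C with (z + a + b)%C in F2 by ring.
    (* Discrete Leibniz rule for 1/z times 1/z^(j+1): each factor carries the mixed difference once,
       and two terms have one first difference on each factor. *)
    replace (DD z a b (S (S j))) with
      ((/ (z + a + b)) * DD z a b (S j) + DD z a b 1 * (/ z) ^ S j + (((/ (z + a)) - (/ (z + a + b))) * ((/ z) ^ S j - (/ (z + a)) ^ S j) + ((/ (z + b)) - (/ (z + a + b))) * ((/ z) ^ S j - (/ (z + b)) ^ S j)))%C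
      by (unfold DD; generalize (/ z)%C (/ (z + a))%C (/ (z + b))%C
            (/ (z + a + b))%C; intros A B D E; cbn [Cpow];
          generalize (A ^ j)%C (B ^ j)%C (D ^ j)%C (E ^ j)%C; intros; ring).
    rewrite F1, F2.
    eapply Rle_trans; [apply Cmod_triangle|].
    eapply Rle_trans; [apply Rplus_le_compat; apply Cmod_triangle|].
    rewrite !Cmod_mult, Cmod_pow.
    assert (P1 : Cmod (/ z) ^ S j <= r ^ S j) by (apply pow_incr; split; [apply Cmod_ge_0|auto]).
    apply Rle_trans with
      ((r * (K * Cmod a * Cmod b * r ^ (j + 3)) + (2 * Cmod a * Cmod b * r ^ 3) * r ^ S j) +
       (Cmod b * (r * r) * (INR (S j) * Cmod a * r ^ (j + 2)) +
        Cmod a * (r * r) * (INR (S j) * Cmod b * r ^ (j + 2)))).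
    2:{ right. replace (r ^ (S j + 3)) with (r ^ j * r ^ 4) by (rewrite <- pow_add; f_equal; lia).
        rewrite !pow_add. simpl pow. ring. }
    assert (Q : forall u v, Cmod u <= r -> Cmod v <= r -> Cmod u * Cmod v <= r * r)
      by (intros; apply Rmult_le_compat; auto using Cmod_ge_0).
    apply Rplus_le_compat; apply Rplus_le_compat.
    + apply Rmult_le_compat; auto using Cmod_ge_0.
    + apply Rmult_le_compat; auto using Cmod_ge_0. apply pow_le, Cmod_ge_0.
    + apply Rmult_le_compat; auto using Cmod_ge_0; [|apply Rmult_le_compat_l; auto using Cmod_ge_0].
      repeat apply Rmult_le_pos; apply Cmod_ge_0.
    + apply Rmult_le_compat; auto using Cmod_ge_0; [|apply Rmult_le_compat_l; auto using Cmod_ge_0].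
      repeat apply Rmult_le_pos; apply Cmod_ge_0.
Qed.

(** * Sums over the integers *)

(** Pairing n with -n-1 visits every integer once, and n pairs cover the interval from -n to n-1.
    Such an interval is a centred residue system modulo 2n, and it is preserved by l -> -l-1, the
    reflection natural for differences of neighbours. *)
Definition zs (f : Z -> C) (n : nat) : C :=
  (f (Z.of_nat n) + f (- Z.of_nat n - 1)%Z)%C.

(* The index n at which [zs] visits l. *)
Definition zidx (l : Z) : nat := if (0 <=? l)%Z then Z.to_nat l else Z.to_nat (- l - 1).

Definition ZS (f : Z -> C) (s : C) : Prop := CS (zs f) s.

Lemma zidx_pos n : zidx (Z.of_nat n) = n.
Proof. unfold zidx. destruct (Z.leb_spec 0 (Z.of_nat n)); lia. Qed.

Lemma zidx_neg n : zidx (- Z.of_nat n - 1) = n.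
Proof. unfold zidx. destruct (Z.leb_spec 0 (- Z.of_nat n - 1)); lia. Qed.

Lemma ZS_ext f g s : (forall l, f l = g l) -> ZS f s -> ZS g s.
Proof. intros H; apply CS_ext; intros n; unfold zs; now rewrite !H. Qed.

Lemma ZS_scal c f s : ZS f s -> ZS (fun l => (c * f l)%C) (c * s)%C.
Proof.
  intros H. eapply CS_ext; [|apply (CS_scal c _ _ H)]. intros n; unfold zs; ring.
Qed.

Lemma ZS_minus f g a b : ZS f a -> ZS g b -> ZS (fun l => (f l - g l)%C) (a - b)%C.
Proof.
  intros H1 H2. eapply CS_ext; [|apply (CS_minus _ _ _ _ H1 H2)].
  intros n; unfold zs; ring.
Qed.

Lemma ZS_refl f s : ZS f s -> ZS (fun l => f (- l - 1)%Z) s.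
Proof.
  apply CS_ext. intros n; unfold zs.
  replace (- (- Z.of_nat n - 1) - 1)%Z with (Z.of_nat n) by lia. ring.
Qed.

Lemma zs_le f w n : (forall l, Cmod (f l) <= w (zidx l)) -> Cmod (zs f n) <= 2 * w n.
Proof.
  intros H. unfold zs. eapply Rle_trans; [apply Cmod_triangle|].
  pose proof (H (Z.of_nat n)) as A. pose proof (H (- Z.of_nat n - 1)%Z) as B.
  rewrite zidx_pos in A. rewrite zidx_neg in B. lra.
Qed.

Lemma ex_series_Rscal c (w : nat -> R) : ex_series w -> ex_series (fun n => c * w n).
Proof. apply (@ex_series_scal R_AbsRing R_NormedModule c w). Qed.

Lemma ZS_dom f w : (forall l, Cmod (f l) <= w (zidx l)) -> ex_series w ->
  exists s, ZS f s /\ Cmod s <= 2 * Series w.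
Proof.
  intros H He. destruct (CS_dom (zs f) (fun n => 2 * w n)) as [s [H1 H2]].
  - intros n; now apply zs_le.
  - now apply ex_series_Rscal.
  - exists s; split; auto. rewrite Series_scal_l in H2. exact H2.
Qed.

Lemma rsum_scal c w n : rsum (fun i => c * w i) n = c * rsum w n.
Proof. induction n; simpl; [ring|rewrite IHn; ring]. Qed.

Lemma ZS_swap (f : Z -> Z -> C) (v : nat -> R) r c s :
  (forall n, 0 <= v n) -> ex_series v ->
  (forall m l, Cmod (f m l) <= v (zidx m) * v (zidx l)) ->
  (forall m, ZS (f m) (r m)) ->
  (forall l, ZS (fun m => f m l) (c l)) ->
  ZS r s -> ZS c s.
Proof.
  intros Hv He Hf Hr Hc Hs.
  (* Pairing doubles the majorant once in each variable, hence the 4. *)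
  apply (CS_swap (fun i j => zs (fun m => zs (f m) j) i) (fun i j => (4 * v i) * v j)
           (fun i => (4 * v i) * Series v) (zs r)); auto.
  - intros i j. replace (4 * v i * v j) with (2 * (v i * (2 * v j))) by ring.
    apply (zs_le (fun m => zs (f m) j) (fun i => v i * (2 * v j))). intros m.
    replace (v (zidx m) * (2 * v j)) with (2 * (v (zidx m) * v j)) by ring.
    apply (zs_le (f m) (fun j => v (zidx m) * v j)). auto.
  - intros i n. rewrite rsum_scal. apply Rmult_le_compat_l.
    + specialize (Hv i); lra.
    + now apply rsum_le_Series.
  - apply ex_series_ext with (fun n => (4 * Series v) * v n); [intros; simpl; ring|].
    now apply ex_series_Rscal.
  - intros i. apply CS_plus; apply Hr.
  - intros j. eapply CS_ext; [|apply CS_plus; [apply (Hc (Z.of_nat j))|apply (Hc (- Z.of_nat j - 1)%Z)]].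
    intros i; unfold zs; ring.
Qed.

Lemma lim0_bounded_mult (X u : nat -> C) B :
  (forall n, Cmod (X n) <= B) -> Clim u (RtoC 0) -> Clim (fun n => (X n * u n)%C) (RtoC 0).
Proof.
  intros HB Hu. apply lim0_squeeze with (fun n => B * Cmod (u n - 0)).
  - intros n; split; [apply Cmod_ge_0|].
    replace (X n * u n - 0)%C with (X n * (u n - 0))%C by ring.
    rewrite Cmod_mult. apply Rmult_le_compat_r; auto using Cmod_ge_0.
  - replace (Finite 0) with (Finite (B * 0)) by (f_equal; ring).
    apply is_lim_seq_mult'; [apply is_lim_seq_const|exact Hu].
Qed.

Lemma ZS_abel (beta X a : Z -> C) B s :
  (forall l, (X l - X (l - 1)%Z)%C = beta l) ->
  (forall l, Cmod (X l) <= B) ->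
  Clim (fun n => a (Z.of_nat n)) (RtoC 0) -> Clim (fun n => a (- Z.of_nat n)%Z) (RtoC 0) ->
  ZS (fun l => (X l * (a l - a (l + 1)%Z))%C) s ->
  ZS (fun l => (beta l * a l)%C) s.
Proof.
  intros HX HB H1 H2 Hs. unfold ZS, CS.
  (* The zeros are the limits of the boundary terms X(n-1) a(n) and X(-n-1) a(-n): bounded times
     null. *)
  replace s with (s + 0 - 0)%C by ring.
  eapply Clim_ext; [|apply Clim_minus; [apply Clim_plus; [exact Hs|]|]].
  2: apply (lim0_bounded_mult (fun n => X (Z.of_nat n - 1)%Z) _ B (fun n => HB _) H1).
  2: apply (lim0_bounded_mult (fun n => X (- Z.of_nat n - 1)%Z) _ B (fun n => HB _) H2).
  intros n. induction n.
  - simpl. ring.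
  - change (psum (zs (fun l => (beta l * a l)%C)) (S n)) with
      (psum (zs (fun l => (beta l * a l)%C)) n + zs (fun l => (beta l * a l)%C) n)%C.
    rewrite <- IHn. cbn [psum]. unfold zs.
    replace (Z.of_nat (S n) - 1)%Z with (Z.of_nat n) by lia.
    replace (Z.of_nat (S n)) with (Z.of_nat n + 1)%Z by lia.
    rewrite <- !HX.
    replace (- Z.of_nat n - 1 + 1)%Z with (- Z.of_nat n)%Z by lia.
    replace (- (Z.of_nat n + 1) - 1)%Z with (- Z.of_nat n - 1 - 1)%Z by lia.
    replace (- (Z.of_nat n + 1))%Z with (- Z.of_nat n - 1)%Z by lia.
    ring.
Qed.

(** The interval from -n to n-1 is not symmetric: its sum is twice the one-sided sum plus the extra
    value f(-n) = f(n). Convergence of f to 0 removes that term. *)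
Lemma ZS_even_half f s : f 0%Z = RtoC 0 -> (forall l, f (- l)%Z = f l) ->
  Clim (fun n => f (Z.of_nat n)) (RtoC 0) -> ZS f s ->
  CS (fun n => f (Z.of_nat n)) (s / 2)%C.
Proof.
  intros H0 He Hl Hs. unfold CS.
  replace (s / 2)%C with ((/ 2) * (s - 0))%C
    by (field; intros H; injection H; lra).
  eapply Clim_ext; [|apply Clim_scal, Clim_minus; [exact Hs|exact Hl]].
  intros n. simpl.
  assert (E : psum (zs f) n = (2 * psum (fun i => f (Z.of_nat i)) n + f (Z.of_nat n))%C).
  { induction n.
    - simpl. rewrite H0. ring.
    - cbn [psum]. rewrite IHn. unfold zs.
      replace (- Z.of_nat n - 1)%Z with (- Z.of_nat (S n))%Z by lia. rewrite He. ring. }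
  rewrite E. field.
Qed.

(** * Convergence of the zeta series *)

(** The standard summable majorant. The value d = 1 is used for inverse squares along a row, d = 1/2
    in each variable of a double sum with cubic decay. *)
Definition wt (d : R) (n : nat) : R := Rpower (INR (S n)) (- (1 + d)).

Lemma wt_pos d n : 0 < wt d n.
Proof. apply exp_pos. Qed.

Lemma ln_le_sub1 x : 0 < x -> ln x <= x - 1.
Proof. intros H. pose proof (exp_ineq1_le (ln x)). rewrite exp_ln in H0; lra. Qed.

(** A discrete integral test: 1/x <= ln x - ln (x-1) combined with e^y >= 1 + y compares the weight
    with a telescoping difference of x^(-d). *)
Lemma wt_telescope d x : 0 < d -> 1 < x ->
  d * Rpower x (- (1 + d)) <= Rpower (x - 1) (- d) - Rpower x (- d).
Proof.
  intros Hd Hx.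
  assert (E : Rpower (x - 1) (- d) = Rpower x (- d) * exp (d * (ln x - ln (x - 1)))).
  { unfold Rpower. rewrite <- exp_plus. f_equal. ring. }
  assert (E2 : Rpower x (- (1 + d)) = Rpower x (- d) * / x).
  { replace (- (1 + d)) with (- d + - (1)) by ring.
    rewrite Rpower_plus, Rpower_Ropp, Rpower_Ropp, Rpower_1 by lra. reflexivity. }
  rewrite E, E2.
  assert (L : / x <= ln x - ln (x - 1)).
  { assert (H : ln ((x - 1) / x) <= (x - 1) / x - 1) by (apply ln_le_sub1, Rdiv_lt_0_compat; lra).
    unfold Rdiv in H. rewrite ln_mult, ln_Rinv in H by (try apply Rinv_0_lt_compat; lra).
    replace ((x - 1) * / x - 1) with (- / x) in H by (field; lra). lra. }
  pose proof (exp_ineq1_le (d * (ln x - ln (x - 1)))) as HE.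
  assert (HP : 0 < Rpower x (- d)) by apply exp_pos.
  assert (L2 : d * / x <= d * (ln x - ln (x - 1))) by (apply Rmult_le_compat_l; lra).
  assert (Rpower x (- d) * (d * / x) <= Rpower x (- d) * (exp (d * (ln x - ln (x - 1))) - 1))
    by (apply Rmult_le_compat_l; lra).
  lra.
Qed.

Lemma wt_ex_series d : 0 < d -> ex_series (wt d).
Proof.
  intros Hd. apply rsum_bounded_ex_series with (1 + / d).
  - intros i; apply Rlt_le, wt_pos.
  - assert (H : forall n, rsum (wt d) (S n) <= 1 + / d * (1 - Rpower (INR (S n)) (- d))).
    { induction n.
      - simpl. unfold wt. simpl INR. unfold Rpower. rewrite ln_1, !Rmult_0_r, exp_0. lra.
      - change (rsum (wt d) (S (S n))) with (rsum (wt d) (S n) + wt d (S n)).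
        assert (Hx : 1 < INR (S (S n))) by (rewrite !S_INR; pose proof (pos_INR n); lra).
        pose proof (wt_telescope d _ Hd Hx) as T.
        replace (INR (S (S n)) - 1) with (INR (S n)) in T by (rewrite (S_INR (S n)); ring).
        unfold wt at 2.
        assert (Rpower (INR (S (S n))) (- (1 + d)) <=
                / d * (Rpower (INR (S n)) (- d) - Rpower (INR (S (S n))) (- d))).
        { apply Rmult_le_reg_l with d; auto. rewrite <- Rmult_assoc, Rinv_r; lra. }
        lra. }
    assert (0 < / d) by now apply Rinv_0_lt_compat.
    intros [|n]; [simpl; lra|].
    eapply Rle_trans; [apply H|]. apply Rplus_le_compat_l.
    assert (0 < Rpower (INR (S n)) (- d)) by apply exp_pos. nra.
Qed.

(** * Exponentials and sums over residues *)

Lemma Cexp_plus a b : Cexp (a + b)%C = (Cexp a * Cexp b)%C.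
Proof.
  unfold Cexp, Cmult, Cplus, Re, Im; simpl.
  rewrite exp_plus, cos_plus, sin_plus.
  apply injective_projections; simpl; ring.
Qed.

Lemma Cexp_0 : Cexp (RtoC 0) = RtoC 1.
Proof.
  unfold Cexp, RtoC; simpl. rewrite exp_0, cos_0, sin_0.
  apply injective_projections; simpl; ring.
Qed.

Lemma Cmod_Cexp a : Cmod (Cexp a) = exp (Re a).
Proof.
  unfold Cexp, Cmod, Re, Im; simpl.
  match goal with |- sqrt ?e = _ =>
    replace e with (exp (fst a) * exp (fst a) * (Rsqr (sin (snd a)) + Rsqr (cos (snd a))))
      by (unfold Rsqr; ring) end.
  rewrite sin2_cos2, Rmult_1_r. apply sqrt_square, Rlt_le, exp_pos.
Qed.

Lemma Cexp_neq0 a : Cexp a <> RtoC 0.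
Proof. apply Cmod_gt_0. rewrite Cmod_Cexp. apply exp_pos. Qed.

Lemma Cexp_opp a : Cexp (- a)%C = (/ Cexp a)%C.
Proof.
  assert (H : (Cexp (- a)%C * Cexp a)%C = RtoC 1).
  { rewrite <- Cexp_plus. replace ((- a) + a)%C with (RtoC 0) by ring. apply Cexp_0. }
  replace (Cexp (- a)%C) with (Cexp (- a)%C * Cexp a * (/ Cexp a))%C
    by (field; apply Cexp_neq0).
  rewrite H. ring.
Qed.

Lemma Cexp_RtoC r : Cexp (RtoC r) = RtoC (exp r).
Proof.
  unfold Cexp, RtoC; simpl. rewrite cos_0, sin_0. apply injective_projections; simpl; ring.
Qed.

Lemma RtoC_neq0 r : r <> 0 -> RtoC r <> RtoC 0.
Proof. intros H E. injection E; auto. Qed.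

Definition ez (N : nat) (j : Z) : C := Cexp (0, 2 * PI * IZR j / INR N).

Lemma ez_plus N i j : ez N (i + j) = (ez N i * ez N j)%C.
Proof.
  unfold ez. rewrite <- Cexp_plus. f_equal. unfold Cplus; simpl. rewrite plus_IZR.
  apply injective_projections; simpl; unfold Rdiv; ring.
Qed.

Lemma ez_0 N : ez N 0 = RtoC 1.
Proof.
  unfold ez. replace (2 * PI * 0 / INR N) with 0 by (unfold Rdiv; ring). apply Cexp_0.
Qed.

Lemma Cmod_ez N j : Cmod (ez N j) = 1.
Proof. unfold ez. rewrite Cmod_Cexp; simpl. apply exp_0. Qed.

Lemma ez_multiple N j : (1 <= N)%nat -> ez N (Z.of_nat N * j) = RtoC 1.
Proof.
  intros HN. unfold ez. rewrite mult_IZR, <- INR_IZR_INZ.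
  assert (INR N <> 0) by (apply not_0_INR; lia).
  replace (2 * PI * (INR N * IZR j) / INR N) with (0 + IZR (2 * j) * PI)
    by (rewrite mult_IZR; field; auto).
  unfold Cexp, Re, Im; cbn [fst snd]. rewrite exp_0.
  assert (HS : sin (0 + IZR (2 * j) * PI) = 0).
  { apply sin_eq_0_1. exists (2 * j)%Z. ring. }
  rewrite HS.
  assert (HC : cos (0 + IZR (2 * j) * PI) = 1).
  { replace (0 + IZR (2 * j) * PI) with (2 * (IZR j * PI)) by (rewrite mult_IZR; ring).
    rewrite cos_2a_sin. rewrite (sin_eq_0_1 (IZR j * PI)) by now exists j. ring. }
  rewrite HC. apply injective_projections; simpl; ring.
Qed.

Lemma ez_eq_1 N j : (1 <= N)%nat -> ez N j = RtoC 1 -> (Z.of_nat N | j)%Z.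
Proof.
  intros HN H. assert (INR N <> 0) by (apply not_0_INR; lia).
  unfold ez, Cexp, RtoC in H; simpl in H. rewrite exp_0 in H. injection H as H1 _.
  replace (2 * PI * IZR j / INR N) with (2 * (PI * IZR j / INR N)) in H1 by (field; auto).
  rewrite cos_2a_sin in H1.
  assert (H2 : sin (PI * IZR j / INR N) = 0) by nra.
  apply sin_eq_0_0 in H2. destruct H2 as [m Hm]. exists m.
  apply eq_IZR. rewrite mult_IZR, <- INR_IZR_INZ.
  pose proof PI_neq0.
  apply Rmult_eq_reg_l with (PI / INR N).
  - replace (PI / INR N * IZR j) with (PI * IZR j / INR N) by (field; auto).
    rewrite Hm. field; auto.
  - apply Rmult_integral_contrapositive; split; auto. now apply Rinv_neq_0_compat.
Qed.

Lemma ez_period N j m : (1 <= N)%nat -> ez N (j + Z.of_nat N * m) = ez N j.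
Proof. intros. rewrite ez_plus, ez_multiple by auto. ring. Qed.

Lemma ez_scale M N j : (1 <= M)%nat -> (1 <= N)%nat -> ez (N * M) (Z.of_nat M * j) = ez N j.
Proof.
  intros HM HN. unfold ez. do 2 f_equal. rewrite mult_INR, mult_IZR, <- INR_IZR_INZ.
  field. split; apply not_0_INR; lia.
Qed.

Definition periodic (q : nat) (f : Z -> C) : Prop := forall n, f (n + Z.of_nat q)%Z = f n.

Lemma periodic_add q f : periodic q f -> forall m n, f (n + Z.of_nat q * m)%Z = f n.
Proof.
  intros H.
  assert (P : forall (m : nat) n, f (n + Z.of_nat q * Z.of_nat m)%Z = f n).
  { induction m; intros n.
    - f_equal; lia.
    - rewrite <- (IHm n), <- (H (n + Z.of_nat q * Z.of_nat m)%Z). f_equal. lia. }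
  intros m n. destruct (Z_le_gt_dec 0 m).
  - rewrite <- (Z2Nat.id m) by lia. apply P.
  - rewrite <- (P (Z.to_nat (- m)) (n + Z.of_nat q * m)%Z). f_equal. rewrite Z2Nat.id by lia. lia.
Qed.

Lemma periodic_mod q f n : (1 <= q)%nat -> periodic q f -> f (n mod Z.of_nat q)%Z = f n.
Proof.
  intros Hq H. rewrite (Z.div_mod n (Z.of_nat q)) at 2 by lia.
  rewrite Z.add_comm, periodic_add; auto.
Qed.

Lemma rsum_incr w n m : (forall i, 0 <= w i) -> (n <= m)%nat -> rsum w n <= rsum w m.
Proof.
  intros Hp H. induction H; [lra|]. simpl. specialize (Hp m). lra.
Qed.

Lemma periodic_bounded q f : (1 <= q)%nat -> periodic q f ->
  exists B, 0 < B /\ forall l, Cmod (f l) <= B.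
Proof.
  intros Hq Hp. set (w := fun h => Cmod (f (Z.of_nat h))).
  assert (Hw : forall i, 0 <= w i) by (intros; apply Cmod_ge_0).
  exists (rsum w q + 1). split.
  - pose proof (rsum_incr w 0 q Hw ltac:(lia)). simpl in H. lra.
  - intros l. rewrite <- (periodic_mod q f l Hq Hp).
    pose proof (Z.mod_pos_bound l (Z.of_nat q) ltac:(lia)) as HB.
    rewrite <- (Z2Nat.id (l mod Z.of_nat q)) by lia.
    set (h := Z.to_nat (l mod Z.of_nat q)). change (Cmod (f (Z.of_nat h))) with (w h).
    pose proof (rsum_incr w (S h) q Hw ltac:(lia)). simpl in H.
    pose proof (rsum_incr w 0 h Hw ltac:(lia)). simpl in H0. lra.
Qed.

Definition rs (q : nat) (f : Z -> C) : C := psum (fun h => f (Z.of_nat h)) q.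

Lemma csum_app l1 l2 f : csum (l1 ++ l2) f = (csum l1 f + csum l2 f)%C.
Proof.
  unfold csum. induction l1; simpl; [ring|]. rewrite IHl1. ring.
Qed.

Lemma psum_csum f n : psum f n = csum (seq 0 n) f.
Proof.
  induction n; auto. rewrite seq_S, csum_app. cbn [psum]. rewrite IHn. unfold csum; simpl. ring.
Qed.

Lemma csum_perm l1 l2 f : Permutation l1 l2 -> csum l1 f = csum l2 f.
Proof.
  intros H; induction H; unfold csum in *; simpl; auto; try congruence. ring.
Qed.

Lemma csum_map (g : nat -> nat) l f : csum (map g l) f = csum l (fun h => f (g h)).
Proof. unfold csum. induction l; simpl; auto. now rewrite IHl. Qed.

(** A map injective modulo q permutes the residues, so the two sums have the same terms in another
    order. It is applied to shifts, to multiplication by a unit and to negation. *)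
Lemma rs_reindex q f (phi : Z -> Z) : (1 <= q)%nat -> periodic q f ->
  (forall h h', (Z.of_nat q | phi h - phi h')%Z -> (Z.of_nat q | h - h')%Z) ->
  rs q (fun h => f (phi h)) = rs q f.
Proof.
  intros Hq Hf Hphi. unfold rs. rewrite !psum_csum.
  set (g := fun h : nat => Z.to_nat (phi (Z.of_nat h) mod Z.of_nat q)).
  assert (Hg : forall h, Z.of_nat (g h) = (phi (Z.of_nat h) mod Z.of_nat q)%Z).
  { intros h. unfold g. rewrite Z2Nat.id; auto. apply Z.mod_pos_bound. lia. }
  transitivity (csum (map g (seq 0 q)) (fun h => f (Z.of_nat h))).
  - rewrite csum_map. rewrite <- !psum_csum. apply psum_ext. intros i _.
    now rewrite Hg, periodic_mod.
  - apply csum_perm. apply NoDup_Permutation_bis.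
    + apply FinFun.Injective_map_NoDup_in; [|apply seq_NoDup].
      intros i j Hi Hj E. apply in_seq in Hi, Hj.
      assert (E2 : (phi (Z.of_nat i) mod Z.of_nat q = phi (Z.of_nat j) mod Z.of_nat q)%Z)
        by (rewrite <- !Hg; congruence).
      assert (D : (Z.of_nat q | phi (Z.of_nat i) - phi (Z.of_nat j))%Z).
      { apply Z.mod_divide; [lia|]. rewrite Zminus_mod, E2, Z.sub_diag. reflexivity. }
      apply Hphi in D. destruct D as [c Hc].
      assert (- 1 < c)%Z by nia. assert (c < 1)%Z by nia. assert (c = 0%Z) by lia. subst c. lia.
    + now rewrite length_map.
    + intros x Hx. apply in_map_iff in Hx. destruct Hx as [h [E _]]. subst x.
      apply in_seq. pose proof (Hg h). pose proof (Z.mod_pos_bound (phi (Z.of_nat h)) (Z.of_nat q)).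
      lia.
Qed.

Lemma rs_shift q f j : (1 <= q)%nat -> periodic q f -> rs q (fun h => f (h + j)%Z) = rs q f.
Proof.
  intros Hq Hf. apply (rs_reindex q f (fun h => (h + j)%Z)); auto.
  intros h h' H. now replace (h + j - (h' + j))%Z with (h - h')%Z in H by lia.
Qed.

Lemma rs_ext q f g : (forall h, f h = g h) -> rs q f = rs q g.
Proof. intros H; apply psum_ext; auto. Qed.

Lemma rs_scal q c f : rs q (fun h => (c * f h)%C) = (c * rs q f)%C.
Proof. apply psum_scal. Qed.

Lemma rs_swap q r (f : Z -> Z -> C) :
  rs q (fun h => rs r (fun j => f h j)) = rs r (fun j => rs q (fun h => f h j)).
Proof. apply (psum_swap (fun i j => f (Z.of_nat i) (Z.of_nat j))). Qed.

(** The usual reason why a character sum vanishes: some reindexing multiplies it by c. *)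
Lemma C_fixed_zero (c s : C) : c <> RtoC 1 -> (c * s)%C = s -> s = RtoC 0.
Proof.
  intros Hc H.
  assert (E : ((c - 1) * s)%C = RtoC 0)
    by (replace ((c - 1) * s)%C with (c * s - s)%C by ring; rewrite H; ring).
  apply NNPP. intros Hs. apply (Cmult_neq_0 (c - 1)%C s); auto.
  intros E1. apply Hc. replace c with (c - 1 + 1)%C by ring. rewrite E1. ring.
Qed.

Lemma rs_const q c : rs q (fun _ => c) = (RtoC (INR q) * c)%C.
Proof.
  unfold rs. induction q; [simpl; ring|]. cbn [psum]. rewrite IHq, S_INR, RtoC_plus. ring.
Qed.

Lemma ez_orthogonal_0 N j : (1 <= N)%nat -> ~ (Z.of_nat N | j)%Z ->
  rs N (fun n => ez N (j * n)) = RtoC 0.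
Proof.
  intros HN Hj. apply C_fixed_zero with (ez N j).
  - intros H; apply Hj. now apply ez_eq_1.
  - rewrite <- rs_scal, <- (rs_shift N (fun n => ez N (j * n)) 1); auto.
    + apply rs_ext. intros h. rewrite <- ez_plus. f_equal. ring.
    + intros n. rewrite <- (ez_period N (j * n) j) by auto. f_equal. ring.
Qed.

Lemma ez_orthogonal_1 N j : (1 <= N)%nat -> (Z.of_nat N | j)%Z ->
  rs N (fun n => ez N (j * n)) = RtoC (INR N).
Proof.
  intros HN [c ->]. rewrite (rs_ext N _ (fun _ => RtoC 1)).
  - rewrite rs_const. ring.
  - intros h. rewrite <- (ez_multiple N (c * h) HN). f_equal. ring.
Qed.

(** * Dirichlet characters *)

Lemma Cconj_RtoC r : Cconj (RtoC r) = RtoC r.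
Proof. unfold Cconj, RtoC; simpl. f_equal. ring. Qed.

(** The powers chi(n)^k = chi(n^k) stay bounded by periodicity, which is impossible when |chi(n)| >
    1. *)
Lemma char_mod_le1 q chi n : dirichlet_char q chi -> Cmod (chi n) <= 1.
Proof.
  intros (Hq & H1 & Hm & Hp & H0 & _).
  destruct (periodic_bounded q chi Hq Hp) as [B [_ HB]].
  apply Rnot_lt_le. intros Hlt.
  destruct (Pow_x_infinity (Cmod (chi n)) ltac:(rewrite Rabs_pos_eq by apply Cmod_ge_0; lra) (B + 1))
    as [k Hk].
  specialize (Hk k (le_n k)).
  assert (E : Cmod (chi n) ^ k = Cmod (chi (n ^ Z.of_nat k)%Z)).
  { rewrite <- Cmod_pow. f_equal. clear - H1 Hm. induction k.
    - simpl. now rewrite H1.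
    - rewrite Nat2Z.inj_succ, Z.pow_succ_r, Hm by lia. cbn [Cpow]. now rewrite IHk. }
  rewrite E, Rabs_pos_eq in Hk by apply Cmod_ge_0. specialize (HB (n ^ Z.of_nat k)%Z). lra.
Qed.

Lemma gcd_inverse n q : (1 <= q)%nat -> Z.gcd n (Z.of_nat q) = 1%Z ->
  exists m c, (n * m = 1 + Z.of_nat q * c)%Z.
Proof.
  intros Hq H. destruct (Z.gcd_bezout n (Z.of_nat q) 1 H) as [u [v E]].
  exists u, (- v)%Z. lia.
Qed.

(** Two moduli at most 1 with product 1 both equal 1, and the inverse of a number of modulus 1 is
    its conjugate. *)
Lemma char_inv q chi n m c : dirichlet_char q chi -> (n * m = 1 + Z.of_nat q * c)%Z ->
  chi m = Cconj (chi n).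
Proof.
  intros Hd E. pose proof Hd as (Hq & H1 & Hm & Hp & _).
  assert (P : (chi n * chi m)%C = RtoC 1).
  { rewrite <- Hm, E, (periodic_add q chi Hp). exact H1. }
  pose proof (char_mod_le1 q chi n Hd). pose proof (char_mod_le1 q chi m Hd).
  assert (M : Cmod (chi n) * Cmod (chi m) = 1) by (rewrite <- Cmod_mult, P; apply Cmod_1).
  pose proof (Cmod_ge_0 (chi n)). pose proof (Cmod_ge_0 (chi m)).
  assert (M1 : Cmod (chi n) = 1) by nra.
  assert (M2 : (chi n * Cconj (chi n))%C = RtoC 1).
  { rewrite <- Cmod2_conj, M1. f_equal. ring. }
  transitivity (chi m * (chi n * Cconj (chi n)))%C; [rewrite M2; ring|].
  replace (chi m * (chi n * Cconj (chi n)))%C with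
    (chi n * chi m * Cconj (chi n))%C by ring.
  rewrite P. ring.
Qed.

Lemma gauss_sum_rs q chi : dirichlet_char q chi ->
  gauss_sum q chi = rs q (fun h => (chi h * ez q h)%C).
Proof.
  intros (Hq & _ & _ & Hp & _).
  rewrite <- (rs_shift q (fun h => (chi h * ez q h)%C) 1); auto.
  - unfold rs. rewrite psum_csum. unfold gauss_sum.
    rewrite <- seq_shift, csum_map. rewrite <- !psum_csum. apply psum_ext. intros i _.
    rewrite Nat2Z.inj_succ. unfold Z.succ. f_equal. unfold ez.
    do 2 f_equal. rewrite INR_IZR_INZ, Nat2Z.inj_succ. reflexivity.
  - intros n. rewrite Hp. f_equal.
    rewrite <- (ez_period q n 1) by auto. f_equal. lia.
Qed.

Lemma Z_divide_mult_coprime q c x : Z.gcd c (Z.of_nat q) = 1%Z ->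
  (Z.of_nat q | c * x)%Z -> (Z.of_nat q | x)%Z.
Proof. intros H D. apply Z.gauss with c; auto. now rewrite Z.gcd_comm. Qed.

Lemma periodic_char_ez q chi n : dirichlet_char q chi ->
  periodic q (fun h => (chi h * ez q (h * n))%C).
Proof.
  intros (Hq & _ & _ & Hp & _) h. rewrite Hp. f_equal.
  rewrite <- (ez_period q (h * n) n) by auto. f_equal. ring.
Qed.

(** For n coprime to q, replacing h by n^(-1) h extracts the conjugate of chi(n). For other n the
    right side is 0, and the left side vanishes by primitivity. *)
Lemma gauss_separable q chi n : primitive_char q chi -> (1 < q)%nat ->
  rs q (fun h => (chi h * ez q (h * n))%C) = (gauss_sum q chi * Cconj (chi n))%C.
Proof.
  intros [Hd Hprim] Hq1. pose proof Hd as (Hq & H1 & Hm & Hp & H0 & Hn0).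
  destruct (Z.eq_dec (Z.gcd n (Z.of_nat q)) 1) as [G|G].
  - destruct (gcd_inverse n q Hq G) as [m [c E]].
    assert (Gm : Z.gcd m (Z.of_nat q) = 1%Z).
    { apply Z.bezout_1_gcd. exists n, (- c)%Z. lia. }
    rewrite <- (rs_reindex q _ (fun h => (m * h)%Z) Hq (periodic_char_ez q chi n Hd)).
    + rewrite (gauss_sum_rs q chi Hd), Cmult_comm, <- (char_inv q chi n m c Hd E), <- rs_scal.
      apply rs_ext. intros h. rewrite Hm.
      replace (m * h * n)%Z with (h + Z.of_nat q * (c * h))%Z
        by (replace (m * h * n)%Z with (h * (n * m))%Z by ring; rewrite E; ring).
      rewrite ez_period by auto. ring.
    + intros h h' D. apply Z_divide_mult_coprime with m; auto.
      now replace (m * (h - h'))%Z with (m * h - m * h')%Z by lia.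
  - rewrite (H0 n G), Cconj_RtoC, Cmult_0_r.
    set (g := Z.gcd n (Z.of_nat q)) in *.
    assert (Hg : (0 < g)%Z).
    { assert (0 <= g)%Z by apply Z.gcd_nonneg.
      assert (g <> 0)%Z by (intros E; apply Z.gcd_eq_0 in E; lia). lia. }
    destruct (Z.gcd_divide_r n (Z.of_nat q)) as [d Hd1]. fold g in Hd1.
    destruct (Z.gcd_divide_l n (Z.of_nat q)) as [e He]. fold g in He.
    assert (Hdpos : (0 < d)%Z) by nia.
    assert (Hdq : (d < Z.of_nat q)%Z) by nia.
    (* The exponential depends on h only modulo d = q / gcd(n, q), a proper divisor of q.
       Primitivity yields a unit c congruent to 1 modulo d with chi(c) different from 1; replacing h
       by c h leaves the exponential alone and scales the sum by chi(c). *)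
    destruct (not_all_ex_not _ _ (Hprim (Z.to_nat d)
                ltac:(exists (Z.to_nat g); nia) ltac:(lia))) as [c Hc].
    apply imply_to_and in Hc. destruct Hc as [Gc Hc].
    apply imply_to_and in Hc. destruct Hc as [Mc Hc].
    rewrite Z2Nat.id in Mc by lia.
    assert (Dc : (d | c - 1)%Z).
    { apply Z.mod_divide; [lia|]. rewrite Zminus_mod, Mc, Z.sub_diag. reflexivity. }
    destruct Dc as [f Hf].
    apply C_fixed_zero with (chi c); auto.
    rewrite <- rs_scal.
    rewrite <- (rs_reindex q _ (fun h => (c * h)%Z) Hq (periodic_char_ez q chi n Hd)).
    + apply rs_ext. intros h. rewrite Hm.
      replace (c * h * n)%Z with (h * n + Z.of_nat q * (f * e * h))%Z.
      2:{ replace c with (1 + f * d)%Z by lia. rewrite Hd1, He. ring. }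
      rewrite ez_period by auto. ring.
    + intros h h' D. apply Z_divide_mult_coprime with c; auto.
      now replace (c * (h - h'))%Z with (c * h - c * h')%Z by lia.
Qed.

(** [K] is c times the delta function of Z/q. This is the common end of Fourier inversion and of the
    identity over roots of unity. *)
Lemma rs_pick q f (K : Z -> C) c j : (1 <= q)%nat -> periodic q f ->
  (forall n, (Z.of_nat q | n)%Z -> K n = c) -> (forall n, ~ (Z.of_nat q | n)%Z -> K n = RtoC 0) ->
  rs q (fun h => (f h * K (h - j)%Z)%C) = (c * f j)%C.
Proof.
  intros Hq Hf K1 K0.
  rewrite <- (rs_shift q (fun h => (f h * K (h - j)%Z)%C) j Hq).
  - unfold rs at 1. destruct q as [|q]; [lia|]. rewrite psum_S_l, psum_zero.
    + rewrite K1 by (exists 0%Z; lia). replace (Z.of_nat 0 + j)%Z with j by lia. ring.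
    + intros i Hi. rewrite K0; [ring|].
      intros [d Hd]. assert (0 < d)%Z by nia. assert (d < 1)%Z by nia. lia.
  - intros h. rewrite Hf. f_equal.
    destruct (classic (Z.of_nat q | h - j)%Z) as [D|D].
    + rewrite (K1 _ D). apply K1. destruct D as [d Hd]. exists (d + 1)%Z. lia.
    + rewrite (K0 _ D). apply K0. intros [d Hd]. apply D. exists (d - 1)%Z. lia.
Qed.

Lemma rs_dft_inverse q f j : (1 <= q)%nat -> periodic q f ->
  rs q (fun n => (rs q (fun h => (f h * ez q (h * n))%C) * ez q (- j * n))%C)
  = (RtoC (INR q) * f j)%C.
Proof.
  intros Hq Hf.
  rewrite (rs_ext q _ (fun n => rs q (fun h => (f h * ez q ((h - j) * n))%C))).
  2:{ intros n. rewrite Cmult_comm, <- rs_scal. apply rs_ext. intros h.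
      replace ((h - j) * n)%Z with (h * n + - j * n)%Z by ring. rewrite ez_plus. ring. }
  rewrite rs_swap.
  rewrite (rs_ext q _ (fun h => (f h * rs q (fun n => ez q ((h - j) * n)))%C)).
  2:{ intros h. apply rs_scal. }
  apply (rs_pick q f (fun m => rs q (fun n => ez q (m * n)))); auto.
  - intros n Hn. now apply ez_orthogonal_1.
  - intros n Hn. now apply ez_orthogonal_0.
Qed.

(** * Partial fractions of periodic Lambert series *)

Definition dft (q : nat) (b beta : Z -> C) : Prop :=
  forall l, beta l = rs q (fun h => (b h * ez q (h * l))%C).

(** The periodic antidifference of [beta]: the sum from 0 through the residue of l inclusive. The
    step from residue q-1 back to residue 0 is consistent because the sum over a full period is
    0. *)
Definition Xsum (q : nat) (beta : Z -> C) (l : Z) : C :=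
  psum (fun j => beta (Z.of_nat j)) (S (Z.to_nat (l mod Z.of_nat q))).

Lemma Xsum_diff q beta l : (1 <= q)%nat -> periodic q beta -> rs q beta = RtoC 0 ->
  (Xsum q beta l - Xsum q beta (l - 1))%C = beta l.
Proof.
  intros Hq Hp H0. unfold Xsum. rewrite <- (periodic_mod q beta l Hq Hp).
  pose proof (Z.mod_pos_bound l (Z.of_nat q) ltac:(lia)) as HB.
  destruct (Z.eq_dec (l mod Z.of_nat q) 0) as [E|E].
  - assert (E2 : ((l - 1) mod Z.of_nat q = Z.of_nat q - 1)%Z).
    { symmetry. apply Z.mod_unique with (l / Z.of_nat q - 1)%Z; [lia|].
      pose proof (Z.div_mod l (Z.of_nat q) ltac:(lia)). lia. }
    rewrite E, E2. replace (S (Z.to_nat (Z.of_nat q - 1))) with q by lia.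
    fold (rs q beta). rewrite H0. simpl. ring.
  - assert (E2 : ((l - 1) mod Z.of_nat q = l mod Z.of_nat q - 1)%Z).
    { symmetry. apply Z.mod_unique with (l / Z.of_nat q)%Z; [lia|].
      pose proof (Z.div_mod l (Z.of_nat q) ltac:(lia)). lia. }
    rewrite E2. replace (S (Z.to_nat (l mod Z.of_nat q - 1))) with (Z.to_nat (l mod Z.of_nat q)) by lia.
    cbn [psum]. rewrite Z2Nat.id by lia. ring.
Qed.

Lemma Xsum_periodic q beta : (1 <= q)%nat -> periodic q (Xsum q beta).
Proof.
  intros Hq l. unfold Xsum. do 3 f_equal.
  replace (l + Z.of_nat q)%Z with (l + 1 * Z.of_nat q)%Z by lia. apply Z_mod_plus_full.
Qed.

Lemma CS_geom x : Cmod x < 1 -> CS (fun j => (x ^ j)%C) (/ (1 - x))%C.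
Proof.
  intros Hx.
  assert (H1 : (1 - x)%C <> RtoC 0).
  { intros E. assert (x = RtoC 1) by (replace x with (1 - (1 - x))%C by ring;
      rewrite E; ring). subst. rewrite Cmod_1 in Hx. lra. }
  assert (H : Clim (fun n => (x ^ n)%C) (RtoC 0)).
  { unfold Clim. apply is_lim_seq_ext with (fun n => Cmod x ^ n).
    - intros n. rewrite <- Cmod_pow. f_equal. ring.
    - apply is_lim_seq_geom. rewrite Rabs_pos_eq by apply Cmod_ge_0. exact Hx. }
  unfold CS.
  replace (/ (1 - x))%C with
    ((/ (1 - x)) * (1 - 0))%C by ring.
  eapply Clim_ext; [|apply Clim_scal, Clim_minus; [apply Clim_const|exact H]].
  intros n. simpl. induction n.
  - simpl. ring.
  - cbn [psum Cpow]. rewrite <- IHn. generalize (x ^ n)%C. intros. field. auto.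
Qed.

(** Spreads a sequence over the multiples of [M]. A power series in e^(-t/M) whose only exponents
    are multiples of M has this shape, and so does the contribution of one divisor M to a divisor
    sum. *)
Definition stretch (M : nat) (f : nat -> C) (j : nat) : C :=
  if Nat.eqb (j mod M) 0 then f (j / M)%nat else RtoC 0.

Lemma psum_stretch M f n : (1 <= M)%nat -> psum (stretch M f) (M * n) = psum f n.
Proof.
  intros HM. induction n; [now rewrite Nat.mul_0_r|].
  rewrite Nat.mul_succ_r, psum_app, IHn. cbn [psum]. f_equal.
  destruct M as [|M]; [lia|]. rewrite psum_S_l.
  rewrite psum_zero.
  - unfold stretch. rewrite Nat.add_0_r, Nat.mul_comm, Nat.Div0.mod_mul, Nat.div_mul by lia.
    simpl. ring.
  - intros i Hi. unfold stretch.
    replace (S M * n + S i)%nat with (S i + n * S M)%nat by lia.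
    rewrite Nat.Div0.mod_add, Nat.mod_small by lia. reflexivity.
Qed.

Lemma CS_stretch M f s : (1 <= M)%nat -> CS (stretch M f) s -> CS f s.
Proof.
  intros HM H. unfold CS, Clim in *.
  apply is_lim_seq_ext with (fun n => Cmod (psum (stretch M f) (M * n) - s)).
  - intros n; now rewrite psum_stretch.
  - apply (is_lim_seq_subseq (fun n => Cmod (psum (stretch M f) n - s)) 0 (fun n => (M * n)%nat)); auto.
    apply eventually_subseq. intros n. nia.
Qed.

(** Each fraction on the right is a geometric series in r e(-l/N), with N = q M and r = e^(-t/M).
    Once beta is expanded by [dft], orthogonality modulo N retains the exponents j congruent to h M,
    that is j = M d with d congruent to h modulo q, and r^(M d) = e^(-d t). *)
Lemma lambert_finite q b beta M t : (1 <= q)%nat -> (1 <= M)%nat -> periodic q b ->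
  dft q b beta -> 0 < t ->
  CS (fun d => (b (Z.of_nat d) * RtoC (exp (- (INR d * t))))%C)
     ((/ RtoC (INR (q * M))) * rs (q * M) (fun l => (beta l * (/ (1 - RtoC (exp (- (t / INR M))) * ez (q * M) (- l))))%C))%C.
Proof.
  intros Hq HM Hb Hbeta Ht. set (N := (q * M)%nat).
  assert (HN : (1 <= N)%nat) by (unfold N; nia).
  assert (HMp : 0 < INR M) by (apply lt_0_INR; lia).
  assert (HNn : RtoC (INR N) <> RtoC 0)
    by (intros E; injection E as E; revert E; apply not_0_INR; lia).
  set (r := exp (- (t / INR M))).
  set (x := fun l => (RtoC r * ez N (- l))%C).
  assert (Hx : forall l, Cmod (x l) < 1).
  { intros l. unfold x. rewrite Cmod_mult, Cmod_ez, Cmod_R, Rabs_pos_eq, Rmult_1_r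
      by apply Rlt_le, exp_pos.
    unfold r. rewrite <- exp_0. apply exp_increasing.
    assert (0 < t / INR M) by now apply Rdiv_lt_0_compat. lra. }
  apply (CS_stretch M _ _ HM).
  eapply CS_ext; [|apply CS_scal, (CS_psum (fun l j => (beta (Z.of_nat l) * x (Z.of_nat l) ^ j)%C))].
  2:{ intros l _. apply CS_scal, CS_geom, Hx. }
  intros j. simpl.
  assert (E : psum (fun l => (beta (Z.of_nat l) * x (Z.of_nat l) ^ j)%C) N =
              (RtoC (r ^ j) * rs q (fun h => (b h * rs N (fun l => ez N ((h * Z.of_nat M - Z.of_nat j) * l)))%C))%C).
  { transitivity (rs N (fun l => (RtoC (r ^ j) * rs q (fun h => (b h * ez N ((h * Z.of_nat M - Z.of_nat j) * l))%C))%C)).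
    - apply psum_ext. intros l _. rewrite Hbeta, <- !rs_scal.
      rewrite Cmult_comm, <- rs_scal. apply rs_ext. intros h.
      assert (Ex : (x (Z.of_nat l) ^ j)%C = (RtoC (r ^ j) * ez N (- Z.of_nat j * Z.of_nat l))%C).
      { clear. unfold x. induction j.
        - cbn [Cpow pow]. replace (- Z.of_nat 0 * Z.of_nat l)%Z with 0%Z by lia. rewrite ez_0. ring.
        - cbn [Cpow pow]. rewrite IHj, RtoC_mult.
          replace (- Z.of_nat (S j) * Z.of_nat l)%Z with (- Z.of_nat l + - Z.of_nat j * Z.of_nat l)%Z by lia.
          rewrite ez_plus. ring. }
      rewrite Ex.
      replace ((h * Z.of_nat M - Z.of_nat j) * Z.of_nat l)%Z with
        (Z.of_nat M * (h * Z.of_nat l) + - Z.of_nat j * Z.of_nat l)%Z by ring.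
      rewrite ez_plus. unfold N at 2. rewrite ez_scale by auto. ring.
    - rewrite rs_scal. f_equal. rewrite rs_swap. apply rs_ext. intros h. now rewrite rs_scal. }
  rewrite E. unfold stretch.
  destruct (Nat.eqb_spec (j mod M) 0) as [Ej|Ej].
  - assert (Hj : j = (M * (j / M))%nat) by (pose proof (Nat.div_mod j M ltac:(lia)); lia).
    set (d := (j / M)%nat) in *.
    rewrite (rs_ext q _ (fun h => (b h * rs N (fun l => ez N ((h - Z.of_nat d) * Z.of_nat M * l)))%C)).
    2:{ intros h. f_equal. apply rs_ext. intros l. f_equal. rewrite Hj. lia. }
    rewrite (rs_pick q b (fun n => rs N (fun l => ez N (n * Z.of_nat M * l))) (RtoC (INR N))); auto.
    + assert (Er : r ^ j = exp (- (INR d * t))).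
      { unfold r. rewrite <- Rpower_pow by apply exp_pos. unfold Rpower. rewrite ln_exp. f_equal.
        rewrite Hj, mult_INR. field. lra. }
      rewrite Er. field. auto.
    + intros n [c Hc]. apply ez_orthogonal_1; auto. exists c. unfold N. nia.
    + intros n Hn. apply ez_orthogonal_0; auto. intros [c Hc]. apply Hn. exists c.
      unfold N in Hc. apply Z.mul_cancel_r with (Z.of_nat M); [lia|]. rewrite Hc. lia.
  - rewrite (rs_ext q _ (fun _ => RtoC 0)).
    + rewrite rs_const. ring.
    + intros h. rewrite ez_orthogonal_0; auto; [ring|].
      intros [c Hc]. apply Ej.
      assert (D : (Z.of_nat M | Z.of_nat j)%Z)
        by (exists (h - c * Z.of_nat q)%Z; unfold N in Hc; nia).
      apply Nat2Z.inj. rewrite Nat2Z.inj_mod. apply Z.mod_divide; [lia|auto].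
Qed.

Lemma rs_symmetric K g : (1 <= K)%nat -> periodic (2 * K) g -> rs (2 * K) g = psum (zs g) K.
Proof.
  intros HK Hg. rewrite <- (rs_shift (2 * K) g (- Z.of_nat K)) by (auto; lia).
  unfold rs. replace (2 * K)%nat with (K + K)%nat by lia. rewrite psum_app.
  unfold zs. rewrite psum_plus, Cplus_comm. f_equal.
  - apply psum_ext. intros i _. f_equal. lia.
  - clear. assert (H : forall n, psum (fun i => g (Z.of_nat i + - Z.of_nat n)%Z) n =
                       psum (fun i => g (- Z.of_nat i - 1)%Z) n).
    { induction n; auto. rewrite psum_S_l. cbn [psum].
      rewrite Cplus_comm. f_equal; [|f_equal; lia].
      rewrite <- IHn. apply psum_ext. intros i _. f_equal. lia. }
    apply H.
Qed.

Lemma sin_ge_quarter y : 0 <= y <= PI / 2 -> y / 4 <= sin y.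
Proof.
  intros [H0 H1].
  pose proof PI_4 as P4.
  assert (Hl : sin_lb y <= sin y) by (apply SIN; lra).
  eapply Rle_trans; [|exact Hl].
  unfold sin_lb, sin_approx, sum_f_R0, sin_term. simpl.
  (* From y <= pi/2 <= 2 the factor 1 - y^2/6 is at least 1/3, and the next two Taylor terms are
     jointly nonnegative; so 1/4 is safe. *)
  assert (Hd : 0 <= y * y <= 4) by nra.
  match goal with |- _ <= ?e =>
    replace e with (y * (1 - y * y / 6 + (y * y) * (y * y) * (1 / 120 - (y * y) / 5040))) by field end.
  set (s := y * y) in *.
  assert (0 <= s * s * (1 / 120 - s / 5040)) by (apply Rmult_le_pos; nra).
  replace (y / 4) with (y * (1 / 4)) by field.
  apply Rmult_le_compat_l; auto. lra.
Qed.

Lemma sin_abs_ge_quarter y : Rabs y <= PI / 2 -> Rabs y / 4 <= Rabs (sin y).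
Proof.
  intros H. destruct (Rle_lt_dec 0 y) as [Hy|Hy].
  - rewrite (Rabs_pos_eq y Hy) in *. eapply Rle_trans; [apply sin_ge_quarter; lra|apply Rle_abs].
  - rewrite (Rabs_left y Hy) in *. rewrite <- Rabs_Ropp, <- sin_neg.
    eapply Rle_trans; [apply sin_ge_quarter; lra|apply Rle_abs].
Qed.

Lemma one_minus_polar_sq r th :
  Cmod (1 - RtoC r * Cexp (0, th)) ^ 2 =
  (1 - r) ^ 2 + 4 * r * sin (th / 2) ^ 2.
Proof.
  rewrite Cmod2_alt. unfold Cexp, Cminus, Cplus, Copp, Cmult, RtoC, Re, Im; cbn [fst snd].
  rewrite exp_0.
  pose proof (cos_2a_sin (th / 2)) as H. replace (2 * (th / 2)) with th in H by field.
  pose proof (sin2_cos2 th) as H2. unfold Rsqr in H2.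
  replace (4 * r * sin (th / 2) ^ 2) with (2 * r * (1 - cos th)) by (rewrite H; ring).
  replace ((1 + - (r * (1 * cos th) - 0 * (1 * sin th))) ^ 2 + (0 + - (r * (1 * sin th) + 0 * (1 * cos th))) ^ 2)
    with (1 - 2 * r * cos th + r * r * (sin th * sin th + cos th * cos th)) by ring.
  rewrite H2. ring.
Qed.

Lemma one_minus_exp_ge y : 0 <= y -> y * exp (- y) <= 1 - exp (- y).
Proof.
  intros Hy. pose proof (exp_ineq1_le y) as H. pose proof (exp_pos (- y)) as P.
  assert (E : exp y * exp (- y) = 1) by (rewrite <- exp_plus, Rplus_opp_r; apply exp_0).
  nra.
Qed.

(** The bound is free of [M], which makes it a majorant for the limit over M. In |1 - r e^(i th)|^2
    = (1-r)^2 + 4 r sin^2(th/2) the first term yields the constant part and the second the part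
    linear in |l|, as |th|/2 <= pi/2 on centred residues. The factor 1/2 averages the two
    estimates. *)
Lemma kernel_lower q M t l : (1 <= q)%nat -> (1 <= M)%nat -> 0 < t ->
  (2 * Z.abs l <= Z.of_nat (q * M))%Z ->
  exp (- t) * Rmin t 1 / 2 * (1 + IZR (Z.abs l)) <=
  INR (q * M) * Cmod (1 - RtoC (exp (- (t / INR M))) * ez (q * M) (- l)).
Proof.
  intros Hq HM Ht Hl.
  assert (HMp : 1 <= INR M) by (apply (le_INR 1); lia).
  assert (Hqp : 1 <= INR q) by (apply (le_INR 1); lia).
  set (N := (q * M)%nat) in *.
  assert (EN : INR N = INR q * INR M) by apply mult_INR.
  assert (HNp : 1 <= INR N) by (rewrite EN; nra).
  set (y := t / INR M).
  assert (Hy : 0 < y) by (apply Rdiv_lt_0_compat; lra).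
  assert (Hyt : y <= t).
  { unfold y. apply Rmult_le_reg_r with (INR M); [lra|]. unfold Rdiv. rewrite Rmult_assoc, Rinv_l; nra. }
  assert (Het : exp (- t) <= exp (- y)) by (destruct (Req_dec y t) as [->|]; [lra|apply Rlt_le, exp_increasing; lra]).
  pose proof (exp_pos (- t)) as Ep.
  unfold ez. set (th := 2 * PI * IZR (- l) / INR N).
  pose proof (one_minus_polar_sq (exp (- y)) th) as Sq.
  set (D := Cmod (1 - RtoC (exp (- y)) * Cexp (0, th))) in *.
  assert (D0 : 0 <= D) by apply Cmod_ge_0.
  assert (A1 : 1 - exp (- y) <= D).
  {
    apply Rsqr_incr_0_var; auto. unfold Rsqr. pose proof (exp_pos (- y)). nra. }
  assert (Ey1 : exp (- y) < 1) by (rewrite <- exp_0; apply exp_increasing; lra).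
  assert (A2 : 2 * exp (- y) * Rabs (sin (th / 2)) <= D).
  { apply Rsqr_incr_0_var; auto. unfold Rsqr.
    assert (Hs : Rabs (sin (th / 2)) * Rabs (sin (th / 2)) = sin (th / 2) ^ 2)
      by (rewrite <- Rabs_mult, Rabs_pos_eq by nra; ring).
    pose proof (exp_pos (- y)).
    assert (exp (- y) * exp (- y) * (sin (th / 2)) ^ 2 <= exp (- y) * (sin (th / 2)) ^ 2)
      by (apply Rmult_le_compat_r; nra).
    nra. }
  assert (Eth : Rabs (th / 2) = PI * IZR (Z.abs l) / INR N).
  { unfold th. replace (2 * PI * IZR (- l) / INR N / 2) with (- (PI / INR N * IZR l))
      by (rewrite opp_IZR; field; lra).
    pose proof PI_RGT_0.
    rewrite Rabs_Ropp, Rabs_mult, Rabs_pos_eq, abs_IZR by (apply Rlt_le, Rdiv_lt_0_compat; lra).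
    field; lra. }
  assert (A3 : Rabs (th / 2) / 4 <= Rabs (sin (th / 2))).
  { apply sin_abs_ge_quarter. rewrite Eth. pose proof PI_RGT_0.
    assert (2 * IZR (Z.abs l) <= INR N).
    { rewrite INR_IZR_INZ, <- mult_IZR. now apply IZR_le. }
    apply Rmult_le_reg_r with (2 * INR N); [lra|].
    replace (PI * IZR (Z.abs l) / INR N * (2 * INR N)) with (PI * (2 * IZR (Z.abs l))) by (field; lra).
    replace (PI / 2 * (2 * INR N)) with (PI * INR N) by field.
    apply Rmult_le_compat_l; lra. }
  assert (Ll : 0 <= IZR (Z.abs l)) by (apply IZR_le; lia).
  assert (B1 : exp (- t) * t <= INR N * D).
  { pose proof (one_minus_exp_ge y ltac:(lra)).
    apply Rle_trans with (INR N * (y * exp (- y))).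
    - replace (INR N * (y * exp (- y))) with (INR q * (t * exp (- y)))
        by (rewrite EN; unfold y; field; lra).
      assert (exp (- t) * t <= t * exp (- y)) by nra.
      assert (0 <= t * exp (- y)) by nra. nra.
    - apply Rmult_le_compat_l; lra. }
  assert (B2 : exp (- t) * IZR (Z.abs l) <= INR N * D).
  { apply Rle_trans with (INR N * (2 * exp (- t) * (Rabs (th / 2) / 4))).
    - rewrite Eth.
      replace (INR N * (2 * exp (- t) * (PI * IZR (Z.abs l) / INR N / 4)))
        with (exp (- t) * IZR (Z.abs l) * (PI / 2)) by (field; lra).
      pose proof PI2_1.
      assert (0 <= exp (- t) * IZR (Z.abs l)) by nra. unfold PI2 in *. nra.
    - apply Rmult_le_compat_l; [lra|].
      eapply Rle_trans; [|exact A2].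
      apply Rmult_le_compat; try nra. apply Rmult_le_pos; [apply Rabs_pos|lra]. }
  pose proof (Rmin_l t 1). pose proof (Rmin_r t 1).
  assert (exp (- t) * Rmin t 1 <= exp (- t) * t) by (apply Rmult_le_compat_l; lra).
  assert (exp (- t) * (Rmin t 1 * IZR (Z.abs l)) <= exp (- t) * (1 * IZR (Z.abs l)))
    by (apply Rmult_le_compat_l; [lra|apply Rmult_le_compat_r; lra]).
  nra.
Qed.

Lemma derivable_seq_quotient g l (h : nat -> R) : derivable_pt_lim g 0 l ->
  (forall m, h m <> 0) -> is_lim_seq h 0 ->
  is_lim_seq (fun m => (g (h m) - g 0) / h m) l.
Proof.
  intros Hg Hn Hh. apply is_lim_seq_spec. intros eps.
  destruct (Hg eps (cond_pos eps)) as [d Hd].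
  apply is_lim_seq_spec in Hh. destruct (Hh d) as [N HN].
  exists N. intros n Hn'. specialize (HN n Hn'). rewrite Rminus_0_r in HN.
  specialize (Hd (h n) (Hn n) HN). now rewrite Rplus_0_l in Hd.
Qed.

Lemma Clim_exp_quotient w (h : nat -> R) : (forall m, h m <> 0) -> is_lim_seq h 0 ->
  Clim (fun m => (RtoC (/ h m) * (1 - Cexp (- (RtoC (h m) * w))%C))%C) w.
Proof.
  intros Hn Hh. destruct w as [a b]. apply Clim_re_im.
  - apply is_lim_seq_ext with (fun m => (- (exp (- (h m * a)) * cos (- (h m * b))) - - (exp (- (0 * a)) * cos (- (0 * b)))) / h m).
    { intros m. unfold Cexp, Cminus, Cplus, Copp, Cmult, RtoC, Re, Im; cbn [fst snd].
      rewrite !Rmult_0_l, !Ropp_0, exp_0, cos_0, !Rminus_0_r, !Rplus_0_r. unfold Rdiv. ring. }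
    apply (derivable_seq_quotient (fun x => - (exp (- (x * a)) * cos (- (x * b))))); auto.
    apply is_derive_Reals. auto_derive; auto.
    rewrite !Rmult_0_l, !Ropp_0, exp_0, cos_0, sin_0. simpl. ring.
  - apply is_lim_seq_ext with (fun m => (- (exp (- (h m * a)) * sin (- (h m * b))) - - (exp (- (0 * a)) * sin (- (0 * b)))) / h m).
    { intros m. unfold Cexp, Cminus, Cplus, Copp, Cmult, RtoC, Re, Im; cbn [fst snd].
      rewrite !Rmult_0_l, !Ropp_0, exp_0, sin_0, !Rminus_0_r, !Rplus_0_r. unfold Rdiv. ring. }
    apply (derivable_seq_quotient (fun x => - (exp (- (x * a)) * sin (- (x * b))))); auto.
    apply is_derive_Reals. auto_derive; auto.
    rewrite !Rmult_0_l, !Ropp_0, exp_0, cos_0, sin_0. simpl. ring.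
Qed.

Lemma rs_minus q f g : rs q (fun h => (f h - g h)%C) = (rs q f - rs q g)%C.
Proof.
  unfold rs. induction q; cbn [psum]; [ring|]. rewrite IHq. ring.
Qed.

(** Summation by parts on the cyclic group Z/N, where there is no boundary. *)
Lemma rs_abel N (beta X c : Z -> C) : (1 <= N)%nat -> periodic N X -> periodic N c ->
  (forall l, (X l - X (l - 1)%Z)%C = beta l) ->
  rs N (fun l => (beta l * c l)%C) =
  rs N (fun l => (X l * (c l - c (l + 1)%Z))%C).
Proof.
  intros HN HX Hc H.
  rewrite (rs_ext N _ (fun l => (X l * c l - X (l - 1)%Z * c l)%C))
    by (intros l; rewrite <- H; ring).
  rewrite (rs_ext N (fun l => (X l * (c l - c (l + 1)%Z))%C)
    (fun l => (X l * c l - X (l + 1 - 1)%Z * c (l + 1)%Z)%C)).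
  2:{ intros l. replace (l + 1 - 1)%Z with l by lia. ring. }
  rewrite !rs_minus. f_equal.
  symmetry. apply (rs_shift N (fun l => (X (l - 1)%Z * c l)%C) 1 HN).
  intros l. rewrite Hc. replace (l + Z.of_nat N - 1)%Z with (l - 1 + Z.of_nat N)%Z by lia.
  now rewrite HX.
Qed.

Definition zpt (u : R) (l : Z) : C := (u, 2 * PI * IZR l).

Lemma zpt_neq0 u l : u <> 0 -> zpt u l <> RtoC 0.
Proof. intros H E. injection E as E _. auto. Qed.

Lemma zpt_succ u l : zpt u (l + 1) = (zpt u l + (0, 2 * PI)%R)%C.
Proof.
  unfold zpt, Cplus; simpl. rewrite plus_IZR. f_equal; ring.
Qed.

Lemma Rinv_pow_add_le x j k : 1 <= x -> (/ x) ^ (k + j) <= (/ x) ^ j.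
Proof.
  intros Hx.
  assert (Hi : 0 < / x <= 1).
  { split; [apply Rinv_0_lt_compat; lra|]. rewrite <- Rinv_1. apply Rinv_le_contravar; lra. }
  assert (I1 : (/ x) ^ k <= 1) by (rewrite <- (pow1 k); apply pow_incr; lra).
  assert (I2 : 0 <= (/ x) ^ j) by (apply pow_le; lra).
  rewrite pow_add. nra.
Qed.

Lemma wt1_eq n : wt 1 n = (/ INR (S n)) ^ 2.
Proof.
  unfold wt. assert (0 < INR (S n)) by (apply lt_0_INR; lia).
  rewrite Rpower_Ropp, pow_inv. f_equal. replace (1 + 1) with (INR 2) by (simpl; ring).
  now apply Rpower_pow.
Qed.

Lemma zidx_abs l : (Z.of_nat (zidx l) <= Z.abs l)%Z /\ (Z.of_nat (zidx l) <= Z.abs (l + 1))%Z.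
Proof. unfold zidx. destruct (Z.leb_spec 0 l); lia. Qed.

Lemma zidx_le_IZR l : INR (S (zidx l)) <= 1 + IZR (Z.abs l) /\
  INR (S (zidx l)) <= 1 + IZR (Z.abs (l + 1)).
Proof.
  pose proof (zidx_abs l) as [A B]. rewrite S_INR, INR_IZR_INZ.
  apply IZR_le in A, B. lra.
Qed.

(** The chord between neighbouring roots of unity has length 2 sin(pi/N), at most the arc 2 pi/N. *)
Lemma ez_dist N l : (1 <= N)%nat ->
  INR N * Cmod (ez N (- l) - ez N (- (l + 1))) <= 2 * PI.
Proof.
  intros HN. assert (HNp : 0 < INR N) by (apply lt_0_INR; lia). pose proof PI_RGT_0.
  replace (- (l + 1))%Z with (- l + -1)%Z by lia. rewrite ez_plus.
  replace (ez N (- l) - ez N (- l) * ez N (-1))%C with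
    (ez N (- l) * (1 - ez N (-1)))%C by ring.
  rewrite Cmod_mult, Cmod_ez, Rmult_1_l.
  apply Rmult_le_reg_l with (/ INR N); [now apply Rinv_0_lt_compat|].
  rewrite <- Rmult_assoc, Rinv_l, Rmult_1_l by lra.
  pose proof (one_minus_polar_sq 1 (2 * PI * -1 / INR N)) as Sq.
  rewrite Cmult_1_l in Sq. fold (ez N (-1)) in Sq.
  assert (0 < PI / INR N) by now apply Rdiv_lt_0_compat.
  apply Rsqr_incr_0_var; [|apply Rmult_le_pos; [apply Rlt_le, Rinv_0_lt_compat|]; lra].
  unfold Rsqr.
  match goal with |- ?a * ?a <= _ => replace (a * a) with (a ^ 2) by ring end.
  rewrite Sq.
  replace (2 * PI * -1 / INR N / 2) with (- (PI / INR N)) by (field; lra).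
  rewrite sin_neg.
  replace (/ INR N * (2 * PI) * (/ INR N * (2 * PI))) with (4 * (PI / INR N * (PI / INR N))) by (field; lra).
  assert (S1 : sin (PI / INR N) <= PI / INR N) by (apply Rlt_le, sin_lt_x; lra).
  assert (S2 : 0 <= sin (PI / INR N)).
  { apply sin_ge_0; [lra|]. apply Rmult_le_reg_r with (INR N); auto.
    assert (1 <= INR N) by (apply (le_INR 1); lia).
    replace (PI / INR N * INR N) with PI by (field; lra). nra. }
  nra.
Qed.

(** Summation by parts is done on Z/N before the limit. The terms then are X(l) times a difference
    of two neighbouring kernels, bounded by a multiple of 1/(1+|l|)^2 uniformly in N, and [tannery]
    applies. *)
Lemma lipschitz_0 q b beta t : (1 <= q)%nat -> periodic q b -> periodic q beta ->
  rs q beta = RtoC 0 ->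
  dft q b beta -> 0 < t ->
  exists L,
  CS (fun d => (b (Z.of_nat d) * RtoC (exp (- (INR d * t))))%C) L /\
  ZS (fun l => (Xsum q beta l * ((/ zpt (INR q * t) l) - (/ zpt (INR q * t) (l + 1))))%C) L.
Proof.
  intros Hq Hb Hbp Hb0 Hbeta Ht.
  set (X := Xsum q beta).
  assert (HX : forall l, (X l - X (l - 1)%Z)%C = beta l) by (intros; now apply Xsum_diff).
  assert (HXp : periodic q X) by now apply Xsum_periodic.
  destruct (periodic_bounded q X Hq HXp) as [B [B0 HB]].
  assert (Hqp : 1 <= INR q) by (apply (le_INR 1); lia).
  (* Even values of M make q M = 2 K, so the residues can be centred as -K, ..., K-1, the range of K
     terms of [zs]. *)
  set (M := fun m : nat => (2 * S m)%nat).
  set (K := fun m : nat => (q * S m)%nat).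
  assert (HM : forall m, (1 <= M m)%nat) by (intros; unfold M; lia).
  assert (HN : forall m, (1 <= q * M m)%nat) by (intros; specialize (HM m); nia).
  assert (HMR : forall m, 1 <= INR (M m)) by (intros; apply (le_INR 1), HM).
  set (x := fun m l => (RtoC (exp (- (t / INR (M m)))) * ez (q * M m) (- l))%C).
  set (c := fun m l => (/ (1 - x m l))%C).
  assert (Hx1 : forall m l, (1 - x m l)%C <> RtoC 0).
  { intros m l E.
    assert (E1 : x m l = RtoC 1) by (replace (x m l) with (1 - (1 - x m l))%C by ring;
      rewrite E; ring).
    assert (E2 : Cmod (x m l) = 1) by (rewrite E1; apply Cmod_1).
    unfold x in E2. rewrite Cmod_mult, Cmod_ez, Cmod_R, Rabs_pos_eq, Rmult_1_r in E2
      by apply Rlt_le, exp_pos.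
    rewrite <- exp_0 in E2. apply exp_inv in E2.
    assert (0 < t / INR (M m)) by (apply Rdiv_lt_0_compat; auto; specialize (HMR m); lra). lra. }
  assert (Hcp : forall m, periodic (q * M m) (c m)).
  { intros m l. unfold c, x. do 3 f_equal.
    rewrite <- (ez_period (q * M m) (- l) (-1)) by auto. f_equal. lia. }
  assert (HXN : forall m, periodic (q * M m) X).
  { intros m l. rewrite Nat2Z.inj_mul. now apply periodic_add. }
  set (T := fun m l => ((/ RtoC (INR (q * M m))) * (X l * (c m l - c m (l + 1)%Z)))%C).
  pose proof (fun m => lambert_finite q b beta (M m) t Hq (HM m) Hb Hbeta Ht) as HV.
  fold (x 0%nat) in HV.
  (* The finite sums for all m equal the same Lambert series, so any of them can name its value; the
     sequence passed to [tannery] is constant. *)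
  set (L := psum (zs (T 0%nat)) (K 0%nat)).
  assert (HT : forall m, CS (fun d => (b (Z.of_nat d) * RtoC (exp (- (INR d * t))))%C)
                 (psum (zs (T m)) (K m))).
  { intros m.
    assert (E : psum (zs (T m)) (K m) = ((/ RtoC (INR (q * M m))) * rs (q * M m) (fun l => (beta l * c m l)%C))%C).
    { rewrite (rs_abel (q * M m) beta X (c m)); auto.
      rewrite <- rs_scal. change (psum (zs (T m)) (K m) = rs (q * M m) (T m)).
      replace (q * M m)%nat with (2 * K m)%nat by (unfold M, K; lia).
      symmetry. apply rs_symmetric; [unfold K; nia|].
      replace (2 * K m)%nat with (q * M m)%nat by (unfold M, K; lia).
      intros l. unfold T. rewrite (HXN m l), (Hcp m l).
      replace (l + Z.of_nat (q * M m) + 1)%Z with (l + 1 + Z.of_nat (q * M m))%Z by lia.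
      now rewrite (Hcp m (l + 1)%Z). }
    rewrite E. apply HV. }
  exists L. split; [apply HT|].
  (* Extension by 0 beyond the residue system turns the finite sums into series; each fixed index is
     eventually inside. *)
  set (f := fun m n => if Nat.ltb n (K m) then zs (T m) n else RtoC 0).
  set (kap := exp (- t) * Rmin t 1 / 2).
  assert (Hkap : 0 < kap).
  { unfold kap. pose proof (exp_pos (- t)). assert (0 < Rmin t 1) by (apply Rmin_glb_lt; lra).
    apply Rdiv_lt_0_compat; [|lra]. now apply Rmult_lt_0_compat. }
  destruct (tannery f (zs (fun l => (X l * ((/ zpt (INR q * t) l) - (/ zpt (INR q * t) (l + 1)%Z)))%C))
     (fun n => 2 * (B * (2 * PI) / (kap * kap)) * wt 1 n) (fun _ => L)) as [L' [H1 H2]].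
  - intros m n. pose proof PI_RGT_0 as Hpi.
    assert (W : 0 <= B * (2 * PI) / (kap * kap))
      by (apply Rlt_le, Rdiv_lt_0_compat; apply Rmult_lt_0_compat; lra).
    unfold f. destruct (Nat.ltb_spec n (K m)) as [Hn|Hn].
    2:{ rewrite Cmod_0. pose proof (wt_pos 1 n).
        apply Rmult_le_pos; [apply Rmult_le_pos|]; lra. }
    assert (Hl : forall l, zidx l = n -> Cmod (T m l) <= B * (2 * PI) / (kap * kap) * wt 1 n).
    { intros l El.
      assert (R1 : (2 * Z.abs l <= Z.of_nat (q * M m))%Z).
      { unfold zidx in El. unfold K in Hn. unfold M. destruct (Z.leb_spec 0 l); nia. }
      assert (R2 : (2 * Z.abs (l + 1) <= Z.of_nat (q * M m))%Z).
      { unfold zidx in El. unfold K in Hn. unfold M. destruct (Z.leb_spec 0 l); nia. }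
      pose proof (kernel_lower q (M m) t l Hq (HM m) Ht R1) as A1.
      pose proof (kernel_lower q (M m) t (l + 1) Hq (HM m) Ht R2) as A2.
      fold kap in A1, A2. fold (x m l) in A1. fold (x m (l + 1)%Z) in A2.
      destruct (zidx_le_IZR l) as [Z1 Z2]. rewrite El in Z1, Z2.
      pose proof (ez_dist (q * M m) l (HN m)) as A3.
      set (N := INR (q * M m)) in *.
      assert (HNp : 0 < N) by (apply lt_0_INR; pose proof (HN m); lia).
      assert (ET : T m l = (X l * (RtoC N * (x m l - x m (l + 1)%Z) * ((/ (RtoC N * (1 - x m l))) * (/ (RtoC N * (1 - x m (l + 1)%Z))))))%C).
      { unfold T, c. fold N.
        assert (RtoC N <> RtoC 0) by (intros E; injection E; lra).
        field. auto. }
      assert (Hne : forall l', (RtoC N * (1 - x m l'))%C <> RtoC 0).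
      { intros l'. apply Cmult_neq_0; auto. intros E; injection E; lra. }
      rewrite ET, !Cmod_mult, !Cmod_inv, !Cmod_mult by auto.
      rewrite (Cmod_R N), Rabs_pos_eq by lra.
      assert (A4 : N * Cmod (x m l - x m (l + 1)%Z) <= 2 * PI).
      { unfold x. replace (_ - _)%C with (RtoC (exp (- (t / INR (M m)))) * (ez (q * M m) (- l) - ez (q * M m) (- (l + 1))))%C by ring.
        rewrite Cmod_mult, Cmod_R, Rabs_pos_eq by apply Rlt_le, exp_pos.
        assert (exp (- (t / INR (M m))) <= 1).
        { rewrite <- exp_0. apply Rlt_le, exp_increasing.
          assert (0 < t / INR (M m)) by (apply Rdiv_lt_0_compat; auto; specialize (HMR m); lra). lra. }
        pose proof (exp_pos (- (t / INR (M m)))).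
        pose proof (Cmod_ge_0 (ez (q * M m) (- l) - ez (q * M m) (- (l + 1)))%C). nra. }
      assert (HSn : 0 < INR (S n)) by (apply lt_0_INR; lia).
      assert (I1 : / (N * Cmod (1 - x m l)) <= / (kap * INR (S n))).
      { apply Rinv_le_contravar; [now apply Rmult_lt_0_compat|].
        eapply Rle_trans; [|exact A1]. apply Rmult_le_compat_l; lra. }
      assert (I2 : / (N * Cmod (1 - x m (l + 1)%Z)) <= / (kap * INR (S n))).
      { apply Rinv_le_contravar; [now apply Rmult_lt_0_compat|].
        eapply Rle_trans; [|exact A2]. apply Rmult_le_compat_l; lra. }
      rewrite wt1_eq.
      replace (B * (2 * PI) / (kap * kap) * (/ INR (S n)) ^ 2) with
        (B * (2 * PI * (/ (kap * INR (S n)) * / (kap * INR (S n))))) by (field; lra).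
      assert (P : forall l', 0 <= / (N * Cmod (1 - x m l'))).
      { intros l'. apply Rlt_le, Rinv_0_lt_compat, Rmult_lt_0_compat; auto. now apply Cmod_gt_0. }
      pose proof (Cmod_ge_0 (x m l - x m (l + 1)%Z)%C).
      apply Rmult_le_compat; auto using Cmod_ge_0.
      { apply Rmult_le_pos; [apply Rmult_le_pos; lra|apply Rmult_le_pos; auto]. }
      apply Rmult_le_compat; auto; [apply Rmult_le_pos; lra|apply Rmult_le_pos; auto|].
      apply Rmult_le_compat; auto. }
    unfold zs. eapply Rle_trans; [apply Cmod_triangle|].
    pose proof (Hl _ (zidx_pos n)). pose proof (Hl _ (zidx_neg n)). lra.
  - apply ex_series_Rscal, wt_ex_series. lra.
  - intros n.
    assert (Hlim : forall l, Clim (fun m => ((/ RtoC (INR (q * M m))) * c m l)%C)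
                     (/ zpt (INR q * t) l)%C).
    { intros l.
      assert (Hz : zpt (INR q * t) l <> RtoC 0).
      { apply zpt_neq0. apply Rgt_not_eq, Rmult_lt_0_compat; lra. }
      (* With h = 1/M and w = t + 2 pi i l / q, the denominator N (1 - x) is q (1 - e^(-h w)) / h,
         which tends to q w = q t + 2 pi i l. *)
      eapply Clim_ext; [|apply (Clim_inv (fun m => (RtoC (INR q) * (RtoC (/ / INR (M m)) * (1 - Cexp (- (RtoC (/ INR (M m)) * (t, 2 * PI * IZR l / INR q)%R))%C)))%C)
        _ Hz)].
      2:{ replace (zpt (INR q * t) l) with (RtoC (INR q) * (t, 2 * PI * IZR l / INR q)%R)%C.
          2:{ unfold zpt, Cmult, RtoC; simpl. f_equal; field; lra. }
          apply Clim_scal. apply (Clim_exp_quotient _ (fun m => / INR (M m))).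
          - intros m. apply Rinv_neq_0_compat. specialize (HMR m). lra.
          - apply (is_lim_seq_inv _ p_infty); [|discriminate].
            apply (is_lim_seq_subseq INR p_infty M); [|apply is_lim_seq_INR].
            apply eventually_subseq. intros k; unfold M; lia. }
      intros m. cbv beta. unfold c.
      assert (Ex : Cexp (- (RtoC (/ INR (M m)) * (t, 2 * PI * IZR l / INR q)%R))%C = x m l).
      { unfold x, ez. rewrite <- Cexp_RtoC, <- Cexp_plus. f_equal.
        rewrite mult_INR, opp_IZR. specialize (HMR m).
        unfold Copp, Cmult, Cplus, RtoC; cbn [fst snd]. f_equal; field; lra. }
      rewrite Ex, Rinv_inv. specialize (Hx1 m l).
      assert (RtoC (INR q) <> RtoC 0) by (intros E; injection E; lra).
      assert (RtoC (INR (M m)) <> RtoC 0) by (apply RtoC_neq0; specialize (HMR m); lra).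
      rewrite mult_INR, RtoC_mult. field. auto. }
    assert (HlimT : forall l, Clim (fun m => T m l)
       (X l * ((/ zpt (INR q * t) l) - (/ zpt (INR q * t) (l + 1)%Z)))%C).
    { intros l. eapply Clim_ext; [|apply Clim_scal, Clim_minus; apply Hlim].
      intros m. unfold T. simpl. ring. }
    unfold Clim. apply is_lim_seq_ext_loc with
      (fun m => Cmod (zs (T m) n - zs (fun l => (X l * ((/ zpt (INR q * t) l) - (/ zpt (INR q * t) (l + 1)%Z)))%C) n)).
    + exists n. intros m Hm. unfold f. destruct (Nat.ltb_spec n (K m)); auto.
      exfalso. unfold K in *. nia.
    + apply (Clim_plus _ _ _ _ (HlimT (Z.of_nat n)) (HlimT (- Z.of_nat n - 1)%Z)).
  - intros m. rewrite (CS_unique _ _ _ (HT 0%nat) (HT m) : L = _).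
    rewrite (psum_ext _ (f m)).
    + apply CS_finite. intros i Hi. unfold f. destruct (Nat.ltb_spec i (K m)); auto. lia.
    + intros i Hi. unfold f. destruct (Nat.ltb_spec i (K m)); auto. lia.
  - rewrite (Clim_unique _ _ _ (Clim_const L) H2). exact H1.
Qed.

(** * Higher powers by differentiation in t *)

Definition Csum (f : nat -> C) : C := epsilon (inhabits (RtoC 0)) (CS f).

Lemma Csum_correct f l : CS f l -> CS f (Csum f).
Proof. intros H. unfold Csum. apply epsilon_spec. now exists l. Qed.

(** The witness (k/e)^k is the maximum of y^k e^(-y), attained at y = k. Every trade of exponential
    decay for a power goes through this bound. *)
Lemma exp_neg_le k : 0 < k -> exists C, 0 < C /\ forall y, 0 < y -> exp (- y) <= C * Rpower y (- k).
Proof.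
  intros Hk. exists (exp (k * ln k - k)). split; [apply exp_pos|]. intros y Hy.
  unfold Rpower. rewrite <- exp_plus.
  assert (H : ln (y / k) <= y / k - 1) by (apply ln_le_sub1; now apply Rdiv_lt_0_compat).
  unfold Rdiv in H at 1. rewrite ln_mult, ln_Rinv in H by (auto; now apply Rinv_0_lt_compat).
  assert (H2 : k * (ln y + - ln k) <= k * (y / k - 1)) by (apply Rmult_le_compat_l; lra).
  replace (k * (y / k - 1)) with (y - k) in H2 by (field; lra).
  destruct (Rle_lt_or_eq_dec (- y) (k * ln k - k + - k * ln y)) as [L|E]; [lra| |].
  - now apply Rlt_le, exp_increasing.
  - rewrite E. lra.
Qed.

Lemma exp_pow_wt k t : 0 < t -> exists C, 0 < C /\
  forall d : nat, INR d ^ k * exp (- (INR d * t)) <= C * wt 1 d.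
Proof.
  (* Of the exponent k + 2, k absorbs the power of d and 2 leaves the weight. The estimate is made
     at d + 1, so that d = 0 is harmless; the price is the factor e^t. *)
  intros Ht. destruct (exp_neg_le (INR k + 2) ltac:(pose proof (pos_INR k); lra)) as [C [C0 HC]].
  exists (C * exp t * Rpower t (- (INR k + 2))). split.
  { repeat apply Rmult_lt_0_compat; auto; apply exp_pos. }
  intros d. set (s := INR (S d)).
  assert (Hs : 0 < s) by (apply lt_0_INR; lia).
  apply Rle_trans with (s ^ k * (exp t * exp (- (s * t)))).
  - apply Rmult_le_compat.
    + apply pow_le, pos_INR.
    + apply Rlt_le, exp_pos.
    + apply pow_incr. split; [apply pos_INR|unfold s; rewrite S_INR; lra].
    + rewrite <- exp_plus. right. f_equal. unfold s. rewrite S_INR. ring.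
  - specialize (HC (s * t) ltac:(now apply Rmult_lt_0_compat)).
    rewrite <- Rpower_mult_distr in HC by auto.
    apply Rle_trans with (s ^ k * (exp t * (C * (Rpower s (- (INR k + 2)) * Rpower t (- (INR k + 2)))))).
    + apply Rmult_le_compat_l; [apply pow_le; lra|]. apply Rmult_le_compat_l; [apply Rlt_le, exp_pos|auto].
    + right. unfold wt. fold s.
      assert (E : s ^ k * Rpower s (- (INR k + 2)) = Rpower s (- (1 + 1))).
      { rewrite <- Rpower_pow by auto. rewrite <- Rpower_plus. f_equal. ring. }
      rewrite <- E. ring.
Qed.

Lemma Clim_invpow_quotient z a (h : nat -> R) j : z <> RtoC 0 ->
  (forall m, (z + RtoC (h m) * a)%C <> RtoC 0) -> (forall m, h m <> 0) -> is_lim_seq h 0 ->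
  Clim (fun m => (RtoC (/ h m) * ((/ (z + RtoC (h m) * a)) ^ j - (/ z) ^ j))%C)
    ((- (RtoC (INR j) * a)) * (/ z) ^ S j)%C.
Proof.
  intros Hz Hza Hh Hlim.
  assert (L0 : Clim (fun m => (/ (z + RtoC (h m) * a))%C) (/ z)%C).
  { apply Clim_inv; auto.
    replace z with (z + 0 * a)%C at 1 by ring.
    apply Clim_plus; [apply Clim_const|]. apply Clim_mult; [now apply RtoC_Clim|apply Clim_const]. }
  induction j.
  - simpl. replace (_ * _)%C with (RtoC 0) by ring.
    eapply Clim_ext; [|apply Clim_const]. intros m; simpl. ring.
  - replace ((- (RtoC (INR (S j)) * a)) * (/ z) ^ S (S j))%C with
      ((- (RtoC (INR j) * a)) * (/ z) ^ S j * (/ z) + (/ z) ^ j * ((- a) * ((/ z) * (/ z))))%C.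
    2:{ rewrite S_INR, RtoC_plus. cbn [Cpow]. ring. }
    eapply Clim_ext; [|apply Clim_plus; [apply Clim_mult; [exact IHj|exact L0]|
       apply Clim_scal, (Clim_scal (- a)%C); apply Clim_mult; [apply (Clim_const (/ z)%C)|exact L0]]].
    intros m. cbv beta. cbn [Cpow]. specialize (Hza m). specialize (Hh m).
    assert (HR : RtoC (h m) <> RtoC 0) by now apply RtoC_neq0.
    rewrite RtoC_inv by auto.
    generalize ((/ (z + RtoC (h m) * a)) ^ j)%C ((/ z) ^ j)%C.
    intros P Q. field. auto.
Qed.

Lemma is_lim_seq_inv_S : is_lim_seq (fun m => / INR (S m)) 0.
Proof.
  apply (is_lim_seq_inv _ p_infty); [|discriminate].
  apply (is_lim_seq_incr_1 INR). apply is_lim_seq_INR.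
Qed.

Lemma Cmod_zpt_ge u l : 0 < u -> Rmin u 1 / 2 * (1 + IZR (Z.abs l)) <= Cmod (zpt u l).
Proof.
  intros Hu. pose proof (Rmax_Cmod (zpt u l)) as H. simpl in H.
  pose proof (Rmax_l (Rabs u) (Rabs (2 * PI * IZR l))).
  pose proof (Rmax_r (Rabs u) (Rabs (2 * PI * IZR l))).
  pose proof PI2_1.
  rewrite Rabs_mult, (Rabs_pos_eq (2 * PI)), <- abs_IZR in * by (unfold PI2 in *; lra).
  rewrite (Rabs_pos_eq u) in * by lra.
  assert (0 <= IZR (Z.abs l)) by (apply IZR_le; lia).
  pose proof (Rmin_l u 1). pose proof (Rmin_r u 1).
  assert (Rmin u 1 * IZR (Z.abs l) <= 1 * IZR (Z.abs l)) by (apply Rmult_le_compat_r; lra).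
  unfold PI2 in *. nra.
Qed.

(** Differentiating 1/(q t + 2 pi i l)^(k+1) in t produces -(k+1) q, while e^(-d t) produces -d; the
    signs cancel and the factors accumulate to k! q^k. *)
Lemma lipschitz k q b beta t : (1 <= q)%nat -> periodic q b -> periodic q beta ->
  rs q beta = RtoC 0 ->
  dft q b beta -> 0 < t ->
  exists L,
  CS (fun d => (RtoC (INR d ^ k) * (b (Z.of_nat d) * RtoC (exp (- (INR d * t)))))%C)
     (RtoC (INR (fact k) * INR q ^ k) * L)%C /\
  ZS (fun l => (Xsum q beta l * ((/ zpt (INR q * t) l) ^ S k - (/ zpt (INR q * t) (l + 1)) ^ S k))%C) L.
Proof.
  intros Hq Hb Hbp Hb0 Hbeta. revert t. induction k as [|k IH]; intros t Ht.
  { destruct (lipschitz_0 q b beta t) as [L [H1 H2]]; auto. exists L. split.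
    - eapply CS_ext; [|replace (RtoC (INR (fact 0) * INR q ^ 0) * L)%C with L; [exact H1|]].
      + intros n. simpl. ring.
      + simpl. rewrite Rmult_1_r. ring.
    - eapply ZS_ext; [|exact H2]. intros l. simpl. ring. }
  set (X := Xsum q beta) in *.
  destruct (periodic_bounded q X Hq (Xsum_periodic q beta Hq)) as [B [B0 HB]].
  destruct (periodic_bounded q b Hq Hb) as [Bb [Bb0 HBb]].
  assert (Hqp : 1 <= INR q) by (apply (le_INR 1); lia).
  set (c := RtoC (INR (fact k) * INR q ^ k)) in *.
  assert (Hc : c <> RtoC 0).
  { apply RtoC_neq0, Rgt_not_eq, Rmult_lt_0_compat; [apply INR_fact_lt_0|apply pow_lt; lra]. }
  (* Difference quotients along this one sequence of steps suffice: [tannery] computes their limit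
     on the series side and on the partial fraction side. *)
  set (h := fun m => / INR (S m)).
  assert (Hh : forall m, 0 < h m) by (intros; apply Rinv_0_lt_compat, lt_0_INR; lia).
  set (A := fun s => (fun d => (RtoC (INR d ^ k) * (b (Z.of_nat d) * RtoC (exp (- (INR d * s)))))%C)).
  set (V := fun s l => (X l * ((/ zpt (INR q * s) l) ^ S k - (/ zpt (INR q * s) (l + 1)%Z) ^ S k))%C).
  (* The induction hypothesis gives a value separately for each s; [Csum] makes it a function of s,
     so that difference quotients can be written. *)
  assert (HA : forall s, 0 < s -> CS (A s) (Csum (A s)) /\ ZS (V s) ((/ c) * Csum (A s))%C).
  { intros s Hs. destruct (IH s Hs) as [L [H1 H2]].
    change (CS (A s) (c * L)%C) in H1.
    pose proof (Csum_correct _ _ H1) as H3. split; [exact H3|].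
    rewrite (CS_unique _ _ _ H3 H1).
    replace ((/ c) * (c * L))%C with L by (field; auto). exact H2. }
  set (D := fun m => (RtoC (/ h m) * (Csum (A (t + h m)%R) - Csum (A t)))%C).
  destruct (exp_pow_wt (S k) t Ht) as [C1 [C10 HC1]].
  destruct (tannery
    (fun m d => (RtoC (/ h m) * (A (t + h m)%R d - A t d))%C)
    (fun d => (- (RtoC (INR d ^ S k) * (b (Z.of_nat d) * RtoC (exp (- (INR d * t))))))%C)
    (fun d => Bb * C1 * wt 1 d) D) as [L1 [T1 T2]].
  - intros m d. unfold A. specialize (Hh m).
    replace (RtoC (/ h m) * _)%C with
      (b (Z.of_nat d) * RtoC (/ h m * (INR d ^ k * (exp (- (INR d * (t + h m))) - exp (- (INR d * t))))))%C.
    2:{ rewrite !RtoC_mult, RtoC_minus. ring. }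
    rewrite Cmod_mult, Cmod_R, Rmult_assoc.
    apply Rmult_le_compat; auto using Cmod_ge_0, Rabs_pos.
    eapply Rle_trans; [|apply HC1].
    pose proof (pos_INR d) as Hd.
    assert (E : exp (- (INR d * (t + h m))) = exp (- (INR d * t)) * exp (- (INR d * h m)))
      by (rewrite <- exp_plus; f_equal; ring).
    rewrite E. pose proof (exp_ineq1_le (- (INR d * h m))) as E1.
    assert (E2 : exp (- (INR d * h m)) <= 1).
    { destruct (Req_dec (INR d * h m) 0) as [->|N]; [rewrite Ropp_0, exp_0; lra|].
      rewrite <- exp_0. apply Rlt_le, exp_increasing. assert (0 <= INR d * h m) by nra. lra. }
    pose proof (exp_pos (- (INR d * t))) as E3.
    assert (Hk : 0 <= INR d ^ k) by (apply pow_le; auto).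
    replace (/ h m * (INR d ^ k * (exp (- (INR d * t)) * exp (- (INR d * h m)) - exp (- (INR d * t)))))
      with (- (/ h m * (INR d ^ k * exp (- (INR d * t)) * (1 - exp (- (INR d * h m)))))) by ring.
    assert (0 < / h m) by now apply Rinv_0_lt_compat.
    assert (0 <= INR d ^ k * exp (- (INR d * t))) by (apply Rmult_le_pos; lra).
    rewrite Rabs_Ropp, Rabs_pos_eq.
    2:{ apply Rmult_le_pos; [lra|]. apply Rmult_le_pos; lra. }
    apply Rle_trans with (/ h m * (INR d ^ k * exp (- (INR d * t)) * (INR d * h m))).
    + apply Rmult_le_compat_l; [lra|]. apply Rmult_le_compat_l; lra.
    + right. simpl. field. lra.
  - apply ex_series_Rscal, wt_ex_series. lra.
  - intros d. unfold A.
    replace (- _)%C with (RtoC (INR d ^ k) * b (Z.of_nat d) * RtoC (- INR d * exp (- (INR d * t))))%C.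
    2:{ cbn [pow]. rewrite !RtoC_mult, RtoC_opp. ring. }
    eapply Clim_ext; [|apply Clim_scal, RtoC_Clim,
      (derivable_seq_quotient (fun y => exp (- (INR d * (t + y)))) _ h)].
    + intros m. cbv beta. rewrite Rplus_0_r. unfold Rdiv. rewrite RtoC_mult, RtoC_minus. ring.
    + apply is_derive_Reals. auto_derive; auto. rewrite Rplus_0_r. ring.
    + intros m. apply Rgt_not_eq, Hh.
    + apply is_lim_seq_inv_S.
  - intros m. apply CS_scal, CS_minus; apply HA; auto. specialize (Hh m). lra.
  - destruct (DD_le k) as [K [K0 HK]].
    set (kap := Rmin t 1 / 2).
    assert (Hkap : 0 < kap) by (unfold kap; assert (0 < Rmin t 1) by (apply Rmin_glb_lt; lra); lra).
    assert (Hzk : forall s l, t <= s -> kap * (1 + IZR (Z.abs l)) <= Cmod (zpt (INR q * s) l)).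
    { intros s l Hs. eapply Rle_trans; [|apply Cmod_zpt_ge; nra].
      assert (0 <= IZR (Z.abs l)) by (apply IZR_le; lia).
      apply Rmult_le_compat_r; [lra|]. unfold kap.
      assert (Rmin t 1 <= Rmin (INR q * s) 1) by (apply Rle_min_compat_r; nra). lra. }
    assert (Hz0 : forall s l, t <= s -> zpt (INR q * s) l <> RtoC 0).
    { intros s l Hs. apply zpt_neq0. apply Rgt_not_eq. apply Rmult_lt_0_compat; lra. }
    destruct (tannery
      (fun m => zs (fun l => (RtoC (/ h m) * (V (t + h m)%R l - V t l))%C))
      (zs (fun l => ((- RtoC (INR (S k) * INR q)) * (X l * ((/ zpt (INR q * t) l) ^ S (S k) - (/ zpt (INR q * t) (l + 1)%Z) ^ S (S k))))%C))
      (fun n => 2 * (B * (K * INR q * (2 * PI) * (/ kap) ^ (k + 3)) * wt 1 n))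
      (fun m => ((/ c) * D m)%C)) as [L2 [T3 T4]].
    + intros m n.
      apply (zs_le _ (fun n => B * (K * INR q * (2 * PI) * (/ kap) ^ (k + 3)) * wt 1 n)). intros l.
      specialize (Hh m). unfold V.
      set (a := RtoC (INR q * h m)). set (be := (0, 2 * PI) : C).
      assert (Ez1 : forall l, zpt (INR q * (t + h m)) l = (zpt (INR q * t) l + a)%C).
      { intros l'. unfold zpt, Cplus, a, RtoC; simpl. f_equal; ring. }
      (* The difference quotient of a difference of neighbours is a mixed second difference with
         steps q h and 2 pi i. Its bound is linear in the step q h, which cancels the 1/h. *)
      replace (RtoC (/ h m) * _)%C with
        (X l * (RtoC (/ h m) * (- DD (zpt (INR q * t) l) a be (S k))))%C.
      2:{ unfold DD. rewrite !Ez1, zpt_succ. fold be.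
          replace (zpt (INR q * t) l + a + be)%C with (zpt (INR q * t) l + be + a)%C by ring.
          ring. }
      rewrite !Cmod_mult, Cmod_opp, Cmod_R, Rabs_pos_eq by (apply Rlt_le; now apply Rinv_0_lt_compat).
      rewrite Rmult_assoc. apply Rmult_le_compat; auto using Cmod_ge_0.
      { apply Rmult_le_pos; [apply Rlt_le; now apply Rinv_0_lt_compat|apply Cmod_ge_0]. }
      set (r := / (kap * INR (S (zidx l)))).
      assert (HSn : 1 <= INR (S (zidx l))) by (apply (le_INR 1); lia).
      destruct (zidx_le_IZR l) as [Z1 Z2].
      assert (Hr : forall s l', t <= s -> INR (S (zidx l)) <= 1 + IZR (Z.abs l') ->
                 Cmod (/ zpt (INR q * s) l') <= r).
      { intros s l' Hs Hl'. rewrite Cmod_inv by auto. apply Rinv_le_contravar.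
        - apply Rmult_lt_0_compat; lra.
        - eapply Rle_trans; [|apply Hzk; auto]. apply Rmult_le_compat_l; lra. }
      assert (HDD : Cmod (DD (zpt (INR q * t) l) a be (S k)) <= K * Cmod a * Cmod be * r ^ (k + 3)).
      { assert (E1 := Ez1 l). assert (E2 := Ez1 (l + 1)%Z). rewrite (zpt_succ (INR q * t) l) in E2. fold be in E2.
        assert (E3 := zpt_succ (INR q * t) l). fold be in E3.
        apply HK.
        - apply Hz0; lra.
        - rewrite <- E1; apply Hz0; lra.
        - rewrite <- E3; apply Hz0; lra.
        - replace (zpt (INR q * t) l + a + be)%C with (zpt (INR q * t) l + be + a)%C by ring.
          rewrite <- E2; apply Hz0; lra.
        - apply Hr; lra.
        - rewrite <- E1; apply Hr; lra.
        - rewrite <- E3; apply Hr; lra.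
        - replace (zpt (INR q * t) l + a + be)%C with (zpt (INR q * t) l + be + a)%C by ring.
          rewrite <- E2; apply Hr; lra. }
      assert (Ea : Cmod a = INR q * h m) by (unfold a; rewrite Cmod_R; apply Rabs_pos_eq; nra).
      assert (Eb : Cmod be = 2 * PI).
      { unfold be. replace ((0, 2 * PI) : C) with (Ci * RtoC (2 * PI))%C.
        - rewrite Cmod_mult, Cmod_Ci, Cmod_R, Rabs_pos_eq; [ring|pose proof PI_RGT_0; lra].
        - unfold Cmult, Ci, RtoC; simpl. f_equal; ring. }
      rewrite Ea, Eb in HDD.
      apply Rle_trans with (/ h m * (K * (INR q * h m) * (2 * PI) * r ^ (k + 3))).
      { apply Rmult_le_compat_l; auto. apply Rlt_le; now apply Rinv_0_lt_compat. }
      replace (/ h m * (K * (INR q * h m) * (2 * PI) * r ^ (k + 3))) with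
        (K * INR q * (2 * PI) * r ^ (k + 3)) by (field; lra).
      rewrite (Rmult_assoc (K * INR q * (2 * PI))).
      apply Rmult_le_compat_l.
      { pose proof PI_RGT_0. apply Rmult_le_pos; [apply Rmult_le_pos|]; lra. }
      unfold r. rewrite Rinv_mult, Rpow_mult_distr. apply Rmult_le_compat_l.
      { apply pow_le, Rlt_le. now apply Rinv_0_lt_compat. }
      rewrite wt1_eq. replace (k + 3)%nat with (k + 1 + 2)%nat by lia. now apply Rinv_pow_add_le.
    + apply ex_series_Rscal, ex_series_Rscal, wt_ex_series. lra.
    + intros n.
      assert (HL : forall l, Clim (fun m => (RtoC (/ h m) * (V (t + h m)%R l - V t l))%C)
         ((- RtoC (INR (S k) * INR q)) * (X l * ((/ zpt (INR q * t) l) ^ S (S k) - (/ zpt (INR q * t) (l + 1)%Z) ^ S (S k))))%C).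
      { intros l.
        assert (HQ : forall l, Clim (fun m => (RtoC (/ h m) * ((/ zpt (INR q * (t + h m)) l) ^ S k - (/ zpt (INR q * t) l) ^ S k))%C)
            ((- (RtoC (INR (S k)) * RtoC (INR q))) * (/ zpt (INR q * t) l) ^ S (S k))%C).
        { intros l'.
          assert (Ez1 : forall m, zpt (INR q * (t + h m)) l' = (zpt (INR q * t) l' + RtoC (h m) * RtoC (INR q))%C).
          { intros m. unfold zpt, Cplus, Cmult, RtoC; simpl. f_equal; ring. }
          eapply Clim_ext; [|apply (Clim_invpow_quotient (zpt (INR q * t) l') (RtoC (INR q)) h (S k))].
          - intros m. cbv beta. now rewrite Ez1.
          - apply Hz0; lra.
          - intros m. rewrite <- Ez1. apply Hz0. specialize (Hh m). lra.
          - intros m. apply Rgt_not_eq, Hh.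
          - apply is_lim_seq_inv_S. }
        eapply Clim_ext; [|replace ((- RtoC (INR (S k) * INR q)) * _)%C with
          (X l * ((- (RtoC (INR (S k)) * RtoC (INR q))) * (/ zpt (INR q * t) l) ^ S (S k) - (- (RtoC (INR (S k)) * RtoC (INR q))) * (/ zpt (INR q * t) (l + 1)%Z) ^ S (S k)))%C;
          [apply Clim_scal, Clim_minus; apply HQ|]].
        - intros m. unfold V. ring.
        - rewrite RtoC_mult. ring. }
      apply Clim_plus; apply HL.
    + intros m. unfold D.
      replace ((/ c) * _)%C with (RtoC (/ h m) * ((/ c) * Csum (A (t + h m)%R) - (/ c) * Csum (A t)))%C by ring.
      apply ZS_scal, ZS_minus; apply HA; auto. specialize (Hh m). lra.
    (* Both limits are taken of the same quotients [D m], up to the factor 1/c. *)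
    + assert (EL : L2 = ((/ c) * L1)%C) by (apply (Clim_unique _ _ _ T4), Clim_scal, T2).
      set (g := RtoC (INR (S k) * INR q)).
      assert (Hg : g <> RtoC 0).
      { apply RtoC_neq0, Rgt_not_eq, Rmult_lt_0_compat; [apply lt_0_INR; lia|lra]. }
      exists ((/ (- g)) * L2)%C. split.
      * replace (RtoC (INR (fact (S k)) * INR q ^ S k) * ((/ (- g)) * L2))%C
          with (RtoC (-1) * L1)%C.
        2:{ rewrite EL. replace (RtoC (INR (fact (S k)) * INR q ^ S k)) with (g * c)%C.
            - field; auto.
            - unfold g, c. rewrite <- RtoC_mult. f_equal.
              change (fact (S k)) with (S k * fact k)%nat. rewrite mult_INR. simpl pow. ring. }
        eapply CS_ext; [|apply (CS_scal (RtoC (-1)) _ _ T1)]. intros d. cbv beta. ring.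
      * eapply ZS_ext; [|apply (ZS_scal (/ (- g))%C _ _ T3)]. intros l. cbv beta. fold g.
        field; auto.
Qed.

(** * Eisenstein double sums *)

Definition lat (al be : C) (m l : Z) : C :=
  (RtoC (IZR m) * al + RtoC (IZR l) * be)%C.

(* The value at m = l = 0 is junk ([/ 0]); it cancels because the coefficients vanish there. *)
Definition latH (al be : C) (k : nat) (m l : Z) : C := ((/ lat al be m l) ^ S k)%C.

Lemma lat_swap al be m l : lat al be m l = lat be al l m.
Proof. unfold lat. ring. Qed.

Lemma lat_succ_l al be m l : lat al be (m + 1) l = (lat al be m l + al)%C.
Proof. unfold lat. rewrite plus_IZR, RtoC_plus. ring. Qed.

Lemma lat_succ_r al be m l : lat al be m (l + 1) = (lat al be m l + be)%C.
Proof. unfold lat. rewrite plus_IZR, RtoC_plus. ring. Qed.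

Lemma latH_swap al be k m l : latH al be k m l = latH be al k l m.
Proof. unfold latH. now rewrite lat_swap. Qed.

(** Quantitative independence of the two periods over Z. It keeps nonzero lattice points away from 0
    and makes their size comparable to |m| + |l|. *)
Definition separated (kap : R) (al be : C) : Prop :=
  0 < kap /\ forall m l, kap * (IZR (Z.abs m) + IZR (Z.abs l)) <= Cmod (lat al be m l).

Lemma separated_swap kap al be : separated kap al be -> separated kap be al.
Proof.
  intros [H0 H]. split; auto. intros m l. rewrite lat_swap, Rplus_comm. apply H.
Qed.

Lemma lat_inv_le kap al be m l s : separated kap al be -> 0 < s ->
  s <= IZR (Z.abs m) + IZR (Z.abs l) ->
  lat al be m l <> RtoC 0 /\ Cmod (/ lat al be m l) <= / (kap * s).
Proof.
  intros [K0 HK] Hs H.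
  assert (P : kap * s <= Cmod (lat al be m l))
    by (eapply Rle_trans; [|apply HK]; apply Rmult_le_compat_l; lra).
  assert (Q : 0 < kap * s) by now apply Rmult_lt_0_compat.
  assert (Z : lat al be m l <> RtoC 0) by (apply Cmod_gt_0; lra).
  split; auto. rewrite Cmod_inv by auto. now apply Rinv_le_contravar.
Qed.

Lemma IZR_abs_ge1 m : m <> 0%Z -> 1 <= IZR (Z.abs m).
Proof. intros H. apply IZR_le. lia. Qed.

Lemma IZR_abs_ge0 m : 0 <= IZR (Z.abs m).
Proof. apply IZR_le. lia. Qed.

Lemma latH_bounded kap al be k : separated kap al be ->
  exists B, 0 < B /\ forall m l, Cmod (latH al be k m l) <= B.
Proof.
  intros Hs. pose proof Hs as [K0 _].
  assert (P : 0 <= (/ (kap * 1)) ^ S k).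
  { apply pow_le, Rlt_le, Rinv_0_lt_compat. lra. }
  exists ((/ (kap * 1)) ^ S k + Cmod (latH al be k 0 0) + 1). split.
  { pose proof (Cmod_ge_0 (latH al be k 0 0)). lra. }
  intros m l. pose proof (Cmod_ge_0 (latH al be k 0 0)).
  destruct (Z.eq_dec m 0) as [Em|Em]; [destruct (Z.eq_dec l 0) as [El|El]|].
  - subst. lra.
  - destruct (lat_inv_le kap al be m l 1 Hs) as [_ H1]; [lra| |].
    { pose proof (IZR_abs_ge1 l El). pose proof (IZR_abs_ge0 m). lra. }
    unfold latH at 1. rewrite Cmod_pow.
    assert (Cmod (/ lat al be m l) ^ S k <= (/ (kap * 1)) ^ S k)
      by (apply pow_incr; split; [apply Cmod_ge_0|auto]). lra.
  - destruct (lat_inv_le kap al be m l 1 Hs) as [_ H1]; [lra| |].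
    { pose proof (IZR_abs_ge1 m Em). pose proof (IZR_abs_ge0 l). lra. }
    unfold latH at 1. rewrite Cmod_pow.
    assert (Cmod (/ lat al be m l) ^ S k <= (/ (kap * 1)) ^ S k)
      by (apply pow_incr; split; [apply Cmod_ge_0|auto]). lra.
Qed.

Lemma zidx_INR l : INR (zidx l) <= IZR (Z.abs l) /\ INR (zidx l) <= IZR (Z.abs (l + 1)).
Proof.
  pose proof (zidx_abs l) as [A B]. rewrite INR_IZR_INZ. apply IZR_le in A, B. lra.
Qed.

Lemma latH_row_diff kap al be k : separated kap al be ->
  exists C, 0 < C /\ forall m l,
    Cmod (latH al be k m l - latH al be k m (l + 1)) <= C * wt 1 (zidx l).
Proof.
  intros Hs. pose proof Hs as [K0 _].
  destruct (latH_bounded kap al be k Hs) as [B [B0 HB]].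
  set (r0 := 2 / kap).
  assert (R0 : 0 < r0) by (apply Rdiv_lt_0_compat; lra).
  set (C := 2 * B + INR (S k) * Cmod be * r0 ^ (k + 2)).
  assert (P0 : 0 <= INR (S k) * Cmod be * r0 ^ (k + 2)).
  { apply Rmult_le_pos; [apply Rmult_le_pos; [apply pos_INR|apply Cmod_ge_0]|]. apply pow_le; lra. }
  exists C. split; [unfold C; lra|]. intros m l.
  (* Index 0 means l = 0 or l = -1, the cases in which the pair l, l+1 can meet the origin; the
     uniform bound is used there. *)
  destruct (Nat.eq_dec (zidx l) 0) as [E|E].
  - rewrite E. replace (wt 1 0) with 1.
    2:{ rewrite wt1_eq. simpl. field. }
    eapply Rle_trans; [apply Cmod_minus_le|].
    pose proof (HB m l). pose proof (HB m (l + 1)%Z). unfold C. lra.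
  - set (n := zidx l) in *.
    assert (Hn : 1 <= INR n) by (apply (le_INR 1); lia).
    destruct (zidx_INR l) as [Z1 Z2]. fold n in Z1, Z2.
    (* For n >= 1 one has (n+1)/2 <= n, so the decay can be stated in the n + 1 of the weight; this
       is the 2 in [r0]. *)
    set (s := INR (S n) / 2).
    assert (Hsn : 0 < s /\ s <= INR n) by (unfold s; rewrite S_INR; lra).
    pose proof (IZR_abs_ge0 m) as M0.
    destruct (lat_inv_le kap al be m l s Hs) as [N1 I1]; [lra|lra|].
    destruct (lat_inv_le kap al be m (l + 1) s Hs) as [N2 I2]; [lra|lra|].
    unfold latH. rewrite lat_succ_r in *.
    eapply Rle_trans; [apply (Cinv_pow_diff_le _ be (/ (kap * s)) k N1 N2 I1 I2)|].
    assert (HS : 1 <= INR (S n)) by (rewrite S_INR; lra).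
    replace (/ (kap * s)) with (r0 * / INR (S n)) by (unfold r0, s; field; lra).
    rewrite Rpow_mult_distr, wt1_eq, <- Rmult_assoc.
    apply Rmult_le_compat; auto; [apply pow_le, Rlt_le, Rinv_0_lt_compat; lra|unfold C; lra|].
    now apply Rinv_pow_add_le.
Qed.

Lemma wt_half_mult a b : wt (1 / 2) a * wt (1 / 2) b =
  Rpower (INR (S a) * INR (S b)) (- (3 / 2)).
Proof.
  unfold wt. replace (- (1 + 1 / 2)) with (- (3 / 2)) by field.
  rewrite Rpower_mult_distr; auto; apply lt_0_INR; lia.
Qed.

(** The inequality (x+y)^2 >= x y, raised to the power 3/2, splits cubic decay into a product of two
    summable weights, the form of majorant needed in [ZS_swap]. *)
Lemma inv_cube_le_wt a b : / (INR (S a) + INR (S b)) ^ 3 <= wt (1 / 2) a * wt (1 / 2) b.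
Proof.
  rewrite wt_half_mult.
  assert (A : 0 < INR (S a)) by (apply lt_0_INR; lia).
  assert (B : 0 < INR (S b)) by (apply lt_0_INR; lia).
  set (x := INR (S a)) in *. set (y := INR (S b)) in *.
  rewrite Rpower_Ropp. apply Rinv_le_contravar; [apply exp_pos|].
  replace ((x + y) ^ 3) with (Rpower ((x + y) * (x + y)) (3 / 2)).
  - apply Rle_Rpower_l; [lra|]. split; nra.
  - rewrite <- Rpower_mult_distr, <- Rpower_plus by lra.
    replace (3 / 2 + 3 / 2) with (INR 3) by (simpl; field). apply Rpower_pow. lra.
Qed.

Lemma latH_mixed_diff kap al be k : separated kap al be ->
  exists C, 0 < C /\ forall m l,
    Cmod (latH al be k m l - latH al be k (m + 1) l - latH al be k m (l + 1) + latH al be k (m + 1) (l + 1)) <= C * (wt (1 / 2) (zidx m) * wt (1 / 2) (zidx l)).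
Proof.
  intros Hs. pose proof Hs as [K0 _].
  destruct (latH_bounded kap al be k Hs) as [B [B0 HB]].
  destruct (DD_le k) as [K [Kp HK]].
  set (r0 := 3 / kap).
  assert (R0 : 0 < r0) by (apply Rdiv_lt_0_compat; lra).
  set (P := K * Cmod al * Cmod be * r0 ^ (k + 3)).
  assert (P0 : 0 <= P).
  { unfold P. apply Rmult_le_pos; [|apply pow_le; lra].
    apply Rmult_le_pos; [apply Rmult_le_pos|]; auto using Cmod_ge_0. }
  exists (4 * B + P). split; [lra|]. intros m l.
  set (a := zidx m) in *. set (b := zidx l) in *.
  (* Here m and l are both 0 or -1, exactly when a corner of the unit square at (m, l) is the
     origin; each of the four corners is bounded by [B]. *)
  destruct (Nat.eq_dec (a + b) 0) as [E|E].
  - assert (Ea : a = 0%nat) by lia. assert (Eb : b = 0%nat) by lia. rewrite Ea, Eb.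
    replace (wt (1 / 2) 0) with 1.
    2:{ unfold wt. simpl INR. unfold Rpower. rewrite ln_1, Rmult_0_r, exp_0. reflexivity. }
    eapply Rle_trans; [apply Cmod_triangle|].
    eapply Rle_trans; [apply Rplus_le_compat_r, Cmod_minus_le|].
    eapply Rle_trans; [apply Rplus_le_compat_r, Rplus_le_compat_r, Cmod_minus_le|].
    pose proof (HB m l). pose proof (HB m (l + 1)%Z). pose proof (HB (m + 1)%Z l).
    pose proof (HB (m + 1)%Z (l + 1)%Z). lra.
  - destruct (zidx_INR l) as [Z1 Z2]. destruct (zidx_INR m) as [Y1 Y2]. fold a in Y1, Y2. fold b in Z1, Z2.
    assert (Hab : 1 <= INR a + INR b) by (rewrite <- plus_INR; apply (le_INR 1); lia).
    (* Since a + b >= 1, (a + b + 2)/3 <= a + b; hence the 3 in [r0]. *)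
    set (s := (INR (S a) + INR (S b)) / 3).
    assert (Hsn : 0 < s /\ s <= INR a + INR b)
      by (unfold s; rewrite !S_INR; pose proof (pos_INR a); pose proof (pos_INR b); lra).
    destruct (lat_inv_le kap al be m l s Hs) as [N1 I1]; [lra|lra|].
    destruct (lat_inv_le kap al be (m + 1) l s Hs) as [N2 I2]; [lra|lra|].
    destruct (lat_inv_le kap al be m (l + 1) s Hs) as [N3 I3]; [lra|lra|].
    destruct (lat_inv_le kap al be (m + 1) (l + 1) s Hs) as [N4 I4]; [lra|lra|].
    unfold latH. rewrite !lat_succ_r, !lat_succ_l in *.
    specialize (HK (lat al be m l) al be (/ (kap * s)) N1 N2 N3 N4 I1 I2 I3 I4).
    unfold DD in HK. eapply Rle_trans; [exact HK|].
    set (S2 := INR (S a) + INR (S b)) in *.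
    assert (HS : 1 <= S2) by (unfold s in Hsn; unfold S2; rewrite !S_INR; pose proof (pos_INR a); pose proof (pos_INR b); lra).
    replace (/ (kap * s)) with (r0 * / S2) by (unfold r0, s; field; lra).
    rewrite Rpow_mult_distr, <- Rmult_assoc. fold P.
    pose proof (inv_cube_le_wt a b) as J6. fold S2 in J6. rewrite <- pow_inv in J6.
    pose proof (Rinv_pow_add_le S2 3 k HS).
    apply Rmult_le_compat; auto; try lra. apply pow_le, Rlt_le, Rinv_0_lt_compat; lra.
Qed.

Lemma latH_lim0 kap al be k l : separated kap al be ->
  Clim (fun n => latH al be k (Z.of_nat n) l) (RtoC 0) /\
  Clim (fun n => latH al be k (- Z.of_nat n) l) (RtoC 0).
Proof.
  intros Hs. pose proof Hs as [K0 _].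
  assert (G : forall (f : nat -> Z), (forall n, Z.abs (f n) = Z.of_nat n) ->
     Clim (fun n => latH al be k (f n) l) (RtoC 0)).
  { intros f Hf. apply Clim_S.
    apply lim0_squeeze with (fun n => (/ kap) ^ S k * / INR (S n)).
    - intros n. split; [apply Cmod_ge_0|].
      replace (_ - _)%C with (latH al be k (f (S n)) l) by ring.
      assert (Hn : 1 <= INR (S n)) by (apply (le_INR 1); lia).
      destruct (lat_inv_le kap al be (f (S n)) l (INR (S n)) Hs) as [_ I]; [lra| |].
      { rewrite Hf, <- INR_IZR_INZ. pose proof (IZR_abs_ge0 l). lra. }
      unfold latH. rewrite Cmod_pow.
      eapply Rle_trans; [apply pow_incr; split; [apply Cmod_ge_0|exact I]|].
      rewrite Rinv_mult, Rpow_mult_distr. apply Rmult_le_compat_l.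
      + apply pow_le, Rlt_le. now apply Rinv_0_lt_compat.
      + rewrite <- (pow_1 (/ INR (S n))) at 2. replace (S k) with (k + 1)%nat by lia.
        now apply Rinv_pow_add_le.
    - replace (Finite 0) with (Finite ((/ kap) ^ S k * 0)) by (f_equal; ring).
      apply is_lim_seq_mult'; [apply is_lim_seq_const|apply is_lim_seq_inv_S]. }
  split; apply G; intros; lia.
Qed.

(** The majorant [wt 1] does not depend on the row, while each entry tends to 0 as m grows, so the
    row sums do too. That decay kills the boundary terms of the second summation by parts. *)
Lemma lattice_rows kap al be k (X : Z -> C) B : separated kap al be ->
  (forall l, Cmod (X l) <= B) ->
  exists A : Z -> C,
    (forall m, ZS (fun l => (X l * (latH al be k m l - latH al be k m (l + 1)%Z))%C) (A m)) /\
    Clim (fun n => A (Z.of_nat n)) (RtoC 0) /\ Clim (fun n => A (- Z.of_nat n)%Z) (RtoC 0).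
Proof.
  intros Hs HB.
  assert (B0 : 0 <= B) by (eapply Rle_trans; [apply Cmod_ge_0|apply (HB 0%Z)]).
  destruct (latH_row_diff kap al be k Hs) as [C [C0 HC]].
  set (f := fun m l => (X l * (latH al be k m l - latH al be k m (l + 1)%Z))%C).
  assert (Hf : forall m l, Cmod (f m l) <= B * C * wt 1 (zidx l)).
  { intros m l. unfold f. rewrite Cmod_mult, Rmult_assoc. apply Rmult_le_compat; auto using Cmod_ge_0. }
  assert (He : ex_series (fun n => B * C * wt 1 n)) by (apply ex_series_Rscal, wt_ex_series; lra).
  exists (fun m => Csum (zs (f m))).
  assert (HA : forall m, ZS (f m) (Csum (zs (f m)))).
  { intros m. destruct (ZS_dom (f m) (fun n => B * C * wt 1 n)) as [s [H1 _]]; auto.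
    apply (Csum_correct _ _ H1). }
  split; [exact HA|].
  assert (G : forall g : nat -> Z, (forall l, Clim (fun n => latH al be k (g n) l) (RtoC 0)) ->
     Clim (fun n => Csum (zs (f (g n)))) (RtoC 0)).
  { intros g Hg.
    destruct (tannery (fun n => zs (f (g n))) (fun _ => RtoC 0) (fun n => 2 * (B * C * wt 1 n))
       (fun n => Csum (zs (f (g n))))) as [L [H1 H2]].
    - intros m n. apply (zs_le (f (g m)) (fun n => B * C * wt 1 n)). auto.
    - now apply ex_series_Rscal.
    - intros n.
      assert (Hl : forall l, Clim (fun m => f (g m) l) (RtoC 0)).
      { intros l. replace (RtoC 0) with (X l * (0 - 0))%C by ring.
        apply Clim_scal, Clim_minus; apply Hg. }
      replace (RtoC 0) with (0 + 0)%C by ring. apply Clim_plus; apply Hl.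
    - intros m. apply HA.
    - assert (E : L = RtoC 0).
      { apply (CS_unique _ _ _ H1). apply (CS_finite (fun _ => RtoC 0) 0). auto. }
      rewrite <- E. exact H2. }
  split; apply G; intros l; apply (latH_lim0 kap al be k l Hs).
Qed.

(* For k = 0 the double sum converges only conditionally; summation by parts in both variables
   makes it absolutely convergent, which is what allows the exchange. *)
Lemma lattice_swap kap al be k (bx X by_ Y : Z -> C) BX BY : separated kap al be ->
  (forall l, Cmod (X l) <= BX) -> (forall l, Cmod (Y l) <= BY) ->
  (forall l, (X l - X (l - 1)%Z)%C = bx l) ->
  (forall l, (Y l - Y (l - 1)%Z)%C = by_ l) ->
  exists (A D : Z -> C) (s : C),
    (forall m, ZS (fun l => (X l * (latH al be k m l - latH al be k m (l + 1)%Z))%C) (A m)) /\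
    (forall l, ZS (fun m => (Y m * (latH al be k m l - latH al be k (m + 1)%Z l))%C) (D l)) /\
    Clim (fun n => A (Z.of_nat n)) (RtoC 0) /\ Clim (fun n => D (Z.of_nat n)) (RtoC 0) /\
    ZS (fun m => (by_ m * A m)%C) s /\ ZS (fun l => (bx l * D l)%C) s.
Proof.
  intros Hs HX HY HbX HbY.
  assert (BX0 : 0 <= BX) by (eapply Rle_trans; [apply Cmod_ge_0|apply (HX 0%Z)]).
  assert (BY0 : 0 <= BY) by (eapply Rle_trans; [apply Cmod_ge_0|apply (HY 0%Z)]).
  destruct (lattice_rows kap al be k X BX Hs HX) as [A [HA [A1 A2]]].
  destruct (lattice_rows kap be al k Y BY (separated_swap _ _ _ Hs) HY) as [D [HD [D1 D2]]].
  assert (HD' : forall l, ZS (fun m => (Y m * (latH al be k m l - latH al be k (m + 1)%Z l))%C) (D l)).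
  { intros l. eapply ZS_ext; [|apply (HD l)]. intros m. cbv beta.
    now rewrite !(latH_swap be al). }
  destruct (latH_mixed_diff kap al be k Hs) as [C [C0 HC]].
  set (f := fun m l => (Y m * X l * (latH al be k m l - latH al be k (m + 1)%Z l - latH al be k m (l + 1)%Z + latH al be k (m + 1)%Z (l + 1)%Z))%C).
  (* With E >= 1 the constant is at most E^2, so one factor E can be given to each variable of the
     product majorant. *)
  set (E := BY * BX * C + 1).
  assert (E1 : 1 <= E).
  { unfold E. assert (0 <= BY * BX * C) by (repeat apply Rmult_le_pos; lra). lra. }
  set (v := fun n => E * wt (1 / 2) n).
  assert (Hv : forall n, 0 <= v n) by (intros n; unfold v; pose proof (wt_pos (1 / 2) n); nra).
  assert (Hf : forall m l, Cmod (f m l) <= v (zidx m) * v (zidx l)).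
  { intros m l. unfold f. rewrite !Cmod_mult. specialize (HC m l).
    pose proof (wt_pos (1 / 2) (zidx m)). pose proof (wt_pos (1 / 2) (zidx l)).
    apply Rle_trans with (BY * BX * (C * (wt (1 / 2) (zidx m) * wt (1 / 2) (zidx l)))).
    - apply Rmult_le_compat; auto using Cmod_ge_0.
      + apply Rmult_le_pos; apply Cmod_ge_0.
      + apply Rmult_le_compat; auto using Cmod_ge_0.
    - unfold v.
      replace (E * wt (1 / 2) (zidx m) * (E * wt (1 / 2) (zidx l))) with
        (E * E * (wt (1 / 2) (zidx m) * wt (1 / 2) (zidx l))) by ring.
      rewrite <- Rmult_assoc. apply Rmult_le_compat_r; [nra|].
      assert (E <= E * E) by nra. unfold E in *. lra. }
  assert (He : ex_series v) by (apply ex_series_Rscal, wt_ex_series; lra).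
  assert (Hr : forall m, ZS (f m) (Y m * (A m - A (m + 1)%Z))%C).
  { intros m. eapply ZS_ext; [|apply (ZS_scal (Y m)), ZS_minus; [apply (HA m)|apply (HA (m + 1)%Z)]].
    intros l. unfold f. ring. }
  assert (Hc : forall l, ZS (fun m => f m l) (X l * (D l - D (l + 1)%Z))%C).
  { intros l. eapply ZS_ext; [|apply (ZS_scal (X l)), ZS_minus; [apply (HD' l)|apply (HD' (l + 1)%Z)]].
    intros m. unfold f. ring. }
  assert (Hex : exists s, ZS (fun m => (Y m * (A m - A (m + 1)%Z))%C) s).
  { destruct (ZS_dom (fun m => (Y m * (A m - A (m + 1)%Z))%C)
      (fun n => 2 * Series v * v n)) as [s [H _]].
    - intros m. destruct (ZS_dom (f m) (fun n => v (zidx m) * v n)) as [s' [H1 H2]].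
      + auto.
      + now apply ex_series_Rscal.
      + rewrite (CS_unique _ _ _ (Hr m) H1). rewrite Series_scal_l in H2. lra.
    - now apply ex_series_Rscal.
    - now exists s. }
  destruct Hex as [s Hss].
  exists A, D, s. repeat split; auto.
  - apply (ZS_abel by_ Y A BY s HbY HY A1 A2 Hss).
  - apply (ZS_abel bx X D BX s HbX HX D1 D2).
    apply (ZS_swap f v _ _ s Hv He Hf Hr Hc Hss).
Qed.

(** * Parity and the transformation formula *)

Lemma Cinv_opp z : (/ (- z))%C = (- (/ z))%C.
Proof.
  unfold Cinv, Copp; simpl.
  replace (- fst z * (- fst z * 1) + - snd z * (- snd z * 1)) with
    (fst z * (fst z * 1) + snd z * (snd z * 1)) by ring.
  unfold Rdiv. f_equal; ring.
Qed.

Lemma Cpow_opp_odd z k : Nat.Even k -> ((- z) ^ S k)%C = (- z ^ S k)%C.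
Proof.
  intros [j ->]. induction j.
  - simpl. ring.
  - replace (2 * S j)%nat with (S (S (2 * j))) by lia.
    change ((- z) ^ S (S (S (2 * j))))%C with
      ((- z) * ((- z) * (- z) ^ S (2 * j)))%C.
    rewrite IHj.
    change (z ^ S (S (S (2 * j))))%C with (z * (z * z ^ S (2 * j)))%C. ring.
Qed.

Lemma latH_opp al be k m l : Nat.Even k -> latH al be k (- m) l = (- latH al be k m (- l))%C.
Proof.
  (* [Cinv_opp] holds at 0 as well, so the origin needs no exception. *)
  intros Hk. unfold latH. rewrite <- Cpow_opp_odd, <- Cinv_opp by auto. do 2 f_equal.
  unfold lat. rewrite !opp_IZR, !RtoC_opp. ring.
Qed.

(** An antidifference has the opposite parity, and a backward difference moves the centre of
    symmetry to -1/2. The vanishing of [X] and [bx] at 0 gives X(-1) = 0, which fixes the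
    constant. *)
Lemma primitive_parity (X bx : Z -> C) eps : (eps * eps)%C = RtoC 1 ->
  (forall l, (X l - X (l - 1)%Z)%C = bx l) -> X 0%Z = RtoC 0 -> bx 0%Z = RtoC 0 ->
  (forall l, bx (- l)%Z = (eps * bx l)%C) ->
  forall l, X (- l - 1)%Z = ((- eps) * X l)%C.
Proof.
  intros He H X0 B0 Hp.
  assert (P : forall n : nat, X (- Z.of_nat n - 1)%Z = ((- eps) * X (Z.of_nat n))%C).
  { induction n.
    - simpl. pose proof (H 0%Z) as H0. rewrite B0, X0 in H0. simpl in H0. rewrite X0.
      replace (X (-1)%Z) with (- (0 - X (-1)%Z))%C by ring. rewrite H0. ring.
    - replace (Z.of_nat (S n)) with (Z.of_nat n + 1)%Z by lia.
      pose proof (H (Z.of_nat n + 1)%Z) as H1. pose proof (H (- (Z.of_nat n + 1))%Z) as H2.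
      rewrite Hp, <- H1 in H2.
      replace (Z.of_nat n + 1 - 1)%Z with (Z.of_nat n) in * by lia.
      replace (- (Z.of_nat n + 1))%Z with (- Z.of_nat n - 1)%Z in * by lia.
      rewrite IHn in H2.
      replace (X (- Z.of_nat n - 1 - 1)%Z) with
        ((- eps) * X (Z.of_nat n) - ((- eps) * X (Z.of_nat n) - X (- Z.of_nat n - 1 - 1)%Z))%C by ring.
      rewrite H2. ring. }
  intros l. destruct (Z_le_gt_dec 0 l).
  - rewrite <- (Z2Nat.id l) by lia. apply P.
  - pose proof (P (Z.to_nat (- l - 1))) as Q. rewrite Z2Nat.id in Q by lia.
    replace (- (- l - 1) - 1)%Z with l in Q by lia. rewrite Q.
    replace ((- eps) * ((- eps) * X (- l - 1)%Z))%C with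
      (eps * eps * X (- l - 1)%Z)%C by ring. rewrite He. ring.
Qed.

(** Negating m has the same effect as negating l up to the sign of the odd power k + 1; the
    reflection of Z then transfers the parity of [X] to the row sums. *)
Lemma row_parity al be k (X : Z -> C) eps A : Nat.Even k -> (eps * eps)%C = RtoC 1 ->
  (forall l, X (- l - 1)%Z = ((- eps) * X l)%C) ->
  (forall m, ZS (fun l => (X l * (latH al be k m l - latH al be k m (l + 1)%Z))%C) (A m)) ->
  forall m, A (- m)%Z = ((- eps) * A m)%C.
Proof.
  intros Hk He HX HA m. apply (CS_unique _ _ _ (HA (- m)%Z)).
  pose proof (ZS_refl _ _ (ZS_scal (- eps)%C _ _ (HA m))) as H.
  eapply ZS_ext; [|exact H]. intros l. cbv beta.
  rewrite !latH_opp, HX by auto.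
  replace (- (l + 1))%Z with (- l - 1)%Z by lia.
  replace (- l - 1 + 1)%Z with (- l)%Z by lia.
  set (x := latH al be k m (- l - 1)). set (y := latH al be k m (- l)).
  transitivity (eps * eps * (X l * (x - y)))%C; [ring|].
  rewrite He. ring.
Qed.

Lemma lat_zpt v m l : lat (RtoC v) (0, 2 * PI) m l = zpt (v * IZR m) l.
Proof. unfold lat, zpt, Cplus, Cmult, RtoC; simpl. f_equal; ring. Qed.

Lemma separated_zpt v : 0 < v -> separated (Rmin v 1 / 2) (RtoC v) (0, 2 * PI).
Proof.
  intros Hv. assert (0 < Rmin v 1) by (apply Rmin_glb_lt; lra). split; [lra|].
  intros m l. rewrite lat_zpt.
  pose proof (Rmax_Cmod (zpt (v * IZR m) l)) as H1. simpl in H1.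
  pose proof (Rmax_l (Rabs (v * IZR m)) (Rabs (2 * PI * IZR l))) as H2.
  pose proof (Rmax_r (Rabs (v * IZR m)) (Rabs (2 * PI * IZR l))) as H3.
  pose proof PI2_1. unfold PI2 in *.
  assert (E1 : Rabs (v * IZR m) = v * IZR (Z.abs m))
    by (rewrite Rabs_mult, (Rabs_pos_eq v), <- abs_IZR; lra).
  assert (E2 : Rabs (2 * PI * IZR l) = 2 * PI * IZR (Z.abs l))
    by (rewrite Rabs_mult, (Rabs_pos_eq (2 * PI)), <- abs_IZR; lra).
  rewrite E1, E2 in *.
  pose proof (IZR_abs_ge0 m). pose proof (IZR_abs_ge0 l).
  pose proof (Rmin_l v 1). pose proof (Rmin_r v 1).
  assert (Rmin v 1 * IZR (Z.abs l) <= 1 * IZR (Z.abs l)) by (apply Rmult_le_compat_r; lra).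
  assert (Rmin v 1 * IZR (Z.abs m) <= v * IZR (Z.abs m)) by (apply Rmult_le_compat_r; lra).
  nra.
Qed.

Lemma Xsum_0 q beta : (1 <= q)%nat -> beta 0%Z = RtoC 0 -> Xsum q beta 0 = RtoC 0.
Proof. intros Hq H. unfold Xsum. rewrite Z.mod_0_l by lia. simpl. rewrite H. ring. Qed.

Lemma Cinv_neq0 a : a <> RtoC 0 -> (/ a)%C <> RtoC 0.
Proof.
  intros H E. assert (T : (a * (/ a))%C = RtoC 1) by (field; auto).
  rewrite E, Cmult_0_r in T. injection T; lra.
Qed.

Lemma Cinv_mult a b : a <> RtoC 0 -> b <> RtoC 0 -> (/ (a * b))%C = ((/ a) * (/ b))%C.
Proof. intros; field; auto. Qed.

Lemma Cpow_mult_distr a b n : ((a * b) ^ n)%C = (a ^ n * b ^ n)%C.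
Proof. induction n; cbn [Cpow]; [ring|rewrite IHn; ring]. Qed.

Lemma Cpow_neq0 a n : a <> RtoC 0 -> (a ^ n)%C <> RtoC 0.
Proof.
  intros H. apply Cmod_gt_0. rewrite Cmod_pow. apply pow_lt. now apply Cmod_gt_0.
Qed.

(** The automorphy factor (2 pi i / (p u))^(k+1): the rotation and scaling by 2 pi i / (p u) takes
    the period p u to 2 pi i. *)
Definition eis_factor (k p : nat) (u : R) : C :=
  ((RtoC (2 * PI / (INR p * u)) * Ci) ^ S k)%C.

(** On the lattice with periods v = p u and 2 pi i, the row m is the expansion of the series of [b1]
    at m u. The column -l, multiplied by g = 2 pi i / v, consists of the points 4 pi^2 l / v + 2 pi
    i m, the expansion of the series of [b2] at the dual argument; the minus sign makes the real
    part positive. [lattice_swap] equates the two iterated sums. *)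
Lemma eisenstein_transform k p q b1 beta1 b2 beta2 e1 e2 u :
  Nat.Even k -> (1 <= p)%nat -> (1 <= q)%nat ->
  periodic p b1 -> periodic p beta1 -> rs p beta1 = RtoC 0 -> dft p b1 beta1 ->
  periodic q b2 -> periodic q beta2 -> rs q beta2 = RtoC 0 -> dft q b2 beta2 ->
  beta1 0%Z = RtoC 0 -> beta2 0%Z = RtoC 0 ->
  (forall l, beta1 (- l)%Z = (e1 * beta1 l)%C) -> (forall l, beta2 (- l)%Z = (e2 * beta2 l)%C) ->
  (e1 * e1)%C = RtoC 1 -> (e2 * e2)%C = RtoC 1 -> (e1 * e2)%C = RtoC (-1) -> 0 < u ->
  exists (A1 A2 : nat -> C) (s : C),
  (forall m, (1 <= m)%nat -> CS (fun d => (RtoC (INR d ^ k) * (b1 (Z.of_nat d) * RtoC (exp (- (INR d * (INR m * u))))))%C)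
     (RtoC (INR (fact k) * INR p ^ k) * A1 m)%C) /\
  (forall l, (1 <= l)%nat -> CS (fun d => (RtoC (INR d ^ k) * (b2 (Z.of_nat d) * RtoC (exp (- (INR d * (INR l * (4 * PI ^ 2 / (INR p * INR q * u))))))))%C)
     (RtoC (INR (fact k) * INR q ^ k) * A2 l)%C) /\
  CS (fun l => (beta1 (Z.of_nat l) * A2 l)%C) s /\
  CS (fun m => (beta2 (Z.of_nat m) * A1 m)%C) (e1 * eis_factor k p u * s)%C.
Proof.
  intros Hk Hp Hq Pb1 Pbeta1 R1 D1 Pb2 Pbeta2 R2 D2 Z1 Z2 E1 E2 S1 S2 S12 Hu.
  assert (HpR : 1 <= INR p) by (apply (le_INR 1); lia).
  assert (HqR : 1 <= INR q) by (apply (le_INR 1); lia).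
  pose proof PI_RGT_0 as Hpi.
  set (v := INR p * u). assert (Hv : 0 < v) by (unfold v; nra).
  set (X := Xsum p beta1). set (Y := Xsum q beta2).
  destruct (periodic_bounded p X Hp (Xsum_periodic p beta1 Hp)) as [BX [_ HBX]].
  destruct (periodic_bounded q Y Hq (Xsum_periodic q beta2 Hq)) as [BY [_ HBY]].
  assert (HX : forall l, (X l - X (l - 1)%Z)%C = beta1 l) by (intros; now apply Xsum_diff).
  assert (HY : forall l, (Y l - Y (l - 1)%Z)%C = beta2 l) by (intros; now apply Xsum_diff).
  set (al := RtoC v). set (be := (0, 2 * PI) : C).
  destruct (lattice_swap _ al be k beta1 X beta2 Y BX BY (separated_zpt v Hv) HBX HBY HX HY)
    as [A [D [s [HA [HD [A0 [D0 [SA SD]]]]]]]].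
  assert (PX := primitive_parity X beta1 e1 S1 HX (Xsum_0 p beta1 Hp Z1) Z1 E1).
  assert (PY := primitive_parity Y beta2 e2 S2 HY (Xsum_0 q beta2 Hq Z2) Z2 E2).
  assert (PA := row_parity al be k X e1 A Hk S1 PX HA).
  assert (PD : forall l, D (- l)%Z = ((- e2) * D l)%C).
  { apply (row_parity be al k Y e2 D Hk S2 PY). intros l.
    eapply ZS_ext; [|apply (HD l)]. intros m. cbv beta. now rewrite !(latH_swap be al). }
  set (g := (RtoC (2 * PI / v) * Ci)%C).
  assert (Hg : g <> RtoC 0).
  { apply Cmult_neq_0; [apply RtoC_neq0, Rgt_not_eq, Rdiv_lt_0_compat; lra|].
    intros E. injection E; lra. }
  assert (Hgk : (g ^ S k)%C <> RtoC 0) by now apply Cpow_neq0.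
  assert (H2 : RtoC 2 <> RtoC 0) by (apply RtoC_neq0; lra).
  (* [e1] comes from reading the columns at -l, g^(-k-1) from rescaling them, and s/2 from folding Z
     onto positive indices. *)
  exists (fun m => A (Z.of_nat m)), (fun l => ((/ g ^ S k) * D (- Z.of_nat l)%Z)%C),
    (e1 * (/ g ^ S k) * (s / 2))%C.
  split; [|split; [|split]].
  - intros m Hm. assert (HmR : 1 <= INR m) by (apply (le_INR 1); lia).
    destruct (lipschitz k p b1 beta1 (INR m * u)) as [L [H3 H4]]; auto; [nra|].
    replace (A (Z.of_nat m)) with L; auto.
    apply (CS_unique _ _ _ H4). eapply ZS_ext; [|apply (HA (Z.of_nat m))].
    intros l. unfold latH, al, be. rewrite !lat_zpt, <- INR_IZR_INZ. fold X.
    replace (v * INR m) with (INR p * (INR m * u)) by (unfold v; ring). reflexivity.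
  - intros l Hl. assert (HlR : 1 <= INR l) by (apply (le_INR 1); lia).
    set (t := INR l * (4 * PI ^ 2 / (INR p * INR q * u))).
    assert (Ht : 0 < t).
    { unfold t. apply Rmult_lt_0_compat; [lra|]. apply Rdiv_lt_0_compat; [|repeat apply Rmult_lt_0_compat; lra].
      apply Rmult_lt_0_compat; [lra|]. apply pow_lt; lra. }
    destruct (lipschitz k q b2 beta2 t) as [L [H3 H4]]; auto.
    replace ((/ g ^ S k) * D (- Z.of_nat l)%Z)%C with L; auto.
    apply (CS_unique _ _ _ H4).
    pose proof (ZS_scal (/ g ^ S k)%C _ _ (HD (- Z.of_nat l)%Z)) as H5.
    eapply ZS_ext; [|exact H5]. intros m. cbv beta. fold Y.
    assert (EH : forall m, latH al be k m (- Z.of_nat l) =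
        (g ^ S k * (/ zpt (INR q * t) m) ^ S k)%C).
    { intros m'. unfold latH. rewrite <- Cpow_mult_distr. f_equal.
      assert (Hz : zpt (INR q * t) m' <> RtoC 0) by (apply zpt_neq0, Rgt_not_eq, Rmult_lt_0_compat; lra).
      replace (lat al be m' (- Z.of_nat l)) with ((/ g) * zpt (INR q * t) m')%C.
      - rewrite Cinv_mult; auto.
        + field. auto.
        + now apply Cinv_neq0.
      - replace (/ g)%C with (RtoC (v / (2 * PI)) * (- Ci))%C.
        + unfold al, be. rewrite lat_zpt.
          unfold zpt, Cmult, Copp, Ci, RtoC, t, v; cbn [fst snd]. rewrite opp_IZR, <- INR_IZR_INZ.
          f_equal; field; lra.
        + assert (T : (g * (RtoC (v / (2 * PI)) * (- Ci)))%C = RtoC 1).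
          { unfold g, Cmult, Copp, Ci, RtoC; simpl. f_equal; field; lra. }
          transitivity ((/ g) * (g * (RtoC (v / (2 * PI)) * (- Ci))))%C; [field; auto|].
          rewrite T. ring. }
    rewrite !EH. field. auto.
  - assert (Hev : forall l, (beta1 (- l)%Z * D (- l)%Z)%C = (beta1 l * D l)%C).
    { intros l. rewrite E1, PD.
      transitivity ((- (e1 * e2)) * (beta1 l * D l))%C; [ring|].
      rewrite S12. ring. }
    eapply CS_ext; [|apply CS_scal, (ZS_even_half (fun l => (beta1 l * D l)%C))]; auto.
    + intros l. cbv beta. rewrite <- Hev, E1.
      transitivity (e1 * e1 * ((/ g ^ S k) * (beta1 (Z.of_nat l) * D (- Z.of_nat l)%Z)))%C; [ring|].
      rewrite S1. ring.
    + rewrite Z1. ring.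
    + destruct (periodic_bounded p beta1 Hp Pbeta1) as [BB [_ HBB]].
      apply (lim0_bounded_mult (fun n => beta1 (Z.of_nat n)) _ BB (fun n => HBB _) D0).
  - replace (e1 * eis_factor k p u * (e1 * (/ g ^ S k) * (s / 2)))%C
      with (s / 2)%C.
    2:{ unfold eis_factor. fold v. fold g.
        transitivity (e1 * e1 * (s / 2))%C; [rewrite S1; ring|]. field. auto. }
    (* The coefficient contributes e2 and the row sum -e1; since e1 e2 = -1 the product is even. *)
    assert (Hev : forall m, (beta2 (- m)%Z * A (- m)%Z)%C = (beta2 m * A m)%C).
    { intros m. rewrite E2, PA.
      transitivity ((- (e1 * e2)) * (beta2 m * A m))%C; [ring|].
      rewrite S12. ring. }
    apply (ZS_even_half (fun m => (beta2 m * A m)%C)); auto.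
    + rewrite Z2. ring.
    + destruct (periodic_bounded q beta2 Hq Pbeta2) as [BB [_ HBB]].
      apply (lim0_bounded_mult (fun n => beta2 (Z.of_nat n)) _ BB (fun n => HBB _) A0).
Qed.

(** * Divisor sums *)

Definition dsum (c : nat -> nat -> C) (n : nat) : C :=
  csum (filter (fun d => Nat.eqb (n mod d) 0) (seq 1 n)) (fun d => c d (n / d)%nat).

Lemma csum_ext l f g : (forall d, In d l -> f d = g d) -> csum l f = csum l g.
Proof.
  unfold csum. induction l; intros H; simpl; auto.
  rewrite IHl, H; auto; [now left|]. intros d Hd. apply H. now right.
Qed.

Lemma csum_scal l c f : csum l (fun d => (c * f d)%C) = (c * csum l f)%C.
Proof. unfold csum. induction l; simpl; [ring|]. rewrite IHl. ring. Qed.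

Lemma dsum_in n d : In d (filter (fun d => Nat.eqb (n mod d) 0) (seq 1 n)) ->
  (1 <= d)%nat /\ (d * (n / d) = n)%nat.
Proof.
  intros H. apply filter_In in H. destruct H as [H1 H2]. apply in_seq in H1.
  apply Nat.eqb_eq in H2. split; [lia|].
  pose proof (Nat.div_mod n d ltac:(lia)). lia.
Qed.

Lemma dsum_psum c n : dsum c n =
  psum (fun d => stretch (S d) (fun m => if Nat.eqb m 0 then RtoC 0 else c (S d) m) n) n.
Proof.
  unfold dsum.
  assert (F : forall (P : nat -> bool) l f, csum (filter P l) f = csum l (fun d => if P d then f d else RtoC 0)).
  { intros P l f. unfold csum. induction l; simpl; auto. destruct (P a); simpl; rewrite IHl; auto. ring. }
  rewrite F, <- seq_shift, csum_map, <- psum_csum. apply psum_ext. intros d Hd.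
  unfold stretch. destruct (Nat.eqb_spec (n mod S d) 0) as [E|E]; auto.
  destruct (Nat.eqb_spec (n / S d) 0) as [E2|E2]; auto.
  exfalso. pose proof (Nat.div_mod n (S d) ltac:(lia)). rewrite E, E2 in H. lia.
Qed.

(** Collects a double series along the hyperbolas d m = n. One exchange moves d outside, each series
    in m is spread over the multiples of d, and a second exchange sums over d at fixed n, where only
    divisors contribute. *)
Lemma CS_divisor_regroup (c : nat -> nat -> C) (W W' : nat -> R) r s :
  (forall n, 0 <= W n) -> (forall n, 0 <= W' n) -> ex_series W -> ex_series W' ->
  (forall d m, Cmod (c (S d) (S m)) <= W d * W' m) ->
  (forall m, CS (fun d => c (S d) (S m)) (r m)) -> CS r s ->
  CS (fun n => dsum c (S n)) s.
Proof.
  intros PW PW' EW EW' Hc Hr Hs.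
  set (c0 := fun D m => if Nat.eqb m 0 then RtoC 0 else c D m).
  assert (HR : forall d, exists R, CS (fun m => c (S d) (S m)) R).
  { intros d. destruct (CS_dom (fun m => c (S d) (S m)) (fun m => W d * W' m)) as [R [H _]].
    - intros m; apply Hc.
    - now apply ex_series_Rscal.
    - now exists R. }
  set (R := fun d => Csum (fun m => c (S d) (S m))).
  assert (HR' : forall d, CS (fun m => c (S d) (S m)) (R d))
    by (intros d; destruct (HR d) as [x Hx]; apply (Csum_correct _ _ Hx)).
  assert (HRs : CS R s).
  { apply (CS_swap (fun m d => c (S d) (S m)) (fun m d => W' m * W d) (fun m => Series W * W' m) r); auto.
    - intros m d. rewrite Rmult_comm. apply Hc.
    - intros m n. rewrite rsum_scal, Rmult_comm. apply Rmult_le_compat_r; auto.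
      now apply rsum_le_Series.
    - now apply ex_series_Rscal. }
  set (G := fun d n => stretch (S d) (c0 (S d)) n).
  set (u := fun d m => if Nat.eqb m 0 then 0 else W d * W' (pred m)).
  assert (Hu : forall d m, 0 <= u d m).
  { intros d m. unfold u. destruct (Nat.eqb m 0); [lra|]. now apply Rmult_le_pos. }
  assert (HG : forall d n, Cmod (G d n) <= Re (stretch (S d) (fun m => RtoC (u d m)) n)).
  { intros d n. unfold G, stretch. destruct (Nat.eqb (n mod S d) 0); [|rewrite Cmod_0; simpl; lra].
    unfold c0, u. destruct (n / S d)%nat as [|m]; simpl; [rewrite Cmod_0; lra|apply Hc]. }
  (* A partial sum is enlarged to a length divisible by d, where [psum_stretch] identifies it with a
     partial sum of the unstretched weights. *)
  assert (HU : forall d n, rsum (fun n => Re (stretch (S d) (fun m => RtoC (u d m)) n)) n <= Series W' * W d).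
  { intros d n.
    assert (Hp : forall i, 0 <= Re (stretch (S d) (fun m => RtoC (u d m)) i))
      by (intros i; eapply Rle_trans; [apply Cmod_ge_0|apply HG]).
    apply Rle_trans with (rsum (fun n => Re (stretch (S d) (fun m => RtoC (u d m)) n)) (S d * S n)).
    { apply rsum_incr; auto. lia. }
    assert (ER : forall f N, rsum (fun n => Re (f n)) N = Re (psum f N)).
    { intros f N. induction N; simpl; auto. rewrite IHN. reflexivity. }
    rewrite ER, psum_stretch by lia. rewrite <- ER. simpl Re.
    assert (EU : forall N, rsum (u d) (S N) = W d * rsum W' N).
    { induction N; [simpl; unfold u; simpl; ring|].
      change (rsum (u d) (S (S N))) with (rsum (u d) (S N) + u d (S N)). rewrite IHN.
      unfold u. simpl. ring. }
    rewrite EU, Rmult_comm. apply Rmult_le_compat_r; auto. now apply rsum_le_Series. }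
  assert (HGn : forall n, CS (fun d => G d n) (dsum c n)).
  { intros n. rewrite dsum_psum. apply (CS_finite (fun d => G d n)). intros d Hd. unfold G, stretch.
    destruct n as [|n].
    - rewrite Nat.Div0.mod_0_l, Nat.Div0.div_0_l. reflexivity.
    - rewrite Nat.mod_small by lia. reflexivity. }
  apply (CS_S (dsum c)); [reflexivity|].
  apply (CS_swap G (fun d n => Re (stretch (S d) (fun m => RtoC (u d m)) n)) (fun d => Series W' * W d) R); auto.
  - now apply ex_series_Rscal.
  - intros d.
    assert (HE : exists x, CS (G d) x).
    { destruct (CS_dom (G d) (fun n => Re (stretch (S d) (fun m => RtoC (u d m)) n))) as [x [H _]]; auto.
      - apply rsum_bounded_ex_series with (Series W' * W d).
        + intros i. eapply Rle_trans; [apply Cmod_ge_0|apply HG].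
        + apply HU.
      - now exists x. }
    destruct HE as [x Hx].
    pose proof (CS_stretch (S d) (c0 (S d)) x ltac:(lia) Hx) as H1.
    apply (CS_S (c0 (S d))) in H1; [|reflexivity].
    rewrite (CS_unique _ _ _ (HR' d) H1). exact Hx.
Qed.

(** The classical sigma_k(n), which majorises every twisted divisor sum. Defining it through [dsum]
    makes the regrouping of complex series available for it. *)
Definition sig (k n : nat) : R :=
  Re (dsum (fun d _ => RtoC (INR d ^ k)) n).

Lemma csum_RtoC l f : csum l (fun d => RtoC (f d)) = RtoC (Re (csum l (fun d => RtoC (f d)))).
Proof.
  unfold csum. induction l; simpl; auto. rewrite IHl. rewrite <- RtoC_plus. reflexivity.
Qed.

Lemma Cmod_csum_le l f g : (forall d, In d l -> Cmod (f d) <= g d) ->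
  Cmod (csum l f) <= Re (csum l (fun d => RtoC (g d))).
Proof.
  unfold csum. induction l; intros H; simpl; [rewrite Cmod_0; lra|].
  eapply Rle_trans; [apply Cmod_triangle|].
  apply Rplus_le_compat; [apply H; now left|]. apply IHl. intros d Hd. apply H. now right.
Qed.

Lemma sig_pos k n : 0 <= sig k n.
Proof.
  unfold sig, dsum. eapply Rle_trans; [apply (Cmod_ge_0 (csum (filter (fun d => Nat.eqb (n mod d) 0) (seq 1 n)) (fun d => RtoC (INR d ^ k))))|].
  apply Cmod_csum_le. intros d _. rewrite Cmod_R, Rabs_pos_eq; [lra|]. apply pow_le, pos_INR.
Qed.

Lemma Rpower_le_1 x a b : 1 <= x -> a <= b -> Rpower x a <= Rpower x b.
Proof.
  intros Hx H. destruct (Req_dec x 1) as [->|N].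
  - unfold Rpower. rewrite ln_1, !Rmult_0_r. lra.
  - apply Rle_Rpower; lra.
Qed.

Lemma divisor_weight k del d m : 0 < del ->
  INR (S d) ^ k * Rpower (INR (S d) * INR (S m)) (- (INR k + 1 + del)) <= wt del d * wt del m.
Proof.
  intros Hd.
  assert (A : 1 <= INR (S d)) by (apply (le_INR 1); lia).
  assert (B : 1 <= INR (S m)) by (apply (le_INR 1); lia).
  rewrite <- Rpower_mult_distr, <- Rmult_assoc by lra.
  rewrite <- (Rpower_pow k (INR (S d))), <- Rpower_plus by lra.
  unfold wt. apply Rmult_le_compat; try (apply Rlt_le, exp_pos).
  - right. f_equal. ring.
  - apply Rpower_le_1; auto. pose proof (pos_INR k). lra.
Qed.

(** The series is zeta(s) zeta(s-k) at s = k + 1 + del. Regrouping gives convergence of the complex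
    series, and nonnegative terms bound the real partial sums by its value. *)
Lemma sig_ex_series k del : 0 < del ->
  ex_series (fun n => sig k (S n) * Rpower (INR (S n)) (- (INR k + 1 + del))).
Proof.
  intros Hd. set (kap := INR k + 1 + del).
  set (c := fun d m : nat => RtoC (INR d ^ k * Rpower (INR d * INR m) (- kap))).
  assert (Hc : forall d m, Cmod (c (S d) (S m)) <= wt del d * wt del m).
  { intros d m. unfold c. rewrite Cmod_R, Rabs_pos_eq; [now apply divisor_weight|].
    apply Rmult_le_pos; [apply pow_le, pos_INR|apply Rlt_le, exp_pos]. }
  assert (Hw := wt_ex_series del Hd).
  assert (Hp : forall n, 0 <= wt del n) by (intros; apply Rlt_le, wt_pos).
  set (r := fun m => Csum (fun d => c (S d) (S m))).
  assert (Hr : forall m, CS (fun d => c (S d) (S m)) (r m) /\ Cmod (r m) <= Series (wt del) * wt del m).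
  { intros m. destruct (CS_dom (fun d => c (S d) (S m)) (fun d => wt del m * wt del d)) as [x [H1 H2]].
    - intros d. rewrite Rmult_comm. apply Hc.
    - now apply ex_series_Rscal.
    - pose proof (Csum_correct _ _ H1) as H3. fold (r m) in H3. split; auto.
      rewrite (CS_unique _ _ _ H3 H1). rewrite Series_scal_l in H2. lra. }
  destruct (CS_dom r (fun m => Series (wt del) * wt del m)) as [s [Hs _]].
  { intros m. apply Hr. }
  { now apply ex_series_Rscal. }
  assert (H := CS_divisor_regroup c (wt del) (wt del) r s Hp Hp Hw Hw Hc (fun m => proj1 (Hr m)) Hs).
  assert (E : forall n, dsum c (S n) = RtoC (sig k (S n) * Rpower (INR (S n)) (- kap))).
  { intros n. unfold sig. rewrite RtoC_mult. unfold dsum at 2. rewrite <- csum_RtoC.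
    rewrite Cmult_comm, <- csum_scal. unfold dsum. apply csum_ext. intros d Hd'.
    apply dsum_in in Hd'. destruct Hd' as [_ Hd']. unfold c.
    rewrite <- mult_INR, Hd', RtoC_mult. ring. }
  apply rsum_bounded_ex_series with (Cmod s).
  { intros i. apply Rmult_le_pos; [apply sig_pos|apply Rlt_le, exp_pos]. }
  set (w := fun n => sig k (S n) * Rpower (INR (S n)) (- kap)).
  assert (Hwp : forall i, 0 <= w i).
  { intros i. apply Rmult_le_pos; [apply sig_pos|apply Rlt_le, exp_pos]. }
  assert (EP : forall N, psum (fun n => dsum c (S n)) N = RtoC (rsum w N)).
  { induction N; simpl; auto. rewrite IHN, E. now rewrite <- RtoC_plus. }
  intros N. apply Clim_Cmod in H.
  assert (Hlim : is_lim_seq (rsum w) (Cmod s)).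
  { eapply is_lim_seq_ext; [|exact H]. intros n. cbv beta. rewrite EP, Cmod_R. apply Rabs_pos_eq.
    apply (rsum_incr w 0 n Hwp). lia. }
  apply (is_lim_seq_incr_compare (rsum w)); auto.
  intros n. simpl. specialize (Hwp n). lra.
Qed.

Lemma exp_divisor_weight k u : 0 < u -> exists C, 0 < C /\ forall d m,
  INR (S d) ^ k * exp (- (INR (S d) * (INR (S m) * u))) <= C * wt 1 d * wt 1 m.
Proof.
  intros Hu. destruct (exp_neg_le (INR k + 1 + 1) ltac:(pose proof (pos_INR k); lra)) as [C [C0 HC]].
  exists (C * Rpower u (- (INR k + 1 + 1))). split; [apply Rmult_lt_0_compat; auto; apply exp_pos|].
  intros d m.
  assert (A : 1 <= INR (S d)) by (apply (le_INR 1); lia).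
  assert (B : 1 <= INR (S m)) by (apply (le_INR 1); lia).
  assert (AB : 0 < INR (S d) * INR (S m)) by (apply Rmult_lt_0_compat; lra).
  specialize (HC (INR (S d) * (INR (S m) * u)) ltac:(repeat apply Rmult_lt_0_compat; lra)).
  rewrite <- Rmult_assoc, <- Rpower_mult_distr in HC by lra.
  pose proof (divisor_weight k 1 d m ltac:(lra)) as D.
  rewrite <- Rmult_assoc.
  eapply Rle_trans; [apply Rmult_le_compat_l; [apply pow_le; lra|exact HC]|].
  assert (0 < C * Rpower u (- (INR k + 1 + 1))) by (apply Rmult_lt_0_compat; auto; apply exp_pos).
  apply Rle_trans with (C * Rpower u (- (INR k + 1 + 1)) *
    (INR (S d) ^ k * Rpower (INR (S d) * INR (S m)) (- (INR k + 1 + 1)))); [right; ring|].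
  rewrite (Rmult_assoc _ (wt 1 d)). apply Rmult_le_compat_l; [lra|auto].
Qed.

(** The factor e^(-d m u) depends only on n = d m. As [b] and [beta] vanish at 0, sums starting at 0
    and at 1 agree. *)
Lemma lambert_regroup k p q b beta u (K : C) (A : nat -> C) s : (1 <= p)%nat -> (1 <= q)%nat ->
  periodic p b -> periodic q beta -> b 0%Z = RtoC 0 -> beta 0%Z = RtoC 0 -> 0 < u ->
  (forall m, (1 <= m)%nat -> CS (fun d => (RtoC (INR d ^ k) * (b (Z.of_nat d) * RtoC (exp (- (INR d * (INR m * u))))))%C) (K * A m)%C) ->
  CS (fun m => (beta (Z.of_nat m) * A m)%C) s ->
  CS (fun n => (dsum (fun d m => (RtoC (INR d ^ k) * b (Z.of_nat d) * beta (Z.of_nat m))%C) (S n) * RtoC (exp (- (INR (S n) * u))))%C) (K * s)%C.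
Proof.
  intros Hp Hq Pb Pbeta b0 beta0 Hu HA Hs.
  destruct (periodic_bounded p b Hp Pb) as [B1 [B10 HB1]].
  destruct (periodic_bounded q beta Hq Pbeta) as [B2 [B20 HB2]].
  destruct (exp_divisor_weight k u Hu) as [C [C0 HC]].
  set (c := fun d m => (RtoC (INR d ^ k) * b (Z.of_nat d) * beta (Z.of_nat m) * RtoC (exp (- (INR d * (INR m * u)))))%C).
  eapply CS_ext.
  2:{ apply (CS_divisor_regroup c (fun d => B1 * B2 * C * wt 1 d) (wt 1)
        (fun m => (beta (Z.of_nat (S m)) * (K * A (S m)))%C)).
      - intros n. pose proof (wt_pos 1 n). repeat apply Rmult_le_pos; lra.
      - intros n. apply Rlt_le, wt_pos.
      - apply ex_series_Rscal, wt_ex_series; lra.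
      - apply wt_ex_series; lra.
      - intros d m. unfold c. rewrite !Cmod_mult, !Cmod_R, !Rabs_pos_eq;
          [|apply Rlt_le, exp_pos|apply pow_le, pos_INR].
        specialize (HC d m).
        apply Rle_trans with (B1 * B2 * (INR (S d) ^ k * exp (- (INR (S d) * (INR (S m) * u))))).
        + pose proof (Cmod_ge_0 (b (Z.of_nat (S d)))). pose proof (Cmod_ge_0 (beta (Z.of_nat (S m)))).
          assert (P : 0 <= INR (S d) ^ k * exp (- (INR (S d) * (INR (S m) * u))))
            by (apply Rmult_le_pos; [apply pow_le, pos_INR|apply Rlt_le, exp_pos]).
          assert (Cmod (b (Z.of_nat (S d))) * Cmod (beta (Z.of_nat (S m))) <= B1 * B2)
            by (apply Rmult_le_compat; auto).
          nra.
        + rewrite !(Rmult_assoc (B1 * B2)). apply Rmult_le_compat_l; [apply Rmult_le_pos; lra|lra].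
      - intros m. pose proof (HA (S m) ltac:(lia)) as H.
        apply CS_S in H; [|simpl Z.of_nat; rewrite b0; ring].
        eapply CS_ext; [|apply (CS_scal (beta (Z.of_nat (S m))) _ _ H)].
        intros d. unfold c. ring.
      - apply (CS_S (fun m => (beta (Z.of_nat m) * (K * A m))%C)).
        + simpl Z.of_nat. rewrite beta0. ring.
        + eapply CS_ext; [|apply (CS_scal K _ _ Hs)]. intros m. cbv beta. ring. }
  intros n. rewrite Cmult_comm. unfold dsum. rewrite <- csum_scal. apply csum_ext.
  intros d Hd. apply dsum_in in Hd. destruct Hd as [_ Hd]. unfold c.
  rewrite <- Rmult_assoc, <- mult_INR, Hd. ring.
Qed.

(** * Twisted divisor sums and their generating series *)

Lemma cpow_INR r k : 0 < r -> cpow r (RtoC (INR k)) = RtoC (r ^ k).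
Proof.
  intros Hr. unfold cpow. rewrite <- RtoC_mult, Cexp_RtoC. f_equal.
  rewrite <- Rpower_pow by auto. reflexivity.
Qed.

Lemma sigma_chi_dsum k chi1 chi2 n : sigma_chi (RtoC (INR k)) chi1 chi2 n =
  dsum (fun d m => (RtoC (INR d ^ k) * chi1 (Z.of_nat d) * chi2 (Z.of_nat m))%C) n.
Proof.
  unfold sigma_chi, dsum. apply csum_ext. intros d Hd. apply dsum_in in Hd.
  rewrite cpow_INR; auto. apply lt_0_INR; lia.
Qed.

Lemma sigma_chi_le k chi1 chi2 n : (forall m, Cmod (chi1 m) <= 1) -> (forall m, Cmod (chi2 m) <= 1) ->
  Cmod (sigma_chi (RtoC (INR k)) chi1 chi2 n) <= sig k n.
Proof.
  intros H1 H2. rewrite sigma_chi_dsum. unfold sig, dsum. apply Cmod_csum_le. intros d _.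
  rewrite !Cmod_mult, Cmod_R, Rabs_pos_eq by apply pow_le, pos_INR.
  specialize (H1 (Z.of_nat d)). specialize (H2 (Z.of_nat (n / d))).
  pose proof (Cmod_ge_0 (chi1 (Z.of_nat d))). pose proof (Cmod_ge_0 (chi2 (Z.of_nat (n / d)))).
  assert (0 <= INR d ^ k) by apply pow_le, pos_INR.
  rewrite <- (Rmult_1_r (INR d ^ k)) at 2. rewrite Rmult_assoc. apply Rmult_le_compat_l; auto. nra.
Qed.

Lemma conj_char_le1 q chi n : dirichlet_char q chi -> Cmod (conj_char chi n) <= 1.
Proof. intros H. unfold conj_char. rewrite Cmod_conj. now apply (char_mod_le1 q). Qed.

Lemma odd_char_modulus q chi : dirichlet_char q chi -> odd_char chi -> (1 < q)%nat.
Proof.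
  intros (Hq & H1 & _ & Hp & _) Ho. destruct (Nat.eq_dec q 1) as [E|E]; [|lia]. subst q.
  exfalso. unfold odd_char in Ho.
  pose proof (periodic_add 1 chi Hp (-2) 1) as T. simpl in T. rewrite Ho, H1 in T.
  injection T; lra.
Qed.

Lemma nonprincipal_modulus q chi : dirichlet_char q chi -> ~ principal_char q chi -> (1 < q)%nat.
Proof.
  intros (Hq & H1 & _ & Hp & _) Hn. destruct (Nat.eq_dec q 1) as [E|E]; [|lia]. subst q.
  exfalso. apply Hn. intros n _. rewrite <- H1.
  rewrite <- (periodic_add 1 chi Hp (n - 1) 1). f_equal. lia.
Qed.

Lemma char_0 q chi : dirichlet_char q chi -> (1 < q)%nat -> chi 0%Z = RtoC 0.
Proof.
  intros (_ & _ & _ & _ & H0 & _) Hq. apply H0. rewrite Z.gcd_0_l. lia.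
Qed.

Lemma char_neg q chi e n : dirichlet_char q chi -> chi (-1)%Z = RtoC e ->
  chi (- n)%Z = (RtoC e * chi n)%C.
Proof.
  intros (_ & _ & Hm & _) E. rewrite <- E, <- Hm. now destruct n.
Qed.

Lemma conj_char_neg q chi e n : dirichlet_char q chi -> chi (-1)%Z = RtoC e ->
  conj_char chi (- n)%Z = (RtoC e * conj_char chi n)%C.
Proof.
  intros Hd E. unfold conj_char. rewrite (char_neg q chi e n Hd E), Cmult_conj, Cconj_RtoC.
  reflexivity.
Qed.

Lemma char_rs_0 q chi : primitive_char q chi -> (1 < q)%nat -> rs q chi = RtoC 0.
Proof.
  intros Hc Hq. pose proof (gauss_separable q chi 0 Hc Hq) as H.
  destruct Hc as [Hd _]. rewrite (char_0 q chi Hd Hq), Cconj_RtoC, Cmult_0_r in H.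
  rewrite <- H. apply rs_ext. intros h. rewrite Z.mul_0_r, ez_0. ring.
Qed.

Lemma gauss_dft q chi : primitive_char q chi -> (1 < q)%nat ->
  dft q chi (fun l => (gauss_sum q chi * conj_char chi l)%C).
Proof. intros Hc Hq l. symmetry. now apply gauss_separable. Qed.

Lemma gauss_dft_rs_0 q chi : primitive_char q chi -> (1 < q)%nat ->
  rs q (fun l => (gauss_sum q chi * conj_char chi l)%C) = RtoC 0.
Proof.
  intros Hc Hq. pose proof Hc as [Hd _]. pose proof Hd as (Hq1 & _ & _ & Hp & _).
  pose proof (rs_dft_inverse q chi 0 Hq1 Hp) as H.
  rewrite (char_0 q chi Hd Hq), Cmult_0_r in H. rewrite <- H. apply rs_ext. intros n.
  rewrite <- (gauss_dft q chi Hc Hq n). replace (-0 * n)%Z with 0%Z by lia. rewrite ez_0. ring.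
Qed.

(** Fourier inversion, with the sign in its exponential turned into chi(-1). It exhibits the
    character itself as a transform, keeping the Gauss sum in the numerator. *)
Lemma gauss_dft_inverse q chi e : primitive_char q chi -> (1 < q)%nat -> chi (-1)%Z = RtoC e ->
  dft q (fun h => (gauss_sum q chi * RtoC (e / INR q) * conj_char chi h)%C) chi.
Proof.
  intros Hc Hq He l. pose proof Hc as [Hd _]. pose proof Hd as (Hq1 & _ & _ & Hp & _).
  assert (HqR : INR q <> 0) by (apply not_0_INR; lia).
  assert (HqC : RtoC (INR q) <> RtoC 0) by now apply RtoC_neq0.
  pose proof (rs_dft_inverse q chi l Hq1 Hp) as H.
  replace (chi l) with ((/ RtoC (INR q)) * (RtoC (INR q) * chi l))%C by (field; auto).
  rewrite <- H.
  rewrite <- (rs_reindex q (fun n => (rs q (fun h => (chi h * ez q (h * n))%C) * ez q (- l * n))%C)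
               (fun h => (- h)%Z) Hq1).
  - rewrite <- rs_scal. apply rs_ext. intros h.
    rewrite <- (gauss_dft q chi Hc Hq (- h)%Z), (conj_char_neg q chi e h Hd He).
    replace (- l * - h)%Z with (h * l)%Z by ring.
    rewrite RtoC_div by auto. unfold Cdiv. ring.
  - intros n. f_equal.
    + apply rs_ext. intros h. f_equal.
      rewrite <- (ez_period q (h * n) h) by auto. f_equal. ring.
    + rewrite <- (ez_period q (- l * n) (- l)) by auto. f_equal. ring.
  - intros h h' [c Hc']. exists (- c)%Z. lia.
Qed.

Lemma sigma_exp_summable k chi1 chi2 v : (forall m, Cmod (chi1 m) <= 1) -> (forall m, Cmod (chi2 m) <= 1) ->
  0 < v -> exists G, CS (fun n => (sigma_chi (RtoC (INR k)) chi1 chi2 (S n) * RtoC (exp (- (INR (S n) * v))))%C) G.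
Proof.
  intros H1 H2 Hv.
  destruct (exp_neg_le (INR k + 1 + 1) ltac:(pose proof (pos_INR k); lra)) as [C [C0 HC]].
  destruct (CS_dom (fun n => (sigma_chi (RtoC (INR k)) chi1 chi2 (S n) * RtoC (exp (- (INR (S n) * v))))%C)
    (fun n => C * Rpower v (- (INR k + 1 + 1)) * (sig k (S n) * Rpower (INR (S n)) (- (INR k + 1 + 1)))))
    as [G [HG _]].
  - intros n. rewrite Cmod_mult, Cmod_R, Rabs_pos_eq by apply Rlt_le, exp_pos.
    assert (A : 0 < INR (S n)) by (apply lt_0_INR; lia).
    specialize (HC (INR (S n) * v) ltac:(now apply Rmult_lt_0_compat)).
    rewrite <- Rpower_mult_distr in HC by auto.
    apply Rle_trans with (sig k (S n) * (C * (Rpower (INR (S n)) (- (INR k + 1 + 1)) * Rpower v (- (INR k + 1 + 1))))).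
    + apply Rmult_le_compat; auto using Cmod_ge_0, sigma_chi_le. apply Rlt_le, exp_pos.
    + right; ring.
  - apply ex_series_Rscal, sig_ex_series. lra.
  - now exists G.
Qed.

(** In [eisenstein_transform] the first pair is chi1 with its transform, the second pair has chi2 as
    the transform. Rows thus carry chi1(d) chi2(m), whereas columns carry conj chi2 on the summed
    divisor and conj chi1 on the cofactor, which explains the exchanged order on the dual side. *)
Lemma lambert_transform k p q chi1 chi2 e1 e2 u : Nat.Even k ->
  primitive_char p chi1 -> primitive_char q chi2 -> (1 < p)%nat -> (1 < q)%nat ->
  chi1 (-1)%Z = RtoC e1 -> chi2 (-1)%Z = RtoC e2 ->
  e1 * e1 = 1 -> e2 * e2 = 1 -> e1 * e2 = -1 -> 0 < u ->
  exists G,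
  CS (fun n => (sigma_chi (RtoC (INR k)) (conj_char chi2) (conj_char chi1) (S n) * RtoC (exp (- (INR (S n) * (4 * PI ^ 2 / (INR p * INR q * u))))))%C) G /\
  CS (fun n => (sigma_chi (RtoC (INR k)) chi1 chi2 (S n) * RtoC (exp (- (INR (S n) * u))))%C)
     (gauss_sum p chi1 * gauss_sum q chi2 * RtoC (- (INR p ^ k / INR q ^ S k)) * eis_factor k p u * G)%C.
Proof.
  intros Hk Hc1 Hc2 Hp Hq E1 E2 S1 S2 S12 Hu.
  pose proof Hc1 as [Hd1 _]. pose proof Hc2 as [Hd2 _].
  pose proof Hd1 as (_ & _ & _ & P1 & _). pose proof Hd2 as (_ & _ & _ & P2 & _).
  assert (HpR : 1 <= INR p) by (apply (le_INR 1); lia).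
  assert (HqR : 1 <= INR q) by (apply (le_INR 1); lia).
  assert (PC : forall r chi, periodic r chi -> periodic r (conj_char chi))
    by (intros r chi H n; unfold conj_char; now rewrite H).
  set (t1 := gauss_sum p chi1). set (t2 := gauss_sum q chi2).
  set (b2 := fun h => (t2 * RtoC (e2 / INR q) * conj_char chi2 h)%C).
  set (beta1 := fun l => (t1 * conj_char chi1 l)%C).
  assert (Pb2 : periodic q b2) by (intros n; unfold b2; now rewrite (PC q chi2 P2)).
  assert (Pbeta1 : periodic p beta1) by (intros n; unfold beta1; now rewrite (PC p chi1 P1)).
  assert (C10 : conj_char chi1 0%Z = RtoC 0)
    by (unfold conj_char; rewrite (char_0 p chi1 Hd1 Hp); apply Cconj_RtoC).
  assert (C20 : conj_char chi2 0%Z = RtoC 0)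
    by (unfold conj_char; rewrite (char_0 q chi2 Hd2 Hq); apply Cconj_RtoC).
  assert (beta10 : beta1 0%Z = RtoC 0) by (unfold beta1; rewrite C10; ring).
  assert (b20 : b2 0%Z = RtoC 0) by (unfold b2; rewrite C20; ring).
  destruct (eisenstein_transform k p q chi1 beta1 b2 chi2 (RtoC e1) (RtoC e2) u)
    as [A1 [A2 [s [H1 [H2 [H3 H4]]]]]]; auto; try lia.
  { now apply gauss_dft_rs_0. }
  { now apply gauss_dft. }
  { now apply char_rs_0. }
  { now apply gauss_dft_inverse. }
  { now apply (char_0 q). }
  { intros l. unfold beta1. rewrite (conj_char_neg p chi1 e1 l Hd1 E1). ring. }
  { intros l. now apply (char_neg q). }
  { now rewrite <- RtoC_mult, S1. }
  { now rewrite <- RtoC_mult, S2. }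
  { now rewrite <- RtoC_mult, S12. }
  set (v := 4 * PI ^ 2 / (INR p * INR q * u)) in *.
  assert (Hv : 0 < v).
  { unfold v. pose proof PI_RGT_0. apply Rdiv_lt_0_compat; [|repeat apply Rmult_lt_0_compat; lra].
    apply Rmult_lt_0_compat; [lra|]. apply pow_lt; lra. }
  pose proof (lambert_regroup k p q chi1 chi2 u _ A1 _ ltac:(lia) ltac:(lia) P1 P2
     (char_0 p chi1 Hd1 Hp) (char_0 q chi2 Hd2 Hq) Hu H1 H4) as F1.
  pose proof (lambert_regroup k q p b2 beta1 v _ A2 _ ltac:(lia) ltac:(lia) Pb2 Pbeta1
     b20 beta10 Hv H2 H3) as F2.
  destruct (sigma_exp_summable k (conj_char chi2) (conj_char chi1) v) as [G HG]; auto.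
  { intros m. now apply (conj_char_le1 q). }
  { intros m. now apply (conj_char_le1 p). }
  exists G. split; auto.
  assert (EG : (t1 * t2 * RtoC (e2 / INR q) * G)%C = (RtoC (INR (fact k) * INR q ^ k) * s)%C).
  { apply (CS_unique _ _ _ (CS_scal (t1 * t2 * RtoC (e2 / INR q))%C _ _ HG)).
    eapply CS_ext; [|exact F2]. intros n. cbv beta. rewrite sigma_chi_dsum.
    replace (dsum (fun d m => (RtoC (INR d ^ k) * b2 (Z.of_nat d) * beta1 (Z.of_nat m))%C) (S n))
      with (t1 * t2 * RtoC (e2 / INR q) * dsum (fun d m => (RtoC (INR d ^ k) * conj_char chi2 (Z.of_nat d) * conj_char chi1 (Z.of_nat m))%C) (S n))%C; [ring|].
    unfold dsum. rewrite <- csum_scal. apply csum_ext. intros d _. unfold b2, beta1. ring. }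
  assert (Hfk : 0 < INR (fact k)) by apply INR_fact_lt_0.
  assert (Hqk : 0 < INR q ^ k) by (apply pow_lt; lra).
  set (K2 := RtoC (INR (fact k) * INR q ^ k)) in *.
  assert (HK2 : K2 <> RtoC 0) by (apply RtoC_neq0, Rgt_not_eq, Rmult_lt_0_compat; auto).
  assert (Es : s = ((/ K2) * (t1 * t2 * RtoC (e2 / INR q) * G))%C)
    by (rewrite EG; field; auto).
  replace (t1 * t2 * RtoC (- (INR p ^ k / INR q ^ S k)) * eis_factor k p u * G)%C
    with (RtoC (INR (fact k) * INR p ^ k) * (RtoC e1 * eis_factor k p u * s))%C.
  - eapply CS_ext; [|exact F1]. intros n. cbv beta. now rewrite sigma_chi_dsum.
  - rewrite Es.
    (* The factorials k! from rows and columns cancel, q^(k+1) combines q^k with the 1/q of Fourier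
       inversion, and the minus sign is e1 e2. *)
    replace (RtoC (- (INR p ^ k / INR q ^ S k))) with
      (RtoC (INR (fact k) * INR p ^ k) * (RtoC e1 * ((/ K2) * RtoC (e2 / INR q))))%C.
    { ring. }
    unfold K2. rewrite <- RtoC_inv by (apply Rgt_not_eq, Rmult_lt_0_compat; auto).
    rewrite <- !RtoC_mult. f_equal. simpl pow.
    replace (INR (fact k) * INR p ^ k * (e1 * (/ (INR (fact k) * INR q ^ k) * (e2 / INR q)))) with
      ((e1 * e2) * (INR p ^ k / (INR q * INR q ^ k))) by (field; lra).
    rewrite S12. ring.
Qed.

(** * Improper integrals through antiderivatives *)

Lemma norm_C_R (c : C) : @norm R_AbsRing C_R_CompleteNormedModule c = Cmod c.
Proof.
  change (prod_norm (K := R_AbsRing) (U := R_NormedModule) (V := R_NormedModule) c = Cmod c).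
  unfold prod_norm, Cmod. f_equal.
  change (Rabs (fst c) ^ 2 + Rabs (snd c) ^ 2 = fst c ^ 2 + snd c ^ 2).
  now rewrite !pow2_abs.
Qed.

Lemma is_RInt_gen_antiderivative {V : CompleteNormedModule R_AbsRing} (f Psi : R -> V) (l0 l1 : V) :
  (forall x, 0 < x -> is_derive Psi x (f x)) -> (forall x, 0 < x -> continuous f x) ->
  filterlim Psi (at_right 0) (locally l0) -> filterlim Psi (Rbar_locally p_infty) (locally l1) ->
  is_RInt_gen f (at_right 0) (Rbar_locally p_infty) (minus l1 l0).
Proof.
  intros HD HC H0 H1 P HP.
  assert (HM : filterlim (fun ab : R * R => minus (Psi (snd ab)) (Psi (fst ab)))
     (filter_prod (at_right 0) (Rbar_locally p_infty)) (locally (minus l1 l0))).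
  { unfold minus. eapply filterlim_comp_2; [| |apply (@filterlim_plus R_AbsRing V l1 (opp l0))].
    - eapply filterlim_comp; [apply filterlim_snd|exact H1].
    - eapply filterlim_comp; [eapply filterlim_comp; [apply filterlim_fst|exact H0]|].
      apply (@filterlim_opp R_AbsRing V l0). }
  specialize (HM P HP). unfold filtermapi. unfold filtermap in HM.
  assert (HQ : filter_prod (at_right 0) (Rbar_locally p_infty) (fun ab : R * R => 0 < fst ab /\ 0 < snd ab)).
  { apply Filter_prod with (fun x => 0 < x) (fun x => 0 < x); [| |now auto].
    - exists (mkposreal 1 Rlt_0_1). intros y _ Hy. exact Hy.
    - exists 0. auto. }
  generalize (filter_and _ _ HM HQ). apply filter_imp. intros [a b] [Hp [Ha Hb]]. simpl in *.
  exists (minus (Psi b) (Psi a)). split; auto.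
  assert (Hm : 0 < Rmin a b) by (apply Rmin_glb_lt; auto).
  apply (is_RInt_derive Psi f); intros x Hx; [apply HD|apply HC]; lra.
Qed.

Definition antiderivative_on (f Psi : R -> C) (l0 l1 : C) : Prop :=
  (forall x, 0 < x -> @is_derive R_AbsRing C_R_NormedModule Psi x (f x)) /\
  (forall x, 0 < x -> @continuous R_UniformSpace C_UniformSpace f x) /\
  filterlim Psi (at_right 0) (@locally C_UniformSpace l0) /\
  filterlim Psi (Rbar_locally p_infty) (@locally C_UniformSpace l1).

(** With an antiderivative at hand, linearity and changes of variable become statements about [Psi]
    and its two end limits. *)
Definition integral_on (f : R -> C) (l : C) : Prop :=
  exists Psi l0 l1, antiderivative_on f Psi l0 l1 /\ l = (l1 - l0)%C.

Lemma integral_on_RInt_gen f l : integral_on f l ->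
  @is_RInt_gen C_R_CompleteNormedModule f (at_right 0) (Rbar_locally p_infty) l.
Proof.
  intros [Psi [l0 [l1 [[H1 [H2 [H3 H4]]] ->]]]].
  apply (@is_RInt_gen_antiderivative C_R_CompleteNormedModule f Psi l0 l1 H1 H2 H3 H4).
Qed.

Lemma integral_on_CInt f l : integral_on f l -> CInt_0_oo f = l.
Proof.
  intros H. unfold CInt_0_oo.
  apply (@is_RInt_gen_unique C_R_CompleteNormedModule (at_right 0) (Rbar_locally p_infty)).
  - apply Proper_StrongProper, at_right_proper_filter.
  - apply Proper_StrongProper, Rbar_locally_filter.
  - now apply integral_on_RInt_gen.
Qed.

Lemma integral_on_plus f g a b : integral_on f a -> integral_on g b ->
  integral_on (fun x => (f x + g x)%C) (a + b)%C.
Proof.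
  intros [P [p0 [p1 [[A1 [A2 [A3 A4]]] ->]]]] [Q [q0 [q1 [[B1 [B2 [B3 B4]]] ->]]]].
  exists (fun x => (P x + Q x)%C), (p0 + q0)%C, (p1 + q1)%C. split; [|ring].
  split; [|split; [|split]].
  - intros x Hx. apply (@is_derive_plus R_AbsRing C_R_NormedModule); auto.
  - intros x Hx. apply (@continuous_plus R_UniformSpace R_AbsRing C_R_NormedModule); auto.
  - eapply (filterlim_comp_2 _ _ (fun x y => (x + y)%C)); [exact A3|exact B3|].
    apply (@filterlim_plus R_AbsRing C_R_NormedModule).
  - eapply (filterlim_comp_2 _ _ (fun x y => (x + y)%C)); [exact A4|exact B4|].
    apply (@filterlim_plus R_AbsRing C_R_NormedModule).
Qed.

Lemma Cmult_is_linear (c : C) : @is_linear R_AbsRing C_R_NormedModule C_R_NormedModule (Cmult c).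
Proof.
  split.
  - intros x y. change ((c * (x + y))%C = (c * x + c * y)%C). ring.
  - intros k x. change ((c * (k * fst x, k * snd x)%R)%C = (k * fst (c * x)%C, k * snd (c * x)%C)).
    unfold Cmult; simpl. f_equal; ring.
  - exists (Cmod c + 1). split; [pose proof (Cmod_ge_0 c); lra|].
    intros x. rewrite !(norm_C_R : forall c, @norm R_AbsRing C_R_NormedModule c = Cmod c).
    rewrite Cmod_mult. pose proof (Cmod_ge_0 x). nra.
Qed.

Lemma Cmult_continuous (c z : C) : @continuous C_UniformSpace C_UniformSpace (Cmult c) z.
Proof.
  apply (@filterdiff_continuous R_AbsRing C_R_NormedModule C_R_NormedModule).
  exists (Cmult c). apply filterdiff_linear, Cmult_is_linear.
Qed.

Lemma is_derive_Cmult (c : C) (f : R -> C) x l :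
  @is_derive R_AbsRing C_R_NormedModule f x l ->
  @is_derive R_AbsRing C_R_NormedModule (fun y => (c * f y)%C) x (c * l)%C.
Proof.
  intros H. unfold is_derive in *.
  eapply filterdiff_ext_lin.
  - apply (filterdiff_comp' f (Cmult c) x _ (Cmult c) H).
    apply filterdiff_linear, Cmult_is_linear.
  - intros y. simpl. now rewrite (linear_scal _ (Cmult_is_linear c)).
Qed.

Lemma integral_on_scal c f a : integral_on f a -> integral_on (fun x => (c * f x)%C) (c * a)%C.
Proof.
  intros [P [p0 [p1 [[A1 [A2 [A3 A4]]] ->]]]].
  exists (fun x => (c * P x)%C), (c * p0)%C, (c * p1)%C. split; [|ring].
  split; [|split; [|split]].
  - intros x Hx. apply is_derive_Cmult; auto.
  - intros x Hx. apply (continuous_comp f (Cmult c)); auto. apply Cmult_continuous.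
  - eapply filterlim_comp; [exact A3|apply Cmult_continuous].
  - eapply filterlim_comp; [exact A4|apply Cmult_continuous].
Qed.

Lemma integral_on_psum (f : nat -> R -> C) a n : (forall i, integral_on (f i) (a i)) ->
  integral_on (fun x => psum (fun i => f i x) n) (psum a n).
Proof.
  intros H. induction n.
  (* The empty sum borrows its antiderivative from 0 times the first function. *)
  - simpl. pose proof (integral_on_scal (RtoC 0) _ _ (H O)) as T.
    rewrite Cmult_0_l in T. destruct T as [P [p0 [p1 [[A1 [A2 [A3 A4]]] E]]]].
    exists P, p0, p1. split; auto. split; [|split; [|split]]; auto.
    + intros x Hx. specialize (A1 x Hx). now rewrite Cmult_0_l in A1.
    + intros x Hx. apply continuous_const.
  - apply integral_on_plus; auto.
Qed.

(** * A dominating function with explicit antiderivative *)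

(** This is (w/(1+w))^d, rising from 0 to 1. Its derivative [gd] behaves like w^(d-1) at 0 and like
    w^(-2) at infinity and has integral 1, so a bound by K [gd] bounds the integral by K. *)
Definition Phi (d w : R) : R := exp (d * (ln w - ln (1 + w))).

Definition gd (d w : R) : R := d * Phi d w / (w * (1 + w)).

Lemma Phi_derive d w : 0 < w -> is_derive (Phi d) w (gd d w).
Proof.
  intros Hw. unfold gd, Phi. auto_derive; [lra|]. unfold Rminus. field. lra.
Qed.

Lemma gd_continuous d w : 0 < w -> continuous (gd d) w.
Proof.
  intros Hw. apply (@ex_derive_continuous R_AbsRing R_NormedModule).
  unfold gd, Phi. auto_derive. repeat split; try lra. nra.
Qed.

Lemma gd_pos d w : 0 < d -> 0 < w -> 0 < gd d w.
Proof.
  intros Hd Hw. unfold gd. apply Rdiv_lt_0_compat; [|nra].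
  apply Rmult_lt_0_compat; auto. apply exp_pos.
Qed.

Lemma gd_eq d w : 0 < w -> gd d w = d * (Rpower w (d - 1) * Rpower (1 + w) (- (d + 1))).
Proof.
  intros Hw. unfold gd, Phi, Rpower. rewrite <- exp_plus.
  replace ((d - 1) * ln w + - (d + 1) * ln (1 + w)) with
    (d * (ln w - ln (1 + w)) + (- ln w + - ln (1 + w))) by ring.
  rewrite (exp_plus (d * (ln w - ln (1 + w)))), (exp_plus (- ln w)), !exp_Ropp, !exp_ln by lra.
  field. lra.
Qed.

Lemma Phi_lim_0 d : 0 < d -> filterlim (Phi d) (at_right 0) (locally 0).
Proof.
  intros Hd. apply filterlim_locally. intros eps. pose proof (cond_pos eps) as He.
  assert (Hr : 0 < Rpower eps (/ d)) by apply exp_pos.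
  exists (mkposreal _ Hr). intros w Hw Hw0.
  change (Rabs (w - 0) < Rpower eps (/ d)) in Hw. rewrite Rminus_0_r, Rabs_pos_eq in Hw by lra.
  change (Rabs (Phi d w - 0) < eps). rewrite Rminus_0_r. unfold Phi. rewrite Rabs_pos_eq by apply Rlt_le, exp_pos.
  rewrite <- (exp_ln eps) by auto. apply exp_increasing.
  assert (H1 : ln w < / d * ln eps).
  { unfold Rpower in Hw. apply ln_increasing in Hw; auto. now rewrite ln_exp in Hw. }
  assert (H2 : 0 < ln (1 + w)) by (rewrite <- ln_1; apply ln_increasing; lra).
  assert (H3 : d * ln w < d * (/ d * ln eps)) by (apply Rmult_lt_compat_l; auto).
  rewrite <- Rmult_assoc, Rinv_r, Rmult_1_l in H3 by lra. nra.
Qed.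

Lemma Phi_lim_oo d : 0 < d -> filterlim (Phi d) (Rbar_locally p_infty) (locally 1).
Proof.
  intros Hd. apply filterlim_locally. intros eps. pose proof (cond_pos eps) as He.
  assert (Hr : 0 < d / eps) by (now apply Rdiv_lt_0_compat).
  exists (d / eps). intros w Hw.
  change (Rabs (Phi d w - 1) < eps).
  assert (Hw0 : 0 < w) by lra.
  assert (H2 : ln w < ln (1 + w)) by (apply ln_increasing; lra).
  assert (H3 : ln (1 + w) - ln w <= / w).
  { rewrite <- ln_div by lra. eapply Rle_trans; [apply ln_le_sub1, Rdiv_lt_0_compat; lra|].
    right. field. lra. }
  unfold Phi. set (y := d * (ln w - ln (1 + w))).
  assert (Hy : y < 0) by (unfold y; nra).
  assert (Hy2 : - y <= d / w) by (unfold y, Rdiv; nra).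
  assert (E1 : exp y < 1) by (rewrite <- exp_0; now apply exp_increasing).
  pose proof (exp_ineq1_le y) as E2.
  assert (E3 : d / w < eps).
  { apply Rmult_lt_reg_r with (w / eps); [now apply Rdiv_lt_0_compat|].
    replace (d / w * (w / eps)) with (d / eps) by (field; lra).
    replace (eps * (w / eps)) with w by (field; lra). auto. }
  apply Rabs_def1; lra.
Qed.

Lemma gd_integral d : 0 < d -> is_RInt_gen (gd d) (at_right 0) (Rbar_locally p_infty) 1.
Proof.
  intros Hd. replace 1 with (minus 1 0) by (unfold minus, plus, opp; simpl; ring).
  apply (@is_RInt_gen_antiderivative R_CompleteNormedModule (gd d) (Phi d)).
  - intros; now apply Phi_derive.
  - intros; now apply gd_continuous.
  - now apply Phi_lim_0.
  - now apply Phi_lim_oo.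
Qed.

Lemma integral_on_bound f l K d : 0 < d -> integral_on f l ->
  (forall w, 0 < w -> Cmod (f w) <= K * gd d w) -> Cmod l <= K.
Proof.
  intros Hd Hf HB. apply integral_on_RInt_gen in Hf.
  rewrite <- norm_C_R. replace K with (scal K 1) by (unfold scal; simpl; unfold mult; simpl; ring).
  apply (@RInt_gen_norm C_R_CompleteNormedModule (at_right 0) (Rbar_locally p_infty)
           (at_right_proper_filter 0) (Rbar_locally_filter p_infty) f (fun w => K * gd d w)); auto.
  - apply Filter_prod with (fun x => 0 < x < 1) (fun x => 1 < x).
    + exists (mkposreal 1 Rlt_0_1). intros y Hy Hy0.
      change (Rabs (y - 0) < 1) in Hy. rewrite Rminus_0_r, Rabs_pos_eq in Hy; lra.
    + now exists 1.
    + simpl. intros; lra.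
  - apply Filter_prod with (fun x => 0 < x) (fun x => 0 < x).
    + exists (mkposreal 1 Rlt_0_1). intros y _ Hy. exact Hy.
    + now exists 0.
    + simpl. intros a b Ha Hb x Hx. rewrite norm_C_R. apply HB. lra.
  - apply (@is_RInt_gen_scal R_NormedModule); [apply at_right_proper_filter|apply Rbar_locally_filter|].
    now apply gd_integral.
Qed.

(** Increments of the antiderivative based at 1 are at most K times increments of [Phi]. Since [Phi]
    has limits at both ends, the antiderivative satisfies the Cauchy criterion there. *)
Lemma integral_on_exists f K d : 0 < d ->
  (forall x, 0 < x -> @continuous R_UniformSpace C_UniformSpace f x) ->
  (forall w, 0 < w -> Cmod (f w) <= K * gd d w) -> exists l, integral_on f l.
Proof.
  intros Hd HC HB.
  assert (K0 : 0 <= K).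
  { pose proof (HB 1 Rlt_0_1) as H. pose proof (Cmod_ge_0 (f 1)). pose proof (gd_pos d 1 Hd Rlt_0_1). nra. }
  set (Psi := fun x => @RInt C_R_CompleteNormedModule f 1 x).
  assert (HI : forall x y, 0 < x -> 0 < y -> @ex_RInt C_R_CompleteNormedModule f x y).
  { intros x y Hx Hy. apply (@ex_RInt_continuous C_R_CompleteNormedModule). intros z Hz. apply HC.
    assert (0 < Rmin x y) by (apply Rmin_glb_lt; auto). lra. }
  assert (HP : forall x, 0 < x -> @is_derive R_AbsRing C_R_NormedModule Psi x (f x)).
  { intros x Hx. apply (@is_derive_RInt C_R_NormedModule f Psi 1 x); auto.
    exists (mkposreal x Hx). intros y Hy. change (Rabs (y - x) < x) in Hy. apply Rabs_def2 in Hy.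
    apply (@RInt_correct C_R_CompleteNormedModule). apply HI; lra. }
  assert (HL : forall x y, 0 < x -> x <= y -> Cmod (Psi y - Psi x) <= K * (Phi d y - Phi d x)).
  { intros x y Hx Hxy. rewrite <- norm_C_R.
    apply (@norm_RInt_le C_R_NormedModule f (fun w => K * gd d w) x y); auto.
    - intros w Hw. eapply Rle_trans; [right; apply norm_C_R|]. apply HB. lra.
    - apply (@is_RInt_derive C_R_CompleteNormedModule Psi f); rewrite Rmin_left, Rmax_right by lra; intros z Hz.
      + apply HP. lra.
      + apply HC. lra.
    - apply (@is_RInt_scal R_NormedModule (gd d) x y K (Phi d y - Phi d x)).
      apply (@is_RInt_derive R_CompleteNormedModule (Phi d) (gd d)); rewrite Rmin_left, Rmax_right by lra; intros z Hz.
      + apply Phi_derive. lra.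
      + apply gd_continuous. lra. }
  assert (HL2 : forall x y, 0 < x -> 0 < y -> Cmod (Psi y - Psi x) <= K * Rabs (Phi d y - Phi d x)).
  { intros x y Hx Hy. destruct (Rle_lt_dec x y).
    - eapply Rle_trans; [now apply HL|]. apply Rmult_le_compat_l; auto. apply Rle_abs.
    - rewrite Cmod_sub_sym, Rabs_minus_sym. eapply Rle_trans; [apply HL; lra|].
      apply Rmult_le_compat_l; auto. apply Rle_abs. }
  assert (HCau : forall (F : (R -> Prop) -> Prop) c, ProperFilter F -> F (fun x => 0 < x) ->
     filterlim (Phi d) F (locally c) -> exists l, filterlim Psi F (@locally C_UniformSpace l)).
  { intros F c PF Fpos HF.
    apply (@filterlim_locally_cauchy R C_R_CompleteNormedModule F PF Psi). intros eps.
    assert (He : 0 < eps / (2 * (K + 1))) by (apply Rdiv_lt_0_compat; [apply cond_pos|lra]).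
    pose proof (proj1 (filterlim_locally (Phi d) c) HF (mkposreal _ He)) as HF2.
    exists (fun x => 0 < x /\ ball c (mkposreal _ He) (Phi d x)). split; [now apply filter_and|].
    intros u v [Hu Bu] [Hv Bv].
    apply C_NormedModule_mixin_compat1. change (Cmod (Psi v - Psi u) < eps).
    eapply Rle_lt_trans; [now apply HL2|].
    change (Rabs (Phi d u - c) < eps / (2 * (K + 1))) in Bu.
    change (Rabs (Phi d v - c) < eps / (2 * (K + 1))) in Bv.
    assert (T : Rabs (Phi d v - Phi d u) <= 2 * (eps / (2 * (K + 1)))).
    { replace (Phi d v - Phi d u) with ((Phi d v - c) - (Phi d u - c)) by ring.
      eapply Rle_trans; [apply Rabs_triang|]. rewrite Rabs_Ropp. lra. }
    pose proof (cond_pos eps).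
    apply Rle_lt_trans with (K * (2 * (eps / (2 * (K + 1))))); [now apply Rmult_le_compat_l|].
    replace (K * (2 * (eps / (2 * (K + 1))))) with (eps * (K / (K + 1))) by (field; lra).
    assert (K / (K + 1) < 1).
    { apply Rmult_lt_reg_r with (K + 1); [lra|]. unfold Rdiv. rewrite Rmult_assoc, Rinv_l; lra. }
    nra. }
  destruct (HCau (at_right 0) 0) as [l0 H0].
  { apply at_right_proper_filter. }
  { exists (mkposreal 1 Rlt_0_1). intros y _ Hy. exact Hy. }
  { now apply Phi_lim_0. }
  destruct (HCau (Rbar_locally p_infty) 1) as [l1 H1].
  { apply Rbar_locally_filter. }
  { now exists 0. }
  { now apply Phi_lim_oo. }
  exists (l1 - l0)%C, Psi, l0, l1. split; auto. split; [|split; [|split]]; auto.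
Qed.

(** * Gamma and Bessel integrals *)

Lemma locally_pos x : 0 < x -> locally x (fun y => 0 < y).
Proof.
  intros Hx. exists (mkposreal x Hx). intros y Hy. change (Rabs (y - x) < x) in Hy.
  apply Rabs_def2 in Hy. lra.
Qed.

Lemma integral_on_ext f g l : (forall x, 0 < x -> f x = g x) -> integral_on f l -> integral_on g l.
Proof.
  intros E [P [p0 [p1 [[A1 [A2 [A3 A4]]] H]]]].
  exists P, p0, p1. split; auto. split; [|split; [|split]]; auto.
  - intros x Hx. rewrite <- E by auto. now apply A1.
  - intros x Hx. apply (continuous_ext_loc g f x); auto.
    generalize (locally_pos x Hx). apply filter_imp. intros; now apply E.
Qed.

Lemma continuous_pair (f g : R -> R) x : continuous f x -> continuous g x ->
  @continuous R_UniformSpace C_UniformSpace (fun y => (f y, g y)) x.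
Proof.
  intros Hf Hg. apply filterlim_locally. intros eps.
  pose proof (proj1 (filterlim_locally f (f x)) Hf eps) as A.
  pose proof (proj1 (filterlim_locally g (g x)) Hg eps) as B.
  generalize (filter_and _ _ A B). apply filter_imp. intros y [H1 H2]. split; auto.
Qed.

(** One family for both sides: B = 0 gives the Gamma integrand, B = n the Bessel integrand. *)
Definition Fc (s : C) (A B w : R) : C :=
  (cpow w (s - 1)%C * RtoC (exp (- (A * w) - B / w)))%C.

Lemma Fc_eq s A B w : Fc s A B w =
  (exp ((Re s - 1) * ln w + (- (A * w) - B / w)) * cos (Im s * ln w),
   exp ((Re s - 1) * ln w + (- (A * w) - B / w)) * sin (Im s * ln w)).
Proof.
  unfold Fc, cpow, Cexp. rewrite exp_plus.
  replace (Re ((s - 1) * RtoC (ln w))%C) with ((Re s - 1) * ln w)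
    by (unfold Cmult, Cminus, Cplus, Copp, RtoC, Re; simpl; ring).
  replace (Im ((s - 1) * RtoC (ln w))%C) with (Im s * ln w)
    by (unfold Cmult, Cminus, Cplus, Copp, RtoC, Im; simpl; ring).
  unfold Cmult, RtoC; cbn [fst snd]. f_equal; ring.
Qed.

Lemma Fc_continuous s A B w : 0 < w -> @continuous R_UniformSpace C_UniformSpace (Fc s A B) w.
Proof.
  intros Hw.
  apply (continuous_ext (fun w => (exp ((Re s - 1) * ln w + (- (A * w) - B / w)) * cos (Im s * ln w),
   exp ((Re s - 1) * ln w + (- (A * w) - B / w)) * sin (Im s * ln w))));
    [intros y; now rewrite Fc_eq|].
  apply (continuous_pair (fun w => exp ((Re s - 1) * ln w + (- (A * w) - B / w)) * cos (Im s * ln w))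
    (fun w => exp ((Re s - 1) * ln w + (- (A * w) - B / w)) * sin (Im s * ln w)));
    apply (@ex_derive_continuous R_AbsRing R_NormedModule);
    auto_derive; repeat split; lra.
Qed.

Lemma Cmod_cpow r s : Cmod (cpow r s) = Rpower r (Re s).
Proof.
  unfold cpow. rewrite Cmod_Cexp. unfold Rpower. f_equal.
  unfold Cmult, RtoC, Re; simpl. ring.
Qed.

Lemma Cmod_Fc s A B w : Cmod (Fc s A B w) = Rpower w (Re s - 1) * exp (- (A * w) - B / w).
Proof.
  unfold Fc. rewrite Cmod_mult, Cmod_cpow, Cmod_R, Rabs_pos_eq by apply Rlt_le, exp_pos.
  reflexivity.
Qed.

Lemma power_exp_dominated c b d : 0 < d -> d <= c -> 0 < b ->
  exists K, 0 < K /\ forall w, 0 < w -> Rpower w (c - 1) * exp (- (b * w)) <= K * gd d w.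
Proof.
  intros Hd Hc Hb.
  (* Writing c + 1 = (c - d) + (d + 1), the first part absorbs the surplus power w^(c-d) and the
     second is the decay of [gd]. The exponential is compared at 1 + w rather than w, so nothing is
     lost near 0. *)
  destruct (exp_neg_le (c + 1) ltac:(lra)) as [C [C0 HC]].
  set (K := exp b * C * Rpower b (- (c + 1))).
  assert (K0 : 0 < K) by (unfold K; repeat apply Rmult_lt_0_compat; auto; apply exp_pos).
  exists (K / d). split; [now apply Rdiv_lt_0_compat|]. intros w Hw.
  rewrite gd_eq by auto.
  replace (K / d * (d * (Rpower w (d - 1) * Rpower (1 + w) (- (d + 1))))) with
    (Rpower w (d - 1) * (K * Rpower (1 + w) (- (d + 1)))) by (field; lra).
  replace (Rpower w (c - 1)) with (Rpower w (d - 1) * Rpower w (c - d))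
    by (rewrite <- Rpower_plus; f_equal; ring).
  rewrite Rmult_assoc. apply Rmult_le_compat_l; [apply Rlt_le, exp_pos|].
  specialize (HC (b * (1 + w)) ltac:(apply Rmult_lt_0_compat; lra)).
  rewrite <- Rpower_mult_distr in HC by lra.
  replace (exp (- (b * w))) with (exp b * exp (- (b * (1 + w)))) by (rewrite <- exp_plus; f_equal; ring).
  assert (P1 : Rpower w (c - d) <= Rpower (1 + w) (c - d)) by (apply Rle_Rpower_l; lra).
  apply Rle_trans with (Rpower (1 + w) (c - d) *
    (exp b * (C * (Rpower b (- (c + 1)) * Rpower (1 + w) (- (c + 1)))))).
  - apply Rmult_le_compat; auto.
    + apply Rlt_le, exp_pos.
    + apply Rmult_le_pos; apply Rlt_le, exp_pos.
    + apply Rmult_le_compat_l; auto. apply Rlt_le, exp_pos.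
  - right. unfold K.
    replace (- (d + 1)) with ((c - d) + - (c + 1)) by ring. rewrite Rpower_plus. ring.
Qed.

Lemma Fc_integrable s A B : 0 < Re s -> 0 < A -> 0 <= B -> exists l, integral_on (Fc s A B) l.
Proof.
  intros Hs HA HB.
  destruct (power_exp_dominated (Re s) A (Re s) Hs ltac:(lra) HA) as [K [K0 HK]].
  apply (integral_on_exists (Fc s A B) K (Re s) Hs).
  - intros; now apply Fc_continuous.
  - intros w Hw. rewrite Cmod_Fc. eapply Rle_trans; [|now apply HK].
    apply Rmult_le_compat_l; [apply Rlt_le, exp_pos|].
    assert (0 <= B / w) by (apply Rmult_le_pos; auto; apply Rlt_le; now apply Rinv_0_lt_compat).
    destruct (Req_dec (B / w) 0) as [->|N]; [rewrite Rminus_0_r; lra|].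
    apply Rlt_le, exp_increasing. lra.
Qed.

Lemma cpow_mult r r' s : 0 < r -> 0 < r' -> cpow (r * r') s = (cpow r s * cpow r' s)%C.
Proof.
  intros H H'. unfold cpow. rewrite ln_mult, RtoC_plus, <- Cexp_plus by auto. f_equal. ring.
Qed.

Lemma cpow_plus r s t : cpow r (s + t)%C = (cpow r s * cpow r t)%C.
Proof. unfold cpow. rewrite <- Cexp_plus. f_equal. ring. Qed.

Lemma cpow_1 r : 0 < r -> cpow r (RtoC 1) = RtoC r.
Proof. intros H. unfold cpow. rewrite Cmult_1_l, Cexp_RtoC, exp_ln; auto. Qed.

Lemma cpow_neq0 r s : cpow r s <> RtoC 0.
Proof. apply Cexp_neq0. Qed.

Lemma cpow_opp r s : cpow r (- s)%C = (/ cpow r s)%C.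
Proof. unfold cpow. rewrite <- Cexp_opp. f_equal. ring. Qed.

Lemma cpow_pred r s : 0 < r -> (RtoC r * cpow r (s - 1)%C)%C = cpow r s.
Proof.
  intros H. rewrite <- (cpow_1 r) at 1 by auto. rewrite <- cpow_plus. f_equal. ring.
Qed.

Lemma scal_R_C (r : R) (z : C) : @scal R_AbsRing C_R_NormedModule r z = (RtoC r * z)%C.
Proof.
  change ((r * fst z, r * snd z) = (RtoC r * z)%C). unfold Cmult, RtoC; simpl. f_equal; ring.
Qed.

Lemma filterlim_scale_0 A : 0 < A -> filterlim (fun w => A * w) (at_right 0) (at_right 0).
Proof.
  intros HA P [eps HP]. assert (He : 0 < eps / A) by (apply Rdiv_lt_0_compat; auto; apply cond_pos).
  exists (mkposreal _ He). intros w Hw Hw0.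
  change (Rabs (w - 0) < eps / A) in Hw. rewrite Rminus_0_r, Rabs_pos_eq in Hw by lra.
  assert (0 < A * w) by now apply Rmult_lt_0_compat.
  apply HP; auto.
  change (Rabs (A * w - 0) < eps). rewrite Rminus_0_r, Rabs_pos_eq by lra.
  apply Rmult_lt_reg_r with (/ A); [now apply Rinv_0_lt_compat|].
  rewrite (Rmult_comm A w), Rmult_assoc, Rinv_r, Rmult_1_r by lra. exact Hw.
Qed.

Lemma filterlim_scale_oo A : 0 < A -> filterlim (fun w => A * w) (Rbar_locally p_infty) (Rbar_locally p_infty).
Proof.
  intros HA P [M HM]. exists (M / A). intros w Hw. apply HM.
  apply Rmult_lt_reg_r with (/ A); [now apply Rinv_0_lt_compat|].
  replace (A * w * / A) with w by (field; lra). exact Hw.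
Qed.

Lemma Fc_scale s A l : 0 < A -> integral_on (Fc s 1 0) l ->
  integral_on (Fc s A 0) (cpow A (- s)%C * l)%C.
Proof.
  intros HA [P [p0 [p1 [[A1 [A2 [A3 A4]]] ->]]]].
  exists (fun w => (cpow A (- s)%C * P (A * w)%R)%C), (cpow A (- s)%C * p0)%C, (cpow A (- s)%C * p1)%C.
  split; [|ring]. split; [|split; [|split]].
  - intros w Hw.
    assert (HAw : 0 < A * w) by now apply Rmult_lt_0_compat.
    replace (Fc s A 0 w) with (cpow A (- s)%C * (@scal R_AbsRing C_R_NormedModule A (Fc s 1 0 (A * w))))%C.
    + apply is_derive_Cmult. apply (@is_derive_comp R_AbsRing C_R_NormedModule P (fun w => A * w)); auto.
      auto_derive; auto. ring.
    + rewrite scal_R_C. unfold Fc. rewrite cpow_mult by auto.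
      replace (- (1 * (A * w)) - 0 / (A * w)) with (- (A * w) - 0 / w) by (field; lra).
      transitivity (cpow A (- s)%C * (RtoC A * cpow A (s - 1)%C) * (cpow w (s - 1)%C * RtoC (exp (- (A * w) - 0 / w))))%C; [ring|].
      rewrite cpow_pred, cpow_opp by auto. field. apply cpow_neq0.
  - intros; now apply Fc_continuous.
  - eapply filterlim_comp; [|apply Cmult_continuous].
    eapply filterlim_comp; [now apply filterlim_scale_0|exact A3].
  - eapply filterlim_comp; [|apply Cmult_continuous].
    eapply filterlim_comp; [now apply filterlim_scale_oo|exact A4].
Qed.

Lemma CGamma_scale s A : 0 < Re s -> 0 < A ->
  integral_on (Fc s A 0) (cpow A (- s)%C * CGamma s)%C.
Proof.
  intros Hs HA. destruct (Fc_integrable s 1 0 Hs Rlt_0_1 ltac:(lra)) as [l Hl].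
  replace (CGamma s) with l; [now apply Fc_scale|].
  symmetry. unfold CGamma. apply integral_on_CInt.
  eapply integral_on_ext; [|exact Hl]. intros x Hx. unfold Fc. do 3 f_equal. field. lra.
Qed.

Lemma filterlim_exp_oo c : 0 < c -> filterlim (fun t => c * exp t) (Rbar_locally p_infty) (Rbar_locally p_infty).
Proof.
  intros Hc. eapply filterlim_comp; [|now apply filterlim_scale_oo].
  intros P [M HM]. exists M. intros t Ht. apply HM. pose proof (exp_ineq1_le t). lra.
Qed.

Lemma filterlim_exp_opp c : 0 < c -> filterlim (fun t => c * exp (- t)) (Rbar_locally p_infty) (at_right 0).
Proof.
  intros Hc. eapply filterlim_comp; [|now apply filterlim_scale_0].
  intros P [eps HP]. pose proof (cond_pos eps) as He. exists (/ eps). intros t Ht. apply HP; [|apply exp_pos].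
  change (Rabs (exp (- t) - 0) < eps). rewrite Rminus_0_r, Rabs_pos_eq by apply Rlt_le, exp_pos.
  assert (0 < / eps) by now apply Rinv_0_lt_compat.
  rewrite exp_Ropp, <- (Rinv_inv eps). apply Rinv_lt_contravar.
  - apply Rmult_lt_0_compat; [lra|apply exp_pos].
  - pose proof (exp_ineq1_le t). lra.
Qed.

(** The point c = z/(2b) is where b w and n/w balance, both being z/2; at w = c e^y the exponent b w
    + n/w becomes z cosh y. The two signs y = t and y = -t add up to the hyperbolic cosine of nu
    t. *)
Lemma bessel_integrand nu b n z t : 0 < b -> 0 < z -> z * z = 4 * b * n ->
  let c := z / (2 * b) in
  (RtoC (/ 2) * cpow c (- nu)%C * (RtoC (c * exp t) * Fc nu b n (c * exp t) + RtoC (c * exp (- t)) * Fc nu b n (c * exp (- t))))%C =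
  (RtoC (exp (- (z * cosh t))) * Ccosh (nu * RtoC t)%C)%C.
Proof.
  intros Hb Hz E c. assert (Hc : 0 < c) by (unfold c; apply Rdiv_lt_0_compat; lra).
  assert (G : forall y, (RtoC (c * exp y) * Fc nu b n (c * exp y))%C =
     (cpow c nu * Cexp (nu * RtoC y)%C * RtoC (exp (- (z * cosh y))))%C).
  { intros y. unfold Fc. pose proof (exp_pos y) as Hy.
    rewrite Cmult_assoc, cpow_pred by now apply Rmult_lt_0_compat.
    rewrite cpow_mult by auto. unfold cpow at 2. rewrite ln_exp. do 3 f_equal.
    unfold cosh. rewrite exp_Ropp. unfold c.
    replace n with (z * z / (4 * b)) by (rewrite E; field; lra). field. lra. }
  rewrite !G. unfold Ccosh.
  replace (cosh (- t)) with (cosh t) by (unfold cosh; rewrite Ropp_involutive; f_equal; ring).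
  replace (nu * RtoC (- t))%C with (- (nu * RtoC t))%C by (rewrite RtoC_opp; ring).
  rewrite cpow_opp. field. apply cpow_neq0.
Qed.

Lemma BesselK_integral nu b n z l : 0 < b -> 0 < z -> z * z = 4 * b * n ->
  integral_on (Fc nu b n) l ->
  BesselK nu z = (RtoC (/ 2) * cpow (z / (2 * b)) (- nu)%C * l)%C.
Proof.
  intros Hb Hz E [P [p0 [p1 [[A1 [A2 [A3 A4]]] ->]]]].
  set (c := z / (2 * b)). assert (Hc : 0 < c) by (unfold c; apply Rdiv_lt_0_compat; lra).
  unfold BesselK. apply integral_on_CInt.
  apply (integral_on_ext (fun t => (RtoC (/ 2) * cpow c (- nu)%C * (RtoC (c * exp t) * Fc nu b n (c * exp t) + RtoC (c * exp (- t)) * Fc nu b n (c * exp (- t))))%C)).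
  { intros t _. apply (bessel_integrand nu b n z t Hb Hz E). }
  apply integral_on_scal.
  (* As t runs over the half line, c e^t covers the part above c and c e^(-t) the part below it; the
     difference starts at 0 and tends to the full integral. *)
  exists (fun t => (P (c * exp t)%R - P (c * exp (- t))%R)%C), (RtoC 0), (p1 - p0)%C.
  split; [|ring].
  assert (Hp : forall t, 0 < c * exp t) by (intros; apply Rmult_lt_0_compat; auto; apply exp_pos).
  assert (D1 : forall t, @is_derive R_AbsRing C_R_NormedModule (fun t => P (c * exp t)%R) t
      (RtoC (c * exp t) * Fc nu b n (c * exp t))%C).
  { intros t. rewrite <- scal_R_C.
    apply (@is_derive_comp R_AbsRing C_R_NormedModule P (fun w => c * exp w)); auto.
    auto_derive; auto. ring. }
  assert (D2 : forall t, @is_derive R_AbsRing C_R_NormedModule (fun t => P (c * exp (- t))%R) t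
      (RtoC (- (c * exp (- t))) * Fc nu b n (c * exp (- t)))%C).
  { intros t. rewrite <- scal_R_C.
    apply (@is_derive_comp R_AbsRing C_R_NormedModule P (fun w => c * exp (- w))); auto.
    auto_derive; auto. ring. }
  assert (Cm : forall (F : (R -> Prop) -> Prop) (f g : R -> C) a b', Filter F ->
     filterlim f F (@locally C_UniformSpace a) -> filterlim g F (@locally C_UniformSpace b') ->
     filterlim (fun t => (f t - g t)%C) F (@locally C_UniformSpace (a - b')%C)).
  { intros F f g a b' FF Hf Hg. unfold Cminus.
    eapply (filterlim_comp_2 _ _ (fun x y => (x + y)%C)); [exact Hf| |apply (@filterlim_plus R_AbsRing C_R_NormedModule)].
    eapply filterlim_comp; [exact Hg|apply (@filterlim_opp R_AbsRing C_R_NormedModule)]. }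
  split; [|split; [|split]].
  - intros t _.
    replace (_ + _)%C with (RtoC (c * exp t) * Fc nu b n (c * exp t) - RtoC (- (c * exp (- t))) * Fc nu b n (c * exp (- t)))%C by (rewrite RtoC_opp; ring).
    apply (@is_derive_minus R_AbsRing C_R_NormedModule); auto.
  - intros t _.
    assert (Cs : forall g : R -> R, (forall t, 0 < g t) -> (forall t, ex_derive g t) ->
       @continuous R_UniformSpace C_UniformSpace (fun t => (RtoC (g t) * Fc nu b n (g t))%C) t).
    { intros g Hg Dg.
      apply (continuous_ext (fun t => @scal R_AbsRing C_R_NormedModule (g t) (Fc nu b n (g t)))).
      { intros y. apply scal_R_C. }
      assert (Cg : continuous g t) by (apply (@ex_derive_continuous R_AbsRing R_NormedModule); auto).
      apply (@continuous_scal R_UniformSpace R_AbsRing C_R_NormedModule); auto.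
      apply (continuous_comp g (Fc nu b n)); auto. }
    apply (@continuous_plus R_UniformSpace R_AbsRing C_R_NormedModule);
      [apply (Cs (fun t => c * exp t))|apply (Cs (fun t => c * exp (- t)))]; auto; intros y; auto_derive; auto.
  - replace (RtoC 0) with (P (c * exp 0)%R - P (c * exp (- 0))%R)%C by (rewrite Ropp_0; ring).
    apply Cm; [apply at_right_proper_filter| |].
    + eapply filterlim_filter_le_1; [apply filter_le_within|].
      apply (@ex_derive_continuous R_AbsRing C_R_NormedModule (fun t => P (c * exp t)%R) 0). eexists; apply D1.
    + eapply filterlim_filter_le_1; [apply filter_le_within|].
      apply (@ex_derive_continuous R_AbsRing C_R_NormedModule (fun t => P (c * exp (- t))%R) 0). eexists; apply D2.
  - apply Cm; [apply Rbar_locally_filter| |].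
    + eapply filterlim_comp; [now apply filterlim_exp_oo|exact A4].
    + eapply filterlim_comp; [now apply filterlim_exp_opp|exact A3].
Qed.

(* Only partial sums are integrated, so no regularity of the limit functions is needed. *)
Lemma integral_series_compare (f h : nat -> R -> C) (If Ih : nat -> C) (M : nat -> R) Kf Kh d c Lh :
  0 < d -> ex_series M ->
  (forall n, integral_on (f n) (If n)) -> (forall n, integral_on (h n) (Ih n)) ->
  (forall n w, 0 < w -> Cmod (f n w) <= Kf * gd d w * M n) ->
  (forall n w, 0 < w -> Cmod (h n w) <= Kh * gd d w * M n) ->
  (forall w, 0 < w -> exists G, CS (fun n => h n w) G /\ CS (fun n => f n w) (c * G)%C) ->
  CS Ih Lh -> CS If (c * Lh)%C.
Proof.
  intros Hd HM HIf HIh Bf Bh HG HL.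
  set (T := fun N => Series M - rsum M N).
  assert (HT : is_lim_seq T 0) by now apply rsum_lim.
  set (K := Kf + Cmod c * Kh).
  (* The full sums satisfy the identity pointwise in w, so the difference of partial sums is a
     difference of two tails, dominated by [gd] times a quantity tending to 0. *)
  assert (HB : forall N, Cmod (psum If N - c * psum Ih N) <= K * T N).
  { intros N.
    assert (HD : integral_on (fun w => (psum (fun n => f n w) N + (- c) * psum (fun n => h n w) N)%C)
       (psum If N + (- c) * psum Ih N)%C).
    { apply integral_on_plus; [|apply integral_on_scal]; now apply integral_on_psum. }
    replace (_ - _)%C with (psum If N + (- c) * psum Ih N)%C by ring.
    apply (integral_on_bound _ _ _ d Hd HD). intros w Hw.
    destruct (HG w Hw) as [G [G1 G2]].
    pose proof (CS_tail_le (fun n => f n w) (fun n => Kf * gd d w * M n) _ N (fun n => Bf n w Hw)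
      (ex_series_Rscal _ _ HM) G2) as T1.
    pose proof (CS_tail_le (fun n => h n w) (fun n => Kh * gd d w * M n) _ N (fun n => Bh n w Hw)
      (ex_series_Rscal _ _ HM) G1) as T2.
    rewrite Series_scal_l, rsum_scal in T1, T2.
    replace (_ + _)%C with (c * (G - psum (fun n => h n w) N) - (c * G - psum (fun n => f n w) N))%C by ring.
    eapply Rle_trans; [apply Cmod_minus_le|]. rewrite Cmod_mult.
    pose proof (Cmod_ge_0 c) as C0.
    assert (T3 : Cmod c * Cmod (G - psum (fun n => h n w) N) <= Cmod c * (Kh * gd d w * Series M - Kh * gd d w * rsum M N))
      by (apply Rmult_le_compat_l; auto).
    unfold K, T. lra. }
  unfold CS in *.
  replace (c * Lh)%C with (0 + c * Lh)%C by ring.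
  apply Clim_ext with (fun N => (psum If N - c * psum Ih N + c * psum Ih N)%C).
  { intros N. ring. }
  apply Clim_plus; [|now apply Clim_scal].
  apply lim0_squeeze with (fun N => K * T N).
  - intros N. split; [apply Cmod_ge_0|].
    replace (psum If N - c * psum Ih N - 0)%C with
      (psum If N - c * psum Ih N)%C by ring. apply HB.
  - replace (Finite 0) with (Finite (K * 0)) by (f_equal; ring).
    apply is_lim_seq_mult'; auto. apply is_lim_seq_const.
Qed.

(** * Uniform bounds, the constant, and the summation formula *)

Lemma Ci_pow_odd j : (Ci ^ S (2 * j))%C = (RtoC ((-1) ^ j) * Ci)%C.
Proof.
  induction j; [simpl; ring|].
  replace (S (2 * S j)) with (S (S (S (2 * j)))) by lia.
  change (Ci ^ S (S (S (2 * j))))%C with (Ci * (Ci * Ci ^ S (2 * j)))%C.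
  rewrite IHj, Cmult_assoc.
  replace (Ci * Ci)%C with (RtoC (-1)) by (unfold Cmult, Ci, RtoC; simpl; f_equal; ring).
  rewrite Cmult_assoc, <- RtoC_mult. reflexivity.
Qed.

Lemma eis_factor_even k p u : Nat.Even k ->
  eis_factor k p u = (RtoC ((-1) ^ (k / 2) * (2 * PI / (INR p * u)) ^ S k) * Ci)%C.
Proof.
  intros [j ->]. unfold eis_factor.
  rewrite Cpow_mult_distr, Ci_pow_odd, <- RtoC_pow.
  replace (2 * j / 2)%nat with j by (rewrite Nat.mul_comm, Nat.div_mul; lia).
  rewrite RtoC_mult. ring.
Qed.

(** The bound e^(-n/w) <= C (n/w)^(-kap) buys decay in n for a growth w^kap, which e^(-b w)
    absorbs. *)
Lemma bessel_side_bound nu b k : 0 < Re nu -> 0 < b ->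
  exists K, forall n w, 0 < w ->
    Cmod (Fc nu b (INR (S n)) w) <= K * gd (Re nu / 2) w * Rpower (INR (S n)) (- (INR k + 1 + Re nu / 2)).
Proof.
  intros Hn Hb. pose proof (pos_INR k) as Hk. set (kap := INR k + 1 + Re nu / 2).
  destruct (exp_neg_le kap ltac:(unfold kap; lra)) as [C [C0 HC]].
  destruct (power_exp_dominated (Re nu + kap) b (Re nu / 2)) as [K [K0 HK]]; try (unfold kap; lra).
  exists (C * K). intros n w Hw.
  assert (A : 0 < INR (S n)) by (apply lt_0_INR; lia).
  rewrite Cmod_Fc. unfold Rminus at 2. rewrite exp_plus.
  specialize (HC (INR (S n) / w) ltac:(now apply Rdiv_lt_0_compat)).
  unfold Rdiv in HC at 2. rewrite <- Rpower_mult_distr in HC by (auto; now apply Rinv_0_lt_compat).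
  assert (E : Rpower (/ w) (- kap) = Rpower w kap).
  { unfold Rpower. rewrite ln_Rinv by auto. f_equal. ring. }
  rewrite E in HC. specialize (HK w Hw).
  replace (Rpower w (Re nu + kap - 1)) with (Rpower w (Re nu - 1) * Rpower w kap) in HK
    by (rewrite <- Rpower_plus; f_equal; ring).
  assert (P1 : 0 < Rpower w (Re nu - 1)) by apply exp_pos.
  assert (P2 : 0 < exp (- (b * w))) by apply exp_pos.
  assert (P3 : 0 < Rpower (INR (S n)) (- kap)) by apply exp_pos.
  apply Rle_trans with (Rpower w (Re nu - 1) * (exp (- (b * w)) * (C * (Rpower (INR (S n)) (- kap) * Rpower w kap)))).
  - apply Rmult_le_compat_l; [lra|]. apply Rmult_le_compat_l; lra.
  - replace (Rpower w (Re nu - 1) * (exp (- (b * w)) * (C * (Rpower (INR (S n)) (- kap) * Rpower w kap))))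
      with (C * Rpower (INR (S n)) (- kap) * (Rpower w (Re nu - 1) * Rpower w kap * exp (- (b * w)))) by ring.
    replace (C * K * gd (Re nu / 2) w * Rpower (INR (S n)) (- kap)) with
      (C * Rpower (INR (S n)) (- kap) * (K * gd (Re nu / 2) w)) by ring.
    apply Rmult_le_compat_l; auto. apply Rmult_le_pos; lra.
Qed.

(** Here the decay in n costs w^(-kap), a singularity at 0. The power w^(Re nu + k) reduces it to
    w^(Re nu / 2 - 1), still integrable because only half of Re nu was spent. *)
Lemma gamma_side_bound nu b c k : 0 < Re nu -> 0 < b -> 0 < c ->
  exists K, forall n w, 0 < w ->
    Cmod (Fc (nu + RtoC (INR k + 1))%C (b + c * INR (S n)) 0 w) <=
    K * gd (Re nu / 2) w * Rpower (INR (S n)) (- (INR k + 1 + Re nu / 2)).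
Proof.
  intros Hn Hb Hc. pose proof (pos_INR k) as Hk. set (kap := INR k + 1 + Re nu / 2).
  destruct (exp_neg_le kap ltac:(unfold kap; lra)) as [C [C0 HC]].
  destruct (power_exp_dominated (Re nu / 2) b (Re nu / 2)) as [K [K0 HK]]; try lra.
  exists (C * Rpower c (- kap) * K). intros n w Hw.
  assert (A : 0 < INR (S n)) by (apply lt_0_INR; lia).
  assert (Acw : 0 < c * INR (S n)) by now apply Rmult_lt_0_compat.
  rewrite Cmod_Fc.
  replace (Re (nu + RtoC (INR k + 1))%C - 1) with (Re nu + INR k)
    by (unfold Cplus, RtoC, Re; simpl; ring).
  replace (- ((b + c * INR (S n)) * w) - 0 / w) with (- (b * w) + - (c * INR (S n) * w)) by (field; lra).
  rewrite exp_plus.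
  specialize (HC (c * INR (S n) * w) ltac:(now apply Rmult_lt_0_compat)).
  rewrite <- !Rpower_mult_distr in HC by auto. specialize (HK w Hw).
  replace (Rpower w (Re nu / 2 - 1)) with (Rpower w (Re nu + INR k) * Rpower w (- kap)) in HK
    by (rewrite <- Rpower_plus; f_equal; unfold kap; field).
  set (X := Rpower w (Re nu + INR k)) in *. set (Y := exp (- (b * w))) in *.
  assert (P1 : 0 < X) by apply exp_pos.
  assert (P2 : 0 < Y) by apply exp_pos.
  assert (P3 : 0 < Rpower (INR (S n)) (- kap)) by apply exp_pos.
  assert (P4 : 0 < Rpower c (- kap)) by apply exp_pos.
  apply Rle_trans with (X * (Y * (C * (Rpower c (- kap) * Rpower (INR (S n)) (- kap) * Rpower w (- kap))))).
  - apply Rmult_le_compat_l; [lra|]. apply Rmult_le_compat_l; lra.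
  - replace (X * (Y * (C * (Rpower c (- kap) * Rpower (INR (S n)) (- kap) * Rpower w (- kap)))))
      with (C * Rpower c (- kap) * Rpower (INR (S n)) (- kap) * (X * Rpower w (- kap) * Y)) by ring.
    replace (C * Rpower c (- kap) * K * gd (Re nu / 2) w * Rpower (INR (S n)) (- kap)) with
      (C * Rpower c (- kap) * Rpower (INR (S n)) (- kap) * (K * gd (Re nu / 2) w)) by ring.
    apply Rmult_le_compat_l; auto. repeat apply Rmult_le_pos; lra.
Qed.

Lemma sigma_shifted_summable k chi1 chi2 B nu : (forall m, Cmod (chi1 m) <= 1) -> (forall m, Cmod (chi2 m) <= 1) ->
  0 < B -> 0 < Re nu ->
  exists L, CS (fun n => (sigma_chi (RtoC (INR k)) chi1 chi2 (S n) / cpow (INR (S n) + B) (nu + RtoC (INR k + 1))%C)%C) L.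
Proof.
  intros H1 H2 HB Hn. pose proof (pos_INR k) as Hk.
  destruct (CS_dom (fun n => (sigma_chi (RtoC (INR k)) chi1 chi2 (S n) / cpow (INR (S n) + B) (nu + RtoC (INR k + 1))%C)%C)
    (fun n => sig k (S n) * Rpower (INR (S n)) (- (INR k + 1 + Re nu)))) as [L [HL _]].
  - intros n. assert (A : 1 <= INR (S n)) by (apply (le_INR 1); lia).
    rewrite Cmod_div by apply cpow_neq0. rewrite Cmod_cpow.
    unfold Rdiv. apply Rmult_le_compat.
    + apply Cmod_ge_0.
    + apply Rlt_le, Rinv_0_lt_compat, exp_pos.
    + now apply sigma_chi_le.
    + rewrite Rpower_Ropp. apply Rinv_le_contravar; [apply exp_pos|].
      replace (Re (nu + RtoC (INR k + 1))%C) with (INR k + 1 + Re nu)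
        by (unfold Cplus, RtoC, Re; simpl; ring).
      apply Rle_Rpower_l; lra.
  - apply sig_ex_series. lra.
  - now exists L.
Qed.

Lemma Cinv_Ci : (/ Ci)%C = (- Ci)%C.
Proof. unfold Cinv, Copp, Ci; simpl. f_equal; field. Qed.

Lemma RtoC_Cexp_ln r : 0 < r -> RtoC r = Cexp (RtoC (ln r)).
Proof. intros H. now rewrite Cexp_RtoC, exp_ln. Qed.

Lemma bessel_constant k p q (a x : R) (nu t1 t2 G : C) sgn : (1 <= p)%nat -> (1 <= q)%nat ->
  0 < a -> 0 < x ->
  (RtoC (/ 2) * cpow (a * sqrt x / 2) nu * (t1 * t2 * RtoC (- (INR p ^ k / INR q ^ S k)) * (RtoC (sgn * (2 * PI / INR p) ^ S k) * Ci) * (G * cpow (4 * PI ^ 2 / (INR p * INR q)) (- (nu + RtoC (INR k + 1)))%C)))%C =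
  (RtoC sgn * cpow (a * INR q) nu * cpow (INR p) (nu + RtoC (INR k))%C * cpow x (nu / 2)%C / (Ci * cpow 2 (3 * nu + RtoC (INR k + 2))%C * cpow PI (2 * nu + RtoC (INR k + 1))%C) * t1 * t2 * G)%C.
Proof.
  intros Hp Hq Ha Hx.
  assert (HpR : 0 < INR p) by (apply lt_0_INR; lia).
  assert (HqR : 0 < INR q) by (apply lt_0_INR; lia).
  pose proof PI_RGT_0 as Hpi.
  assert (H2 : RtoC 2 <> RtoC 0) by (apply RtoC_neq0; lra).
  assert (Hsx : 0 < sqrt x) by now apply sqrt_lt_R0.
  assert (Ls : ln (sqrt x) = ln x / 2).
  { assert (T : ln x = ln (sqrt x) + ln (sqrt x)) by (rewrite <- ln_mult, sqrt_sqrt; auto; lra). lra. }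
  assert (L1 : ln (a * sqrt x / 2) = ln a + ln x / 2 - ln 2).
  { rewrite ln_div, ln_mult, Ls by (auto; nra). ring. }
  assert (L2 : ln (4 * PI ^ 2 / (INR p * INR q)) = 2 * ln 2 + 2 * ln PI - ln (INR p) - ln (INR q)).
  { replace 4 with (2 * 2) by ring. rewrite ln_div, !ln_mult by (try nra; repeat apply Rmult_lt_0_compat; try apply pow_lt; lra).
    replace (PI ^ 2) with (PI * PI) by ring. rewrite ln_mult by lra. ring. }
  assert (L3 : RtoC (INR p ^ k / INR q ^ S k * (2 * PI / INR p) ^ S k) =
    Cexp (RtoC (INR k * ln (INR p) - (INR k + 1) * ln (INR q) + (INR k + 1) * (ln 2 + ln PI - ln (INR p))))).
  { assert (P1 : 0 < 2 * PI / INR p) by (apply Rdiv_lt_0_compat; lra).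
    rewrite RtoC_Cexp_ln.
    - do 2 f_equal. rewrite ln_mult, ln_div, !ln_pow, ln_div, ln_mult, S_INR
        by (auto; try (apply Rdiv_lt_0_compat); try apply pow_lt; lra). ring.
    - apply Rmult_lt_0_compat; [apply Rdiv_lt_0_compat|]; apply pow_lt; auto. }
  (* The minus sign left by the opposite parities joins [Ci], and -i = 1/i gives the i in the
     denominator. All positive factors become exponentials of logarithms, whose exponents are then
     compared. *)
  replace (t1 * t2 * RtoC (- (INR p ^ k / INR q ^ S k)) * (RtoC (sgn * (2 * PI / INR p) ^ S k) * Ci))%C with
    (t1 * t2 * (RtoC sgn * (- Ci)) * RtoC (INR p ^ k / INR q ^ S k * (2 * PI / INR p) ^ S k))%C.
  2:{ rewrite RtoC_opp, !RtoC_mult. ring. }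
  rewrite L3, (RtoC_Cexp_ln (/ 2)) by lra. rewrite ln_Rinv by lra.
  unfold Cdiv. rewrite !Cinv_mult by (try apply Cmult_neq_0; try apply cpow_neq0; intros E; injection E; lra).
  rewrite Cinv_Ci. unfold cpow. rewrite <- !Cexp_opp.
  rewrite L1, L2, (ln_mult a (INR q)) by auto.
  set (E1 := (Cexp (RtoC (- ln 2)) * _)%C).
  match goal with |- _ = ?rhs => set (RHS := rhs) end.
  assert (HL : forall e1 e2 e3 e4, (Cexp e1 * Cexp e2 * (t1 * t2 * (RtoC sgn * (- Ci)) * Cexp e3 * (G * Cexp e4)))%C =
    (t1 * t2 * (RtoC sgn * (- Ci)) * G * Cexp (e1 + e2 + (e3 + e4))%C)%C).
  { intros. rewrite !Cexp_plus. ring. }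
  unfold E1. rewrite HL. unfold RHS.
  assert (HR : forall e1 e2 e3 e4 e5,
    (RtoC sgn * Cexp e1 * Cexp e2 * Cexp e3 * ((- Ci) * Cexp e4 * Cexp e5) * t1 * t2 * G)%C =
    (t1 * t2 * (RtoC sgn * (- Ci)) * G * Cexp (e1 + e2 + (e3 + (e4 + e5)))%C)%C).
  { intros. rewrite !Cexp_plus. ring. }
  rewrite HR. do 2 f_equal.
  unfold Rdiv.
  repeat (rewrite ?RtoC_plus, ?RtoC_minus, ?RtoC_mult, ?RtoC_opp, ?RtoC_inv by lra).
  field.
Qed.

Theorem theorem2p16 (k : nat) (p q : nat) (chi1 chi2 : Z -> C) (a x : R) (nu : C) :
  Nat.Even k ->
  primitive_char p chi1 -> primitive_char q chi2 ->
  ((even_char chi1 /\ ~ principal_char p chi1 /\ odd_char chi2) \/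
   (even_char chi2 /\ ~ principal_char q chi2 /\ odd_char chi1)) ->
  0 < a -> 0 < x -> 0 < Re nu ->
  exists L : C,
    is_series (fun m : nat =>
        let n := S m in
        Cdiv (sigma_chi (RtoC (INR k)) (conj_char chi2) (conj_char chi1) n)
             (cpow (INR n + a ^ 2 * INR p * INR q * x / (16 * PI ^ 2))
                   (Cplus nu (RtoC (INR k + 1))))) L /\
    is_series (fun m : nat =>
        let n := S m in
        Cmult (Cmult (sigma_chi (RtoC (INR k)) chi1 chi2 n)
                     (cpow (INR n) (Cdiv nu (RtoC 2))))
              (BesselK nu (a * sqrt (INR n * x))))
      (Cmult
        (Cmult
          (Cmult
            (Cmult
              (Cdiv
                (Cmult (Cmult (Cmult (RtoC ((-1) ^ (k / 2)))
                                     (cpow (a * INR q) nu))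
                              (cpow (INR p) (Cplus nu (RtoC (INR k)))))
                       (cpow x (Cdiv nu (RtoC 2))))
                (Cmult (Cmult Ci
                              (cpow 2 (Cplus (Cmult (RtoC 3) nu) (RtoC (INR k + 2)))))
                       (cpow PI (Cplus (Cmult (RtoC 2) nu) (RtoC (INR k + 1))))))
              (gauss_sum p chi1))
            (gauss_sum q chi2))
          (CGamma (Cplus nu (RtoC (INR k + 1)))))
        L).
Proof.
  intros Hk Hc1 Hc2 Hpar Ha Hx Hnu.
  pose proof Hc1 as [Hd1 _]. pose proof Hc2 as [Hd2 _].
  assert (HE : exists e1 e2, chi1 (-1)%Z = RtoC e1 /\ chi2 (-1)%Z = RtoC e2 /\
     e1 * e1 = 1 /\ e2 * e2 = 1 /\ e1 * e2 = -1 /\ (1 < p)%nat /\ (1 < q)%nat).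
  { destruct Hpar as [[H1 [H2 H3]]|[H1 [H2 H3]]].
    - exists 1, (-1). repeat split; auto; try lra.
      + now apply (nonprincipal_modulus p chi1).
      + now apply (odd_char_modulus q chi2).
    - exists (-1), 1. repeat split; auto; try lra.
      + now apply (odd_char_modulus p chi1).
      + now apply (nonprincipal_modulus q chi2). }
  destruct HE as [e1 [e2 [E1 [E2 [S1 [S2 [S12 [Hp Hq]]]]]]]].
  pose proof PI_RGT_0 as Hpi. pose proof (pos_INR k) as HkR.
  assert (HpR : 0 < INR p) by (apply lt_0_INR; lia).
  assert (HqR : 0 < INR q) by (apply lt_0_INR; lia).
  set (b := a ^ 2 * x / 4).
  set (cc := 4 * PI ^ 2 / (INR p * INR q)).
  set (B0 := a ^ 2 * INR p * INR q * x / (16 * PI ^ 2)).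
  assert (Ha2 : 0 < a ^ 2) by now apply pow_lt.
  assert (Hpi2 : 0 < PI ^ 2) by now apply pow_lt.
  assert (Hb : 0 < b) by (unfold b; apply Rdiv_lt_0_compat; [apply Rmult_lt_0_compat|]; lra).
  assert (Hcc : 0 < cc) by (unfold cc; apply Rdiv_lt_0_compat; apply Rmult_lt_0_compat; lra).
  assert (HB0 : 0 < B0).
  { unfold B0. apply Rdiv_lt_0_compat; [|apply Rmult_lt_0_compat; lra].
    apply Rmult_lt_0_compat; [|lra]. apply Rmult_lt_0_compat; [|lra]. apply Rmult_lt_0_compat; lra. }
  (* Hence b + cc n = cc (n + B0): this is the origin of the shift in the dual series. *)
  assert (Ebc : b = cc * B0) by (unfold b, cc, B0; field; lra).
  set (s' := (nu + RtoC (INR k + 1))%C).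
  assert (Hs' : 0 < Re s') by (unfold s', Cplus, RtoC, Re in *; simpl; lra).
  set (A := fun n => sigma_chi (RtoC (INR k)) chi1 chi2 (S n)).
  set (A' := fun n => sigma_chi (RtoC (INR k)) (conj_char chi2) (conj_char chi1) (S n)).
  assert (HA : forall n, Cmod (A n) <= sig k (S n)).
  { intros n. apply sigma_chi_le; intros m; [now apply (char_mod_le1 p)|now apply (char_mod_le1 q)]. }
  assert (HA' : forall n, Cmod (A' n) <= sig k (S n)).
  { intros n. apply sigma_chi_le; intros m; [now apply (conj_char_le1 q)|now apply (conj_char_le1 p)]. }
  destruct (sigma_shifted_summable k (conj_char chi2) (conj_char chi1) B0 nu) as [L HL]; auto.
  { intros m; now apply (conj_char_le1 q). }
  { intros m; now apply (conj_char_le1 p). }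
  exists L. split; [now apply CS_is_series in HL|].
  set (z := fun n => a * sqrt (INR (S n) * x)).
  assert (HN : forall n, 1 <= INR (S n)) by (intros n; apply (le_INR 1); lia).
  assert (Hz : forall n, 0 < z n).
  { intros n. apply Rmult_lt_0_compat; auto. apply sqrt_lt_R0, Rmult_lt_0_compat; auto.
    specialize (HN n). lra. }
  assert (Ez : forall n, z n * z n = 4 * b * INR (S n)).
  { intros n. unfold z, b.
    replace (a * sqrt (INR (S n) * x) * (a * sqrt (INR (S n) * x))) with
      (a ^ 2 * (sqrt (INR (S n) * x) * sqrt (INR (S n) * x))) by ring.
    rewrite sqrt_sqrt by (specialize (HN n); nra). field. }
  (* [BesselK_integral] solved for the integral. *)
  set (I := fun n => (2 * cpow (z n / (2 * b)) nu * BesselK nu (z n))%C).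
  assert (HI : forall n, integral_on (Fc nu b (INR (S n))) (I n)).
  { intros n. destruct (Fc_integrable nu b (INR (S n)) Hnu Hb ltac:(specialize (HN n); lra)) as [l Hl].
    replace (I n) with l; auto. unfold I.
    rewrite (BesselK_integral nu b (INR (S n)) (z n) l Hb (Hz n) (Ez n) Hl).
    rewrite cpow_opp, RtoC_inv by lra. field. apply cpow_neq0. }
  set (t1 := gauss_sum p chi1). set (t2 := gauss_sum q chi2).
  set (sgn := (-1) ^ (k / 2)).
  set (C1 := (t1 * t2 * RtoC (- (INR p ^ k / INR q ^ S k)) * (RtoC (sgn * (2 * PI / INR p) ^ S k) * Ci))%C).
  set (Lh := (CGamma s' * cpow cc (- s')%C * L)%C).
  assert (HIf : CS (fun n => (A n * I n)%C) (C1 * Lh)%C).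
  { destruct (bessel_side_bound nu b k Hnu Hb) as [Kf HKf].
    destruct (gamma_side_bound nu b cc k Hnu Hb Hcc) as [Kh HKh].
    assert (Hg : forall w, 0 < w -> 0 < gd (Re nu / 2) w) by (intros; apply gd_pos; lra).
    apply (integral_series_compare
      (fun n w => (A n * Fc nu b (INR (S n)) w)%C)
      (fun n w => (A' n * Fc s' (b + cc * INR (S n)) 0 w)%C)
      (fun n => (A n * I n)%C)
      (fun n => (A' n * (cpow (b + cc * INR (S n)) (- s')%C * CGamma s'))%C)
      (fun n => sig k (S n) * Rpower (INR (S n)) (- (INR k + 1 + Re nu / 2)))
      Kf Kh (Re nu / 2) C1 Lh).
    - lra.
    - apply sig_ex_series. lra.
    - intros n. apply integral_on_scal, HI.
    - intros n. apply integral_on_scal, CGamma_scale; auto.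
      specialize (HN n). assert (0 < cc * INR (S n)) by (apply Rmult_lt_0_compat; lra). lra.
    - intros n w Hw. rewrite Cmod_mult.
      replace (Kf * gd (Re nu / 2) w * (sig k (S n) * Rpower (INR (S n)) (- (INR k + 1 + Re nu / 2)))) with
        (sig k (S n) * (Kf * gd (Re nu / 2) w * Rpower (INR (S n)) (- (INR k + 1 + Re nu / 2)))) by ring.
      apply Rmult_le_compat; auto using Cmod_ge_0.
    - intros n w Hw. rewrite Cmod_mult.
      replace (Kh * gd (Re nu / 2) w * (sig k (S n) * Rpower (INR (S n)) (- (INR k + 1 + Re nu / 2)))) with
        (sig k (S n) * (Kh * gd (Re nu / 2) w * Rpower (INR (S n)) (- (INR k + 1 + Re nu / 2)))) by ring.
      apply Rmult_le_compat; auto using Cmod_ge_0.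
    - intros w Hw. assert (Hiw : 0 < / w) by now apply Rinv_0_lt_compat.
      (* At u = 1/w the dual argument is linear in w, and the automorphy factor contributes w^(k+1),
         which raises the exponent from nu to nu + k + 1. *)
      destruct (lambert_transform k p q chi1 chi2 e1 e2 (/ w)) as [G [G1 G2]]; auto.
      exists (cpow w (s' - 1)%C * RtoC (exp (- (b * w))) * G)%C. split.
      + eapply CS_ext; [|apply (CS_scal (cpow w (s' - 1)%C * RtoC (exp (- (b * w))))%C _ _ G1)].
        intros n. cbv beta. unfold Fc. fold (A' n).
        replace (- ((b + cc * INR (S n)) * w) - 0 / w) with
          (- (b * w) + - (INR (S n) * (4 * PI ^ 2 / (INR p * INR q * / w)))) by (unfold cc; field; lra).
        rewrite exp_plus, RtoC_mult. ring.
      + rewrite (eis_factor_even k p (/ w) Hk) in G2. fold sgn t1 t2 in G2.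
        replace (C1 * (cpow w (s' - 1)%C * RtoC (exp (- (b * w))) * G))%C with
          (cpow w (nu - 1)%C * RtoC (exp (- (b * w))) * (t1 * t2 * RtoC (- (INR p ^ k / INR q ^ S k)) * (RtoC (sgn * (2 * PI / (INR p * / w)) ^ S k) * Ci) * G))%C.
        * eapply CS_ext; [|apply (CS_scal (cpow w (nu - 1)%C * RtoC (exp (- (b * w))))%C _ _ G2)].
          intros n. cbv beta. unfold Fc. fold (A n).
          replace (- (b * w) - INR (S n) / w) with (- (b * w) + - (INR (S n) * / w)) by (unfold Rdiv; ring).
          rewrite exp_plus, RtoC_mult. ring.
        * replace (s' - 1)%C with (nu - 1 + RtoC (INR (S k)))%C
            by (unfold s'; rewrite S_INR; ring).
          rewrite cpow_plus, cpow_INR by auto.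
          replace (sgn * (2 * PI / (INR p * / w)) ^ S k) with (sgn * (2 * PI / INR p) ^ S k * w ^ S k).
          { unfold C1. rewrite !RtoC_mult. ring. }
          rewrite Rmult_assoc, <- Rpow_mult_distr. do 2 f_equal. field. lra.
    - unfold Lh.
      eapply CS_ext; [|apply (CS_scal (CGamma s' * cpow cc (- s')%C)%C _ _ HL)].
      intros n. cbv beta. fold s'. fold (A' n).
      replace (b + cc * INR (S n)) with (cc * (INR (S n) + B0)) by (rewrite Ebc; ring).
      specialize (HN n). rewrite cpow_mult, (cpow_opp (INR (S n) + B0)) by lra. unfold Cdiv. ring. }
  apply CS_is_series.
  match goal with |- CS _ (Cmult ?r L) => assert (EC : r =
    (RtoC (/ 2) * cpow (a * sqrt x / 2) nu * (C1 * (CGamma s' * cpow cc (- s')%C)))%C) end.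
  { symmetry. apply bessel_constant; auto; lia. }
  rewrite EC.
  replace (RtoC (/ 2) * cpow (a * sqrt x / 2) nu * (C1 * (CGamma s' * cpow cc (- s')%C)) * L)%C
    with (RtoC (/ 2) * cpow (a * sqrt x / 2) nu * (C1 * Lh))%C by (unfold Lh; ring).
  eapply CS_ext; [|apply (CS_scal _ _ _ HIf)].
  intros n. cbv beta zeta. fold (A n). fold (z n). unfold I. specialize (HN n). specialize (Hz n).
  assert (Hsx : 0 < sqrt x) by now apply sqrt_lt_R0.
  (* Since z/(2b) = 2 sqrt n / (a sqrt x), the weight n^(nu/2) is exactly what removes the
     dependence on n from the factor relating the Bessel function to its integral. *)
  assert (EN : cpow (INR (S n)) (nu / 2)%C = (cpow (a * sqrt x / 2) nu * cpow (z n / (2 * b)) nu)%C).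
  { rewrite <- cpow_mult by (apply Rdiv_lt_0_compat; try lra; now apply Rmult_lt_0_compat).
    assert (Es : sqrt x * sqrt x = x) by (apply sqrt_sqrt; lra).
    replace (a * sqrt x / 2 * (z n / (2 * b))) with (sqrt (INR (S n))).
    - unfold cpow. f_equal.
      assert (T : ln (INR (S n)) = ln (sqrt (INR (S n))) + ln (sqrt (INR (S n)))).
      { rewrite <- ln_mult, sqrt_sqrt; auto; try lra; apply sqrt_lt_R0; lra. }
      rewrite T, RtoC_plus. field.
    - unfold z, b. rewrite sqrt_mult by lra.
      replace (a * sqrt x / 2 * (a * (sqrt (INR (S n)) * sqrt x) / (2 * (a ^ 2 * x / 4)))) with
        (sqrt (INR (S n)) * ((sqrt x * sqrt x) / x)) by (field; lra).
      rewrite Es. field. lra. }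
  rewrite EN, RtoC_inv by lra. field.
Qed.
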